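(* Let $q=N^\kappa$ with $0<\kappa\le1/2$. Let $H=(h_{ij})$ be a real symmetric $N\times N$ random matrix with entries independent up to the symmetry constraint and with law $$\mathbb{P}\Big[h_{ij}=\tfrac{1}{\sqrt q}(1-qs_{ij})\Big]=qs_{ij},\qquad \mathbb{P}\Big[h_{ij}=-\tfrac{1}{\sqrt q}\,qs_{ij}\Big]=1-qs_{ij}.$$ Assume that $I\subset\mathbb{R}$ is a bulk interval. Fix $\delta>0$ and define $\mathcal{D}_\delta^I=\{E+\mathrm{i}\eta: E\in I,\ N^{\delta-1}\le\eta\le10\}$. Then on this domain $\Lambda\prec\Phi$ (uniformly in $z\in\mathcal{D}_\delta^I$).
   Context: Fix an integer $r\ge1$ and $M>0$. For each $N$ let $\gamma_i^{(k)}$ ($1\le k\le r$, $1\le i\le N$; they may depend on $N$) be real numbers with $\gamma_i^{(k)}\ge1$ and $\frac1N\sum_{k,i}(\gamma_i^{(k)})^2\le M$. Put $s_{ij}=\frac1N\sum_{k=1}^r\gamma_i^{(k)}\gamma_j^{(k)}$, assume $qs_{ij}\le1$ for all $i,j$, and put $\theta_i=\sum_{k=1}^r\gamma_i^{(k)}$. For $z=E+\mathrm{i}\eta$ in the open upper half plane $\mathbb{C}^+$ let $G(z)=(H-z)^{-1}$. (Here $H$ is the centered adjacency matrix, divided by $\sqrt q$, of a random graph with independent edges of probability $qs_{ij}$.) Self-consistent system. For $z\in\mathbb{C}^+$, $(u^{(1)}(z),\dots,u^{(r)}(z))\in(\mathbb{C}^+)^r$ denotes the unique solution of $u^{(k)}(z)=-\frac1N\sum_{i=1}^N\frac{\gamma_i^{(k)}}{z+\sum_{j=1}^r\gamma_i^{(j)}u^{(j)}(z)}$,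 $1\le k\le r$. Put $g_i=-\frac{1}{z+\sum_{j=1}^r\gamma_i^{(j)}u^{(j)}(z)}$ and $m(z)=\frac1N\sum_{i=1}^N g_i$. Bulk interval. A bounded interval $I\subset\mathbb{R}$ is a bulk interval if there is $c_I>0$, not depending on $N$, such that $\operatorname{Im}m(z)>c_I$ on $\{E+\mathrm{i}\eta: E\in I,\ 0<\eta\le1\}$. Control quantities. $\Lambda_d=\max_i\theta_i|G_{ii}-g_i|$, $\Lambda_o=\max_{i\ne j}\sqrt{\theta_i\theta_j}\,|G_{ij}|$, $\Lambda=\max\{\Lambda_d,\Lambda_o\}$, $\Phi=\frac1{\sqrt q}+\frac1{\sqrt{N\eta}}$. Stochastic domination. For families of random variables $X=(X^{(N)}(u))$, $Y=(Y^{(N)}(u))$, $u\in U^{(N)}$, with $Y\ge0$, $X\prec Y$ uniformly in $u$ means: for all $\varepsilon,D>0$, $\sup_{u\in U^{(N)}}\mathbb{P}[|X(u)|>N^\varepsilon Y(u)]\le N^{-D}$ for all large enough $N$. *)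

(* Defs.v *)
From HB Require Import structures.
From mathcomp Require Import all_boot all_order all_algebra.
From mathcomp Require Import all_classical all_reals all_analysis.
From mathcomp.real_closed Require Import complex.

Set Implicit Arguments.
Unset Strict Implicit.
Unset Printing Implicit Defensive.

Import Order.TTheory GRing.Theory Num.Theory.
Import numFieldNormedType.Exports.

Local Open Scope classical_set_scope.
Local Open Scope ring_scope.
Local Open Scope complex_scope.

Section Probability.
Context (R : realType).

(* [X] and [Y] are indexed by N, by a parameter in [U N] and by the sample
   point; [Y] is meant to be nonnegative. *)
Definition stoch_dom (d : nat -> measure_display)
    (T : forall N, measurableType (d N)) (P : forall N, probability (T N) R)
    (V : Type) (U : nat -> set V) (X Y : forall N, V -> T N -> R) : Prop :=
  forall eps D : R, 0 < eps -> 0 < D ->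
    \forall N \near \oo,
      (ereal_sup [set P N [set w | (N%:R `^ eps * Y N v w < `|X N v w|)%R] | v in U N]
         <= (N%:R `^ (- D))%:E)%E.

Definition mutually_independent (d : measure_display) (T : measurableType d)
    (P : probability T R) (K : finType) (A : {set K}) (X : K -> {RV P >-> R}) : Prop :=
  forall (J : {set K}) (B : K -> set R), J \subset A ->
    (forall k, measurable (B k)) ->
    (P (\bigcap_(k in [set` J]) (X k @^-1` B k))
      = \prod_(k in J) P (X k @^-1` B k))%E.

End Probability.

Section Model.
Context (R : realType).
Implicit Types (r N : nat) (z : R[i]) (kappa q eta : R).

Definition upper_half_plane : set R[i] := [set z | 0 < complex.Im z].

(* [gamma k i] stands for gamma_i^(k). *)
Definition profile r N (gamma : 'I_r -> 'I_N -> R) (i j : 'I_N) : R :=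
  N%:R^-1 * \sum_(k < r) gamma k i * gamma k j.

Definition theta r N (gamma : 'I_r -> 'I_N -> R) (i : 'I_N) : R :=
  \sum_(k < r) gamma k i.

Definition solves_system r N (gamma : 'I_r -> 'I_N -> R)
    (u : R[i] -> 'I_r -> R[i]) : Prop :=
  forall z, upper_half_plane z ->
    (forall k, upper_half_plane (u z k)) /\
    (forall k, u z k = - (N%:R^-1 * \sum_(i < N)
        ((gamma k i)%:C / (z + \sum_(j < r) (gamma j i)%:C * u z j)))).

Definition gsol r N (gamma : 'I_r -> 'I_N -> R) (u : R[i] -> 'I_r -> R[i])
    z (i : 'I_N) : R[i] :=
  - (z + \sum_(j < r) (gamma j i)%:C * u z j)^-1.

Definition msol r N (gamma : 'I_r -> 'I_N -> R) (u : R[i] -> 'I_r -> R[i])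
    z : R[i] :=
  N%:R^-1 * \sum_(i < N) gsol gamma u z i.

(* The constant c_I is uniform in N, which ranges over N >= N0: the model is
   only required to exist from N0 on. *)
Definition bulk_interval r (N0 : nat) (gamma : forall N, 'I_r -> 'I_N -> R)
    (u : nat -> R[i] -> 'I_r -> R[i]) (I : set R) : Prop :=
  [/\ is_interval I, bounded_set I &
    exists2 c : R, 0 < c &
      forall N, (N0 <= N)%N -> forall z,
        I (complex.Re z) -> 0 < complex.Im z <= 1 ->
        c < complex.Im (msol (gamma N) (u N) z)].

(* On the upper half plane H - z is invertible for real symmetric H, so
   [invmx] is the genuine inverse there. *)
Definition green N (H : 'M[R]_N) z : 'M[R[i]]_N :=
  invmx (map_mx (real_complex R) H - z%:M).

(* The maxima are over nonnegative reals, so the base value 0 only matters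
   for an empty index set. *)
Definition Lambda_d N (th : 'I_N -> R) (G : 'M[R[i]]_N) (g : 'I_N -> R[i]) : R :=
  \big[Num.max/0]_(i < N) (th i * Normc.normc (G i i - g i)).

Definition Lambda_o N (th : 'I_N -> R) (G : 'M[R[i]]_N) : R :=
  \big[Num.max/0]_(ij : 'I_N * 'I_N | ij.1 != ij.2)
    (Num.sqrt (th ij.1 * th ij.2) * Normc.normc (G ij.1 ij.2)).

Definition Lambda r N (gamma : 'I_r -> 'I_N -> R) (u : R[i] -> 'I_r -> R[i])
    (H : 'M[R]_N) z : R :=
  Num.max (Lambda_d (theta gamma) (green H z) (gsol gamma u z))
          (Lambda_o (theta gamma) (green H z)).

Definition Phi N q eta : R := (Num.sqrt q)^-1 + (Num.sqrt (N%:R * eta))^-1.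

Definition spectral_domain (I : set R) (delta : R) N : set R[i] :=
  [set z | I (complex.Re z) /\ N%:R `^ (delta - 1) <= complex.Im z <= 10].

End Model.

Section Matrix.
Context (R : realType) (d : measure_display) (T : measurableType d)
  (P : probability T R) (N : nat).

Definition sample_matrix (h : 'I_N -> 'I_N -> {RV P >-> R}) (w : T) : 'M[R]_N :=
  \matrix_(i, j) h i j w.

Definition centered_adjacency (q : R) (s : 'I_N -> 'I_N -> R)
    (h : 'I_N -> 'I_N -> {RV P >-> R}) : Prop :=
  [/\ (forall i j w, h i j w = h j i w),
      mutually_independent [set ij : 'I_N * 'I_N | (ij.1 <= ij.2)%N]%SET
        (fun ij => h ij.1 ij.2) &
      forall i j,
        P (h i j @^-1` [set (Num.sqrt q)^-1 * (1 - q * s i j)])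
          = (q * s i j)%:E /\
        P (h i j @^-1` [set - ((Num.sqrt q)^-1 * (q * s i j))])
          = (1 - q * s i j)%:E].

End Matrix.

(* Main.v *)
Require Import Defs.
From HB Require Import structures.
From mathcomp Require Import all_boot all_order all_algebra.
From mathcomp Require Import all_classical all_reals all_analysis.
From mathcomp.real_closed Require Import complex.
From mathcomp Require Import measurable_realfun.
From mathcomp Require Import ring lra.

Import Order.TTheory GRing.Theory Num.Theory.
Import numFieldNormedType.Exports.

Set Implicit Arguments.
Unset Strict Implicit.
Unset Printing Implicit Defensive.

Local Open Scope classical_set_scope.
Local Open Scope ring_scope.

(** The comparison of the resolvent [G] of [H] with the solution of the
    self-consistent system has three ingredients.

    _Stability of the system_.  Put [v_k = 1/N sum_i gamma_i^(k) G_ii].  A Schur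
    complement formula gives [-1/G_ii = z + sum_j gamma_i^(j) v_j + eps_i], so [v]
    solves the system up to an error controlled by [max_i |eps_i| / theta_i].  For
    two approximate solutions [a] and [b] with imaginary parts bounded below, the
    difference [x = a - b] satisfies [(1 - T) x = error] with
    [x^* T x = 1/N sum_i alpha_i beta_i |gamma_i . x|^2], where [alpha_i] and
    [beta_i] are the values of [-1/(z + gamma_i . a)] and [-1/(z + gamma_i . b)].
    In the bulk these point away from the real axis, so that
    [Re (alpha_i beta_i) <= (1 - 2 c^2) |alpha_i beta_i|], whereas the imaginary
    part of the system itself (a Schur test with the positive vector [Im a]) shows
    that the form with weights [|alpha_i|^2] is at most the identity.  Hence
    [Re x^* (1 - T) x >= c^2 |x|^2]: this is [stability], and
    [self_consistent_stable] turns it into a bound on [theta_i |G_ii - g_i|].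
    Since [gamma >= 1], the lower bound on [Im m] is a lower bound on every [Im u_k].

    _Large deviations_.  Conditionally on the minor obtained by deleting row [i],
    both [G_ij / G_ii] and [eps_i] are linear or quadratic forms in the entries of
    row [i], which are bounded by [q^(-1/2)] and have variance at most [s_ij].  An
    exponential martingale inequality ([bernstein]) bounds the linear forms; the
    quadratic form is a linear form whose coefficients are partial sums of the same
    row, truncated so as to be bounded and predictable.  The resulting
    [good_event] fails with probability at most [16 N^2 exp ((1 - t) / 2)], without
    any a priori information on the minor.  Because independence makes the law of
    the matrix the image of a product measure on two-point spaces, all expectations
    are finite sums ([transfer] passes to this model).

    _Bootstrap_.  On the good event, a priori bounds at [z] improve themselves.  The
    variance of the forms involves the weighted sum
    [1/N sum_b theta_a theta_b |G_ab|^2], in which the [theta_b] may grow like a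
    power of [N].  It is split at [theta_b = t^2]: below, the Ward identity gives
    [t^2 / (N eta)]; above, the bounded second moment of [theta] makes the indices
    so rare that the contribution is at most [Lambda_o^2 / t^4].  Thus
    [Lambda_o <= C t (q^(-1/2) + Lambda_o / t^2 + t / sqrt (N eta))], which yields
    [Lambda_o <= C t^2 Phi] and then [Lambda <= C t^3 Phi] ([bulk_step]).  At height
    10 no a priori bound is needed, the trivial bound on the resolvent and
    [s_ij <= 1/q] suffice ([base_step]); the resolvent being Lipschitz, the estimate
    is carried down a fine vertical grid ([vertical_bootstrap]), and a union
    bound over the grid with [t] a small power of [N] concludes. *)

Local Notation Re := complex.Re.
Local Notation Im := complex.Im.
Local Notation "n[ x ]" := (Normc.normc x) (at level 0, format "n[ x ]").
Local Notation "x %:C" := (real_complex _ x) : ring_scope.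

(** * Complex numbers through their real and imaginary parts *)

Section ComplexFacts.
Context (R : rcfType).
Implicit Types (x y z : R[i]) (a : R).

Lemma ReD x y : Re (x + y) = Re x + Re y. Proof. by case: x; case: y. Qed.
Lemma ImD x y : Im (x + y) = Im x + Im y. Proof. by case: x; case: y. Qed.
Lemma ImN x : Im (- x) = - Im x. Proof. by case: x. Qed.
Lemma ReM x y : Re (x * y) = Re x * Re y - Im x * Im y.
Proof. by case: x; case: y. Qed.
Lemma ImM x y : Im (x * y) = Re x * Im y + Im x * Re y.
Proof. by case: x => a b; case: y => c d /=; rewrite [b * c]mulrC. Qed.
Lemma ReCM a x : Re (a%:C * x) = a * Re x. Proof. by rewrite ReM /= mul0r subr0. Qed.
Lemma ImCM a x : Im (a%:C * x) = a * Im x. Proof. by rewrite ImM /= mul0r addr0. Qed.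

Lemma Re_sum I (s : seq I) (P : pred I) (F : I -> R[i]) :
  Re (\sum_(i <- s | P i) F i) = \sum_(i <- s | P i) Re (F i).
Proof. by apply: (big_morph _ ReD). Qed.
Lemma Im_sum I (s : seq I) (P : pred I) (F : I -> R[i]) :
  Im (\sum_(i <- s | P i) F i) = \sum_(i <- s | P i) Im (F i).
Proof. by apply: (big_morph _ ImD). Qed.

Lemma natCE n : (n%:R : R[i]) = (n%:R : R)%:C.
Proof. by rewrite rmorph_nat. Qed.

Lemma natVCE n : (n%:R^-1 : R[i]) = (n%:R^-1 : R)%:C.
Proof. by rewrite fmorphV rmorph_nat. Qed.

Lemma complex_ext x y : Re x = Re y -> Im x = Im y -> x = y.
Proof. by case: x; case: y => a b c d /= -> ->. Qed.

Lemma normc_ge0 x : 0 <= n[x].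
Proof. by case: x => a b; exact: sqrtr_ge0. Qed.

Lemma normc_sqr x : n[x] ^+ 2 = Re x ^+ 2 + Im x ^+ 2.
Proof. by case: x => a b /=; rewrite sqr_sqrtr ?addr_ge0 ?sqr_ge0. Qed.

Lemma normc_gt0 x : (0 < n[x]) = (x != 0).
Proof.
rewrite lt0r normc_ge0 andbT; congr (~~ _).
by apply/eqP/eqP => [/Normc.eq0_normc //|->]; rewrite Normc.normc0.
Qed.

Lemma normcC a : n[a%:C] = `|a|.
Proof. by rewrite /= expr0n addr0 sqrtr_sqr. Qed.

Lemma normcCM a x : 0 <= a -> n[a%:C * x] = a * n[x].
Proof. by move=> a0; rewrite Normc.normcM normcC ger0_norm. Qed.

Lemma Re_le_normc x : `|Re x| <= n[x].
Proof.
by rewrite -(ler_pXn2r (ltn0Sn 1)) ?nnegrE ?normc_ge0 // normc_sqr real_normK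
  ?num_real // lerDl sqr_ge0.
Qed.

Lemma Im_le_normc x : `|Im x| <= n[x].
Proof.
by rewrite -(ler_pXn2r (ltn0Sn 1)) ?nnegrE ?normc_ge0 // normc_sqr real_normK
  ?num_real // lerDr sqr_ge0.
Qed.

Lemma normc_le_ReIm x : n[x] <= `|Re x| + `|Im x|.
Proof.
rewrite -(ler_pXn2r (ltn0Sn 1)) ?nnegrE ?normc_ge0 ?addr_ge0 //.
rewrite normc_sqr sqrrD !real_normK ?num_real // -addrA lerD2l lerDr.
by rewrite mulrn_wge0 // mulr_ge0.
Qed.

Lemma normcB x y : n[x - y] = n[y - x].
Proof. by rewrite -normcN opprB. Qed.

Lemma normcD x y : n[x + y] <= n[x] + n[y].
Proof. exact: le_normcD. Qed.

Lemma normcBD x y : n[x - y] <= n[x] + n[y].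
Proof. by rewrite (le_trans (normcD _ _)) // normcN. Qed.

Lemma normc_distD y x z : n[x - z] <= n[x - y] + n[y - z].
Proof. by rewrite (le_trans _ (normcD _ _)) // addrA subrK. Qed.

Lemma normc_lower x y : n[x] - n[y] <= n[x - y].
Proof. by rewrite lerBlDr -{1}[x](subrK y) normcD. Qed.

Lemma normc_sum I (s : seq I) (P : pred I) (F : I -> R[i]) :
  n[\sum_(i <- s | P i) F i] <= \sum_(i <- s | P i) n[F i].
Proof.
elim/big_rec2: _ => [|i y1 y2 _ le]; first by rewrite Normc.normc0.
by rewrite (le_trans (normcD _ _)) // lerD2l.
Qed.

Lemma normc_conj x : n[x^*%C] = n[x].
Proof. by case: x => a b /=; rewrite sqrrN. Qed.

Lemma mul_conj x : x^*%C * x = (n[x] ^+ 2)%:C.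
Proof.
rewrite normc_sqr; case: x => a b.
by apply: complex_ext => /=; [ring|ring].
Qed.

Lemma conjc_CM a x : (a%:C * x)^*%C = a%:C * x^*%C.
Proof. by case: x => b c; apply: complex_ext => /=; ring. Qed.

Lemma Im_oppV x : Im (- x^-1) = Im x / n[x] ^+ 2.
Proof. by rewrite normc_sqr; case: x => a b /=; rewrite opprK. Qed.

Lemma normc_le_sqr x a : 0 <= a -> n[x] ^+ 2 <= a ^+ 2 -> n[x] <= a.
Proof. by move=> a0; rewrite ler_pXn2r ?nnegrE ?normc_ge0. Qed.

End ComplexFacts.

(** * Resolvents of real symmetric matrices *)

Section Resolvent.
Context (R : realType) (N : nat).
Implicit Types (H : 'M[R]_N) (z : R[i]).

Definition sym_mx H := forall a b, H a b = H b a.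

Lemma Im_hermitian_form H (f : 'I_N -> R[i]) : sym_mx H ->
  Im (\sum_a \sum_x (H a x)%:C * f x * (f a)^*%C) = 0.
Proof.
move=> Hs; set S := Im _.
have E1 : S = \sum_a \sum_x H a x * (Im (f x) * Re (f a) - Re (f x) * Im (f a)).
  rewrite /S Im_sum; apply: eq_bigr => a _; rewrite Im_sum; apply: eq_bigr => x _.
  by rewrite -mulrA ImCM; case: (f x) => c d; case: (f a) => c' d' /=; congr (_ * _); ring.
have E2 : S = - S.
  rewrite {1}E1 exchange_big E1 -sumrN; apply: eq_bigr => a _.
  rewrite -sumrN; apply: eq_bigr => x _; rewrite Hs; ring.
lra.
Qed.

(** A vector in the kernel of [H - z] would give the real form of [H] the
    nonzero imaginary part [Im z |v|^2]. *)
Lemma green_unit H z : sym_mx H -> 0 < Im z ->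
  map_mx (real_complex R) H - z%:M \in unitmx.
Proof.
move=> Hs z0; rewrite -row_free_unit -kermx_eq0.
apply/rowV0P => v /sub_kermxP; rewrite mulmxBr => /eqP; rewrite subr_eq0 => /eqP E.
have Ex (x : 'I_N) : \sum_a v 0 a * (H a x)%:C = z * v 0 x.
  have /rowP/(_ x) := E; rewrite mul_mx_scalar !mxE => <-.
  by apply: eq_bigr => a _; rewrite mxE.
have := Im_hermitian_form (fun x => v 0 x) Hs.
rewrite (eq_bigr (fun a => z * (n[v 0 a] ^+ 2)%:C)) => [|a _]; last first.
  rewrite -mul_conj [X in z * X]mulrC mulrA -Ex mulr_suml.
  by apply: eq_bigr => x _; rewrite Hs [X in X * _]mulrC.
rewrite -mulr_sumr -rmorph_sum mulrC ImCM => /eqP.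
rewrite mulf_eq0 (gt_eqF z0) orbF psumr_eq0 => [/allP E0|a _]; last exact: sqr_ge0.
apply/rowP => a; rewrite mxE; apply: Normc.eq0_normc; apply/eqP.
by rewrite -sqrf_eq0 (eqP (E0 a _)) // mem_index_enum.
Qed.

Lemma greenE_l H z a b : sym_mx H -> 0 < Im z ->
  \sum_x (H a x)%:C * green H z x b - z * green H z a b = (a == b)%:R.
Proof.
move=> Hs z0; have /matrixP/(_ a b) := mulmxV (green_unit Hs z0).
rewrite mulmxBl mul_scalar_mx -/(green H z) !mxE => <-.
by congr (_ - _); apply: eq_bigr => x _; rewrite mxE.
Qed.

Lemma green_sym H z a b : sym_mx H -> green H z a b = green H z b a.
Proof.
move=> Hs.
suff E : (green H z)^T = green H z by rewrite -[in RHS]E mxE.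
rewrite /green trmx_inv; congr invmx; apply/matrixP => x y.
by rewrite !mxE Hs eq_sym.
Qed.

Lemma greenE_r H z a b : sym_mx H -> 0 < Im z ->
  \sum_x green H z a x * (H x b)%:C - z * green H z a b = (a == b)%:R.
Proof.
move=> Hs z0; rewrite eq_sym -(greenE_l b a Hs z0) (green_sym z a b Hs).
by congr (_ - _); apply: eq_bigr => x _; rewrite mulrC Hs (green_sym z a x Hs).
Qed.

(** The Ward identity.  Pair [(H - z) G = 1] with the conjugate of a column of
    [G] and take imaginary parts: the form of the real symmetric [H] drops out. *)
Lemma ward H z a : sym_mx H -> 0 < Im z ->
  \sum_b n[green H z a b] ^+ 2 = Im (green H z a a) / Im z.
Proof.
move=> Hs z0; set G := green H z.
have E : \sum_b (\sum_x (H b x)%:C * G x a - z * G b a) * (G b a)^*%C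
         = (G a a)^*%C.
  rewrite (bigD1 a) //= greenE_l // eqxx mul1r big1 ?addr0 // => b /negPf ba.
  by rewrite greenE_l // ba mul0r.
have E1 : Im (- z * \sum_b (n[G b a] ^+ 2)%:C) = - Im (G a a).
  have -> : - Im (G a a) = Im (G a a)^*%C by case: (G a a).
  rewrite -E [in RHS](eq_bigr (fun b => \sum_x (H b x)%:C * G x a * (G b a)^*%C
      + - z * (n[G b a] ^+ 2)%:C)) => [|b _]; last first.
    by rewrite mulrBl mulr_suml -mul_conj mulNr; congr (_ - _); ring.
  by rewrite big_split /= ImD Im_hermitian_form // add0r -mulr_sumr.
move: E1; rewrite -rmorph_sum mulrC ImCM ImN mulrN => /oppr_inj <-.
rewrite mulfK ?gt_eqF //.
by apply: eq_bigr => b _; rewrite /G (green_sym z a b Hs).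
Qed.

Lemma green_entry_le H z a b : sym_mx H -> 0 < Im z ->
  n[green H z a b] ^+ 2 <= Im (green H z a a) / Im z.
Proof.
move=> Hs z0; rewrite -ward // (bigD1 b) //= lerDl.
by apply: sumr_ge0 => c _; exact: sqr_ge0.
Qed.

Lemma Im_green_ge0 H z a : sym_mx H -> 0 < Im z -> 0 <= Im (green H z a a).
Proof.
move=> Hs z0; rewrite -(pmulr_lge0 (x := (Im z)^-1)) ?invr_gt0 //.
by rewrite -ward // sumr_ge0 // => b _; exact: sqr_ge0.
Qed.

Lemma green_diag_le H z a : sym_mx H -> 0 < Im z -> n[green H z a a] <= (Im z)^-1.
Proof.
move=> Hs z0; have := green_entry_le a a Hs z0.
set g := green H z a a => le1.
have [->|g0] := eqVneq n[g] 0; first by rewrite invr_ge0 ltW.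
have gp : 0 < n[g] by rewrite lt0r g0 normc_ge0.
rewrite -(ler_pM2l gp) -expr2 (le_trans le1) // ler_pM2r ?invr_gt0 //.
exact: le_trans (ler_norm _) (Im_le_normc _).
Qed.

Lemma green_le H z a b : sym_mx H -> 0 < Im z -> n[green H z a b] <= (Im z)^-1.
Proof.
move=> Hs z0; apply: normc_le_sqr; first by rewrite invr_ge0 ltW.
rewrite (le_trans (green_entry_le a b Hs z0)) // expr2 ler_pM2r ?invr_gt0 //.
apply: le_trans (green_diag_le a Hs z0).
exact: le_trans (ler_norm _) (Im_le_normc _).
Qed.

(** Cauchy-Schwarz in the first resolvent identity
    [G(z) - G(z') = (z - z') G(z) G(z')], together with the Ward identity. *)
Lemma green_lip H z z' a b : sym_mx H -> 0 < Im z -> 0 < Im z' ->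
  n[green H z a b - green H z' a b] <= n[z - z'] * ((Im z)^-1 * (Im z')^-1) *+ N.
Proof.
move=> Hs z0 z0'; set G := green H z; set G' := green H z'.
have E : G a b - G' a b = (z - z') * \sum_x G a x * G' x b.
  have E1 : G' a b = \sum_x (\sum_y G a y * (H y x)%:C - z * G a x) * G' x b.
    rewrite (bigD1 a) //= greenE_r // eqxx mul1r big1 ?addr0 // => x /negPf xa.
    by rewrite greenE_r // eq_sym xa mul0r.
  have E2 : G a b = \sum_x G a x * (\sum_y (H x y)%:C * G' y b - z' * G' x b).
    rewrite (bigD1 b) //= greenE_l // eqxx mulr1 big1 ?addr0 // => x /negPf xa.
    by rewrite greenE_l // xa mulr0.
  rewrite E1 E2 mulr_sumr.
  under eq_bigr do rewrite mulrBr mulr_sumr.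
  under [X in _ - X]eq_bigr do rewrite mulrBl mulr_suml.
  rewrite !sumrB exchange_big /=.
  have -> : \sum_j \sum_i G a i * ((H i j)%:C * G' j b)
     = \sum_i \sum_j G a j * (H j i)%:C * G' i b.
    by apply: eq_bigr => i _; apply: eq_bigr => j _; rewrite mulrA.
  rewrite opprB addrC addrA subrK -sumrB; apply: eq_bigr => i _; ring.
rewrite E Normc.normcM -mulrnAr ler_wpM2l ?normc_ge0 //.
rewrite (le_trans (normc_sum _ _ _)) // -[X in _ *+ X]card_ord -sumr_const.
apply: ler_sum => x _; rewrite Normc.normcM ler_pM ?normc_ge0 //; exact: green_le.
Qed.

(** Deleting the [i]-th row and column is implemented by zeroing them, which
    keeps the index set; off [i] this gives the resolvent of the deleted matrix. *)
Definition minor_mx (i : 'I_N) H : 'M[R]_N :=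
  \matrix_(a, b) (if (a == i) || (b == i) then 0 else H a b).

Lemma minor_mx_sym i H : sym_mx H -> sym_mx (minor_mx i H).
Proof. by move=> Hs a b; rewrite !mxE orbC Hs. Qed.

Lemma green_minor_row0 i H z b : sym_mx H -> 0 < Im z -> b != i ->
  green (minor_mx i H) z i b = 0.
Proof.
move=> Hs z0 bi; have := greenE_l i b (minor_mx_sym i Hs) z0.
rewrite big1 => [|x _]; last by rewrite mxE eqxx mul0r.
rewrite eq_sym (negPf bi) sub0r => /eqP; rewrite oppr_eq0 mulf_eq0.
by case/orP => /eqP // zE; move: z0; rewrite zE ltxx.
Qed.

Lemma green_minor_resolvent i H z c j : sym_mx H -> 0 < Im z -> j != i ->
  green (minor_mx i H) z c j = green H z c j
    + green H z c i * \sum_(a | a != i) (H i a)%:C * green (minor_mx i H) z a j.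
Proof.
move=> Hs z0 ji; set G := green H z; set Gi := green (minor_mx i H) z.
have His := minor_mx_sym i Hs.
have E1 : Gi c j = \sum_x (\sum_y G c y * (H y x)%:C - z * G c x) * Gi x j.
  rewrite (bigD1 c) //= greenE_r // eqxx mul1r big1 ?addr0 // => x /negPf xa.
  by rewrite greenE_r // eq_sym xa mul0r.
have E2 : Gi c j = \sum_y G c y * (\sum_x (H y x)%:C * Gi x j - z * Gi y j).
  rewrite E1.
  under eq_bigr do rewrite mulrBl mulr_suml.
  under [RHS]eq_bigr do rewrite mulrBr mulr_sumr.
  rewrite !sumrB exchange_big /=; congr (_ - _).
    by apply: eq_bigr => y _; apply: eq_bigr => x _; rewrite mulrA.
  by apply: eq_bigr => y _; ring.
rewrite {}E2 (bigD1 i) //= addrC; congr (_ + _); last first.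
  rewrite green_minor_row0 // mulr0 subr0; congr (_ * _).
  by rewrite (bigD1 i) //= green_minor_row0 // mulr0 add0r.
have H1 y : y != i -> \sum_x (H y x)%:C * Gi x j - z * Gi y j = (y == j)%:R.
  move=> yi; rewrite -(greenE_l y j His z0); congr (_ - _).
  apply: eq_bigr => x _; rewrite mxE (negPf yi) /=; case: eqP => [->|//].
  by rewrite /Gi green_minor_row0 // !mulr0.
rewrite (eq_bigr (fun y => G c y * (y == j)%:R)) => [|y yi]; last by rewrite H1.
rewrite (bigD1 j) //= eqxx mulr1 big1 ?addr0 // => y /andP[_ /negPf ->].
by rewrite mulr0.
Qed.

(** These Schur complement formulas separate the entries of row [i] from the
    minor: for a random matrix the two are independent, which is what makes the
    sums below accessible to large deviation estimates. *)
Lemma schur_offdiag i H z j : sym_mx H -> 0 < Im z -> j != i ->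
  green H z i j
    = - (green H z i i * \sum_(a | a != i) (H i a)%:C * green (minor_mx i H) z a j).
Proof.
move=> Hs z0 ji; have := green_minor_resolvent i Hs z0 ji.
by rewrite green_minor_row0 // => /eqP; rewrite eq_sym addr_eq0 => /eqP.
Qed.

Lemma schur_minor i H z c j : sym_mx H -> 0 < Im z -> j != i ->
  green H z i i * green (minor_mx i H) z c j
    = green H z i i * green H z c j - green H z c i * green H z i j.
Proof.
move=> Hs z0 ji; rewrite (green_minor_resolvent c Hs z0 ji) (schur_offdiag Hs z0 ji).
by rewrite mulrN opprK mulrDr; congr (_ + _); ring.
Qed.

Lemma schur_diag i H z : sym_mx H -> 0 < Im z ->
  green H z i i * ((H i i)%:C - z -
    \sum_(x | x != i) \sum_(a | a != i)
      (H i x)%:C * (H i a)%:C * green (minor_mx i H) z a x) = 1.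
Proof.
move=> Hs z0; have := greenE_l i i Hs z0; rewrite eqxx (bigD1 i) //= => E; apply: etrans E.
set G := green H z; set Gi := green (minor_mx i H) z.
have -> : \sum_(x | x != i) (H i x)%:C * G x i
    = - (G i i * \sum_(x | x != i) \sum_(a | a != i) (H i x)%:C * (H i a)%:C * Gi a x).
  rewrite mulr_sumr -sumrN; apply: eq_bigr => x xi.
  rewrite /G green_sym // schur_offdiag // mulrN mulrCA; congr (- (_ * _)).
  by rewrite mulr_sumr; apply: eq_bigr => a _; rewrite mulrA.
ring.
Qed.

End Resolvent.

(** * Finite sums *)

Section FiniteSums.
Context (R : rcfType).

(** Cauchy-Schwarz, in the form that absorbs arbitrary weights. *)
Lemma cauchy_schwarz_sum (I : finType) (P : pred I) (c A B : I -> R) :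
  (forall i, P i -> 0 <= A i) -> (forall i, P i -> 0 <= B i) ->
  (forall i, P i -> c i ^+ 2 <= A i * B i) ->
  (\sum_(i | P i) c i) ^+ 2 <= (\sum_(i | P i) A i) * (\sum_(i | P i) B i).
Proof.
move=> A0 B0 h.
have -> : (\sum_(i | P i) A i) * (\sum_(i | P i) B i)
    = \sum_(i | P i) \sum_(j | P j) (A i * B j + A j * B i) / 2.
  have E : (\sum_(i | P i) A i) * (\sum_(i | P i) B i)
      = \sum_(i | P i) \sum_(j | P j) A i * B j.
    by rewrite mulr_suml; apply: eq_bigr => i _; rewrite mulr_sumr.
  rewrite [RHS](eq_bigr (fun i => (\sum_(j | P j) A i * B j) / 2
      + (\sum_(j | P j) A j * B i) / 2)) => [|i _]; last first.
    by rewrite -mulr_suml -mulrDl -big_split.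
  rewrite big_split /= -!mulr_suml [X in _ + X / 2]exchange_big /= E.
  by field.
rewrite expr2 mulr_suml; apply: ler_sum => i Pi; rewrite mulr_sumr.
apply: ler_sum => j Pj.
have [] := (h _ Pi, h _ Pj) => hi hj.
have [] := (A0 _ Pi, A0 _ Pj, B0 _ Pi, B0 _ Pj) => [[[Ai Aj] Bi] Bj].
have nn : 0 <= (A i * B j + A j * B i) / 2 by rewrite divr_ge0 ?addr_ge0 ?mulr_ge0.
apply: le_trans (ler_norm _) _.
rewrite -(ler_pXn2r (ltn0Sn 1)) ?nnegrE //.
rewrite real_normK ?num_real // exprMn.
apply: (@le_trans _ _ ((A i * B i) * (A j * B j))); first by rewrite ler_pM ?sqr_ge0.
rewrite -subr_ge0.
have -> : ((A i * B j + A j * B i) / 2) ^+ 2 - A i * B i * (A j * B j)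
  = ((A i * B j - A j * B i) / 2) ^+ 2 by field.
exact: sqr_ge0.
Qed.

Lemma sqr_sum_le (I : finType) (P : pred I) (c : I -> R) :
  (\sum_(i | P i) c i) ^+ 2 <= #|P|%:R * \sum_(i | P i) c i ^+ 2.
Proof.
have := @cauchy_schwarz_sum I P c (fun=> 1) (fun i => c i ^+ 2).
rewrite sumr_const; apply => // i _; first exact: sqr_ge0.
by rewrite mul1r.
Qed.

End FiniteSums.

(** * The self-consistent system *)

Section Stability.
Context (R : realType) (r N : nat) (gamma : 'I_r -> 'I_N -> R).
Hypothesis gamma1 : forall k i, 1 <= gamma k i.

Local Notation th := (theta gamma).

Let gamma0 k i : 0 <= gamma k i. Proof. exact: le_trans ler01 _. Qed.

Lemma gamma_le_theta k i : gamma k i <= th i.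
Proof. by rewrite /theta (bigD1 k) //= lerDl sumr_ge0. Qed.

Lemma theta_ge1 i : (0 < r)%N -> 1 <= th i.
Proof. by move=> r0; apply: le_trans (gamma_le_theta (Ordinal r0) i). Qed.

Definition gdot (a : 'I_r -> R[i]) (i : 'I_N) : R[i] :=
  \sum_j (gamma j i)%:C * a j.

Definition sys_map (z : R[i]) (a : 'I_r -> R[i]) (k : 'I_r) : R[i] :=
  - (N%:R^-1 * \sum_i ((gamma k i)%:C / (z + gdot a i))).

Lemma Im_gdot a i : Im (gdot a i) = \sum_j gamma j i * Im (a j).
Proof. by rewrite Im_sum; apply: eq_bigr => j _; rewrite ImCM. Qed.

Lemma Im_gdot_ge a i c0 : (forall k, c0 <= Im (a k)) -> c0 * th i <= Im (gdot a i).
Proof.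
move=> h; rewrite Im_gdot mulr_sumr; apply: ler_sum => j _.
by rewrite mulrC ler_wpM2l.
Qed.

Lemma normc_gdot_le a i C0 : (forall k, n[a k] <= C0) -> n[gdot a i] <= C0 * th i.
Proof.
move=> h; rewrite (le_trans (normc_sum _ _ _)) // mulr_sumr; apply: ler_sum => j _.
by rewrite normcCM // mulrC ler_wpM2r.
Qed.

Lemma gdotB a b i : gdot a i - gdot b i = gdot (fun k => a k - b k) i.
Proof. by rewrite -sumrB; apply: eq_bigr => j _; rewrite mulrBr. Qed.

(** A weighted Schur test: up to an error [rho / c0], the vector [Im a] is a
    positive sub-eigenvector, with eigenvalue 1, of the matrix of this
    quadratic form. *)
Lemma schur_test z (a x : 'I_r -> R[i]) (c0 rho : R) :
  0 < Im z -> 0 < c0 -> (forall k, c0 <= Im (a k)) ->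
  (forall k, n[a k - sys_map z a k] <= rho) ->
  N%:R^-1 * \sum_i n[- (z + gdot a i)^-1] ^+ 2 * n[gdot x i] ^+ 2
    <= (1 + rho / c0) * \sum_k n[x k] ^+ 2.
Proof.
move=> z0 c00 ha hrho.
have ha0 k : 0 < Im (a k) by exact: lt_le_trans (ha k).
pose w i := n[- (z + gdot a i)^-1] ^+ 2.
have w0 i : 0 <= w i by exact: sqr_ge0.
have ImF k : N%:R^-1 * \sum_i w i * gamma k i * Im (gdot a i) <= Im (sys_map z a k).
  rewrite /sys_map ImN natVCE ImCM Im_sum -mulrN -sumrN ler_wpM2l ?invr_ge0 //.
  apply: ler_sum => i _; rewrite ImCM -mulrN -ImN Im_oppV [w i * _]mulrC -mulrA ler_wpM2l //.
  rewrite /w normcN Normc.normcV exprVn mulrC ler_wpM2r ?invr_ge0 ?sqr_ge0 //.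
  by rewrite ImD lerDr ltW.
have step i : n[gdot x i] ^+ 2 <= Im (gdot a i) * \sum_k gamma k i * (n[x k] ^+ 2 / Im (a k)).
  apply: (@le_trans _ _ ((\sum_k gamma k i * n[x k]) ^+ 2)).
    rewrite ler_pXn2r ?nnegrE ?normc_ge0 ?sumr_ge0 //; last first.
      by move=> k _; rewrite mulr_ge0 // normc_ge0.
    by rewrite (le_trans (normc_sum _ _ _)) //; apply: ler_sum => k _; rewrite normcCM.
  rewrite Im_gdot; apply: cauchy_schwarz_sum => k _.
  - by rewrite mulr_ge0 // ltW.
  - by rewrite mulr_ge0 // divr_ge0 ?sqr_ge0 // ltW.
  rewrite le_eqVlt; apply/orP; left; apply/eqP; field.
  by rewrite (gt_eqF (ha0 k)).
apply: (@le_trans _ _ (\sum_k n[x k] ^+ 2 / Im (a k) *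
    (N%:R^-1 * \sum_i w i * gamma k i * Im (gdot a i)))).
  under [X in _ <= X]eq_bigr do rewrite mulrCA mulr_sumr.
  rewrite -mulr_sumr ler_wpM2l ?invr_ge0 // exchange_big /=.
  apply: ler_sum => i _; rewrite (le_trans (ler_wpM2l (w0 i) (step i))) //.
  rewrite mulr_sumr mulr_sumr le_eqVlt; apply/orP; left; apply/eqP.
  by apply: eq_bigr => k _; ring.
rewrite mulr_sumr; apply: ler_sum => k _.
have hk : Im (sys_map z a k) <= Im (a k) + rho.
  rewrite -lerBlDl (le_trans (ler_norm _)) // -ImN -ImD.
  by rewrite (le_trans (Im_le_normc _)) // normcB.
have rho0 : 0 <= rho by exact: le_trans (normc_ge0 _) (hrho k).
rewrite (@le_trans _ _ (n[x k] ^+ 2 / Im (a k) * (Im (a k) + rho))) //.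
  by rewrite ler_wpM2l ?divr_ge0 ?sqr_ge0 ?(ltW (ha0 k)) // (le_trans (ImF k)).
rewrite -[_ / _ * _]mulrA mulrC ler_wpM2r ?sqr_ge0 //.
rewrite mulrDr mulVf ?gt_eqF // lerD2l mulrC ler_wpM2l // lef_pV2 ?posrE //.
Qed.

Lemma sector_den z (a : 'I_r -> R[i]) (c0 C0 Z : R) i : (0 < r)%N ->
  0 < Im z -> 0 < c0 -> n[z] <= Z ->
  (forall k, c0 <= Im (a k)) -> (forall k, n[a k] <= C0) ->
  [/\ c0 * th i <= Im (z + gdot a i),
      n[z + gdot a i] <= (Z + C0) * th i,
      0 < n[z + gdot a i] &
      c0 / (Z + C0) * n[- (z + gdot a i)^-1] <= Im (- (z + gdot a i)^-1)].
Proof.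
move=> r0 z0 c00 hZ ha hC.
have t1 := theta_ge1 i r0.
have t0 : 0 < th i by exact: lt_le_trans t1.
have H1 : c0 * th i <= Im (z + gdot a i).
  by rewrite ImD (le_trans (Im_gdot_ge i ha)) // lerDr ltW.
have Z0 : 0 <= Z by exact: le_trans (normc_ge0 _) hZ.
have H2 : n[z + gdot a i] <= (Z + C0) * th i.
  rewrite (le_trans (normcD _ _)) // mulrDl lerD ?normc_gdot_le //.
  by rewrite (le_trans hZ) // ler_peMr.
have H3 : 0 < n[z + gdot a i].
  apply: lt_le_trans (le_trans (ler_norm _) (Im_le_normc _)).
  by apply: lt_le_trans H1; rewrite mulr_gt0.
split => //.
have C00 : 0 < C0.
  apply: lt_le_trans (hC (Ordinal r0)); apply: lt_le_trans c00 _.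
  by rewrite (le_trans (ha (Ordinal r0))) // (le_trans (ler_norm _)) ?Im_le_normc.
rewrite Im_oppV normcN Normc.normcV.
set d := n[_] in H2 H3 *.
rewrite expr2 invfM mulrA ler_wpM2r ?invr_ge0 ?normc_ge0 //.
rewrite ler_pdivlMr // mulrAC ler_pdivrMr ?ltr_wpDl // mulrC.
rewrite (le_trans (ler_wpM2r (ltW c00) H2)) // mulrC mulrCA mulrC.
by rewrite ler_wpM2r // ltW // ltr_wpDl.
Qed.

Lemma Re_mul_sector (x y : R[i]) (c : R) : 0 <= c <= 1 ->
  c * n[x] <= Im x -> c * n[y] <= Im y ->
  Re (x * y) <= (1 - 2 * c ^+ 2) * (n[x] * n[y]).
Proof.
move=> /andP[c0 c1] hx hy.
have [nx ny] := (normc_ge0 x, normc_ge0 y).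
have HI : c ^+ 2 * (n[x] * n[y]) <= Im x * Im y.
  have -> : c ^+ 2 * (n[x] * n[y]) = (c * n[x]) * (c * n[y]) by ring.
  by rewrite ler_pM // mulr_ge0.
suff : Re (x * y) + Im x * Im y <= (1 - c ^+ 2) * (n[x] * n[y]) by lra.
rewrite ReM subrK.
have sq (w : R[i]) : c * n[w] <= Im w -> Re w ^+ 2 <= (1 - c ^+ 2) * n[w] ^+ 2.
  move=> hw; have : (c * n[w]) ^+ 2 <= Im w ^+ 2.
    by rewrite ler_pXn2r ?nnegrE ?mulr_ge0 ?normc_ge0 // (le_trans _ hw) ?mulr_ge0 ?normc_ge0.
  have := normc_sqr w; rewrite exprMn; lra.
have c2 : 0 <= 1 - c ^+ 2 by rewrite subr_ge0 expr_le1.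
apply: le_trans (ler_norm _) _.
rewrite -(ler_pXn2r (ltn0Sn 1)) ?nnegrE ?mulr_ge0 //.
rewrite real_normK ?num_real // exprMn.
have -> : ((1 - c ^+ 2) * (n[x] * n[y])) ^+ 2
  = ((1 - c ^+ 2) * n[x] ^+ 2) * ((1 - c ^+ 2) * n[y] ^+ 2) by ring.
by rewrite ler_pM ?sqr_ge0 ?sq.
Qed.

(** Two approximate solutions of the system at the same spectral parameter are
    close, however far apart they might a priori be.  For the difference [x],
    [x^* (1 - T) x] with [T] built from the products [alpha_i beta_i] is
    coercive: its real part sees only [Re (alpha_i beta_i)], which loses a fixed
    fraction of [|alpha_i beta_i|] because both factors point away from the real
    axis, while the form with [|alpha_i beta_i|] in place of [alpha_i beta_i]
    is at most the identity by the Schur test. *)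
Lemma stability z (a b : 'I_r -> R[i]) (c0 C0 Z rho : R) : (0 < r)%N ->
  0 < Im z -> 0 < c0 -> n[z] <= Z ->
  (forall k, c0 <= Im (a k)) -> (forall k, n[a k] <= C0) ->
  (forall k, c0 <= Im (b k)) -> (forall k, n[b k] <= C0) ->
  (forall k, n[a k - sys_map z a k] <= rho) ->
  (forall k, n[b k - sys_map z b k] <= rho) ->
  rho <= c0 * (c0 / (Z + C0)) ^+ 2 ->
  \sum_k n[a k - b k] <= 2 * r%:R * rho / (c0 / (Z + C0)) ^+ 2.
Proof.
move=> r0 z0 c00 hZ ha hCa hb hCb ra rb hrho.
set c := c0 / (Z + C0) in hrho *.
pose x k := a k - b k.
pose al i := - (z + gdot a i)^-1.
pose be i := - (z + gdot b i)^-1.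
have c0C : c0 <= C0.
  apply: le_trans (hCa (Ordinal r0)).
  by rewrite (le_trans (ha (Ordinal r0))) // (le_trans (ler_norm _)) ?Im_le_normc.
have Z0 : 0 <= Z by exact: le_trans (normc_ge0 _) hZ.
have ZC : 0 < Z + C0 by rewrite ltr_wpDl // (lt_le_trans c00).
have c_gt0 : 0 < c by rewrite divr_gt0.
have c01 : 0 <= c <= 1.
  by rewrite ltW //= ler_pdivrMr // mul1r (le_trans c0C) // lerDr.
have rho0 : 0 <= rho by exact: le_trans (normc_ge0 _) (ra (Ordinal r0)).
pose Q := N%:R^-1 * \sum_i (al i * be i) * (n[gdot x i] ^+ 2)%:C.
pose e k := (a k - sys_map z a k) - (b k - sys_map z b k).
have E : \sum_k (x k)^*%C * x k = \sum_k (x k)^*%C * e k + Q.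
  have Ek k : x k = e k + N%:R^-1 * \sum_i (gamma k i)%:C * (al i * be i * gdot x i).
    rewrite /x /e.
    suff -> : N%:R^-1 * \sum_i (gamma k i)%:C * (al i * be i * gdot x i)
      = sys_map z a k - sys_map z b k by ring.
    rewrite /sys_map -!mulrN -mulrDr; congr (_ * _).
    rewrite opprK addrC -sumrB; apply: eq_bigr => i _.
    have [_ _ da _] := sector_den i r0 z0 c00 hZ ha hCa.
    have [_ _ db _] := sector_den i r0 z0 c00 hZ hb hCb.
    rewrite normc_gt0 in da; rewrite normc_gt0 in db.
    rewrite -mulrBr; congr (_ * _); rewrite -gdotB /al /be; field.
    by rewrite da db.
  rewrite [LHS](eq_bigr (fun k => (x k)^*%C * e k + N%:R^-1 * \sum_i
      (x k)^*%C * ((gamma k i)%:C * (al i * be i * gdot x i)))) => [|k _]; last first.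
    by rewrite {2}(Ek k) mulrDr; congr (_ + _); rewrite mulrCA mulr_sumr.
  rewrite big_split /= -mulr_sumr exchange_big /=; congr (_ + _ * _).
  apply: eq_bigr => i _; rewrite -mul_conj.
  rewrite [in RHS]mulrCA mulrA [(gdot x i)^*%C]rmorph_sum mulr_suml mulr_suml.
  apply: eq_bigr => k _; rewrite [X in _ = X * _ * _](_ : _ = (gamma k i)%:C * (x k)^*%C); last exact: conjc_CM.
  ring.
have nx2 : Re (\sum_k (x k)^*%C * x k) = \sum_k n[x k] ^+ 2.
  by rewrite Re_sum; apply: eq_bigr => k _; rewrite mul_conj.
have e2 k : n[e k] <= 2 * rho.
  by rewrite (le_trans (normcBD _ _)) // mulr_natl mulr2n lerD.
have He : Re (\sum_k (x k)^*%C * e k) <= 2 * rho * \sum_k n[x k].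
  rewrite Re_sum mulr_sumr; apply: ler_sum => k _.
  rewrite (le_trans (ler_norm _)) // (le_trans (Re_le_normc _)) //.
  by rewrite Normc.normcM normc_conj mulrC ler_wpM2r ?normc_ge0.
have HQ : Re Q <= (1 - 2 * c ^+ 2) * (1 + rho / c0) * \sum_k n[x k] ^+ 2
     \/ 1 - 2 * c ^+ 2 < 0 /\ Re Q <= 0.
  have S1 : Re Q <= (1 - 2 * c ^+ 2) *
      (N%:R^-1 * \sum_i n[al i] * n[be i] * n[gdot x i] ^+ 2).
    rewrite /Q natVCE ReCM Re_sum mulrCA ler_wpM2l ?invr_ge0 // mulr_sumr.
    apply: ler_sum => i _; rewrite [_ * _%:C]mulrC ReCM mulrC [X in _ <= X]mulrA ler_wpM2r ?sqr_ge0 //.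
    have [_ _ _ sa] := sector_den i r0 z0 c00 hZ ha hCa.
    have [_ _ _ sb] := sector_den i r0 z0 c00 hZ hb hCb.
    exact: Re_mul_sector.
  have S2 : N%:R^-1 * \sum_i n[al i] * n[be i] * n[gdot x i] ^+ 2
     <= (1 + rho / c0) * \sum_k n[x k] ^+ 2.
    have A1 := schur_test x z0 c00 ha ra.
    have A2 := schur_test x z0 c00 hb rb.
    rewrite -/al -/be in A1 A2.
    apply: (@le_trans _ _ ((N%:R^-1 * (\sum_i n[al i] ^+ 2 * n[gdot x i] ^+ 2)
      + N%:R^-1 * (\sum_i n[be i] ^+ 2 * n[gdot x i] ^+ 2)) / 2)); last first.
      rewrite ler_pdivrMr // mulr_natr mulr2n; exact: lerD.
    rewrite -mulrDr -mulrA ler_wpM2l ?invr_ge0 // -big_split /= mulr_suml.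
    apply: ler_sum => i _; rewrite -mulrDl [X in _ <= X]mulrAC ler_wpM2r ?sqr_ge0 //.
    rewrite -subr_ge0.
    have -> : (n[al i] ^+ 2 + n[be i] ^+ 2) / 2 - n[al i] * n[be i]
      = (n[al i] - n[be i]) ^+ 2 / 2 by field.
    by rewrite divr_ge0 ?sqr_ge0.
  have [neg|pos] := ltP (1 - 2 * c ^+ 2) 0; [right|left].
    split=> //; apply: (le_trans S1).
    rewrite mulr_le0_ge0 ?(ltW neg) // mulr_ge0 ?invr_ge0 //.
    by apply: sumr_ge0 => i _; rewrite !mulr_ge0 ?normc_ge0 ?sqr_ge0.
  by apply: (le_trans S1); rewrite -mulrA ler_wpM2l.
set X := \sum_k n[x k] ^+ 2 in nx2 HQ.
have X0 : 0 <= X by apply: sumr_ge0 => k _; exact: sqr_ge0.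
have C1 : Re Q <= (1 - c ^+ 2) * X.
  case: HQ => [HQ|[_ HQ]].
    apply: (le_trans HQ); rewrite ler_wpM2r //.
    have h1 : rho / c0 <= c ^+ 2 by rewrite ler_pdivrMr // mulrC.
    have h0 : 0 <= rho / c0 by rewrite divr_ge0 // ltW.
    have := sqr_ge0 c; nra.
  apply: (le_trans HQ); rewrite mulr_ge0 // subr_ge0 expr_le1 //; by case/andP: c01.
have main : c ^+ 2 * X <= 2 * rho * \sum_k n[x k].
  have : Re (\sum_k (x k)^*%C * x k) <= 2 * rho * (\sum_k n[x k]) + (1 - c ^+ 2) * X.
    by rewrite E ReD lerD.
  rewrite nx2; lra.
set S := \sum_k n[x k] in main He *.
have S0 : 0 <= S by apply: sumr_ge0 => k _; exact: normc_ge0.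
have CS : S ^+ 2 <= r%:R * X.
  by rewrite (le_trans (sqr_sum_le _ _)) // card_ord.
have c2 : 0 < c ^+ 2 by rewrite exprn_gt0.
rewrite ler_pdivlMr //.
have [->|Sn0] := eqVneq S 0; first by rewrite mul0r !mulr_ge0.
have Sp : 0 < S by rewrite lt0r Sn0.
rewrite -(ler_pM2l Sp) mulrA -expr2.
apply: (@le_trans _ _ (r%:R * (c ^+ 2 * X))).
  by rewrite [X in _ <= X](_ : _ = r%:R * X * c ^+ 2) ?ler_wpM2r ?(ltW c2) //; ring.
have -> : S * (2 * r%:R * rho) = r%:R * (2 * rho * S) by ring.
by rewrite ler_wpM2l.
Qed.

End Stability.

(** * The variance profile *)

Section Profile.
Context (R : realType) (r N : nat) (gamma : 'I_r -> 'I_N -> R) (M q : R).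
Hypothesis r0 : (0 < r)%N.
Hypothesis N0 : (0 < N)%N.
Hypothesis gamma1 : forall k i, 1 <= gamma k i.
Hypothesis gammaM : N%:R^-1 * (\sum_k \sum_i gamma k i ^+ 2) <= M.
Hypothesis q1 : 1 <= q.
Hypothesis qN : q ^+ 2 <= N%:R.
Hypothesis qs1 : forall i j, q * profile gamma i j <= 1.

Local Notation th := (theta gamma).
Local Notation s := (profile gamma).
Local Notation Mt := (r%:R * M).

Let gamma0 k i : 0 <= gamma k i. Proof. exact: le_trans ler01 _. Qed.
Let NR0 : 0 < (N%:R : R). Proof. by rewrite ltr0n. Qed.
Let th1 i : 1 <= th i. Proof. exact: theta_ge1. Qed.
Let th0 i : 0 < th i. Proof. exact: lt_le_trans (th1 i). Qed.
Let q0 : 0 < q. Proof. exact: lt_le_trans q1. Qed.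

Lemma theta_sqr_le i : th i ^+ 2 <= r%:R * \sum_k gamma k i ^+ 2.
Proof. by rewrite (le_trans (sqr_sum_le _ _)) // card_ord. Qed.

Lemma avg_theta2_le : N%:R^-1 * \sum_i th i ^+ 2 <= Mt.
Proof.
apply: (@le_trans _ _ (r%:R * (N%:R^-1 * (\sum_k \sum_i gamma k i ^+ 2)))).
  rewrite mulrCA ler_wpM2l ?invr_ge0 // exchange_big mulr_sumr /=.
  by apply: ler_sum => i _; exact: theta_sqr_le.
by rewrite ler_wpM2l.
Qed.

Lemma avg_theta_le : N%:R^-1 * \sum_i th i <= Mt.
Proof.
apply: le_trans avg_theta2_le; rewrite ler_wpM2l ?invr_ge0 //.
by apply: ler_sum => i _; rewrite expr2 ler_peMr // ltW.
Qed.

Lemma avg_const (a : R) : N%:R^-1 * \sum_(i < N) a = a.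
Proof. by rewrite sumr_const card_ord -[X in _ * X]mulr_natl mulKf // gt_eqF. Qed.

Lemma Mt_ge1 : 1 <= Mt.
Proof.
apply: le_trans avg_theta_le; rewrite -{1}(avg_const 1) ler_wpM2l ?invr_ge0 //.
by apply: ler_sum => i _.
Qed.

Lemma avg_gamma_le k : N%:R^-1 * \sum_i gamma k i <= Mt.
Proof.
apply: le_trans avg_theta_le; rewrite ler_wpM2l ?invr_ge0 //.
by apply: ler_sum => i _; exact: gamma_le_theta.
Qed.

Lemma profile_ge0 i j : 0 <= s i j.
Proof. by rewrite mulr_ge0 ?invr_ge0 // sumr_ge0 // => k _; rewrite mulr_ge0. Qed.

Lemma profile_sym i j : s i j = s j i.
Proof. by rewrite /profile; congr (_ * _); apply: eq_bigr => k _; rewrite mulrC. Qed.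

Lemma profile_le_theta i j : s i j <= N%:R^-1 * (th i * th j).
Proof.
rewrite /profile ler_wpM2l ?invr_ge0 // [X in _ <= X * _]/theta mulr_suml.
by apply: ler_sum => k _; rewrite ler_wpM2l //; exact: gamma_le_theta.
Qed.

Lemma profile_le_q i j : s i j <= q^-1.
Proof. by rewrite -(ler_pM2l q0) mulfV ?gt_eqF. Qed.

Lemma sum_profile_le i : \sum_j s i j <= Mt * th i.
Proof.
apply: (@le_trans _ _ (th i * (N%:R^-1 * \sum_j th j))).
  rewrite mulrCA mulr_sumr mulr_sumr; apply: ler_sum => j _; exact: profile_le_theta.
by rewrite mulrC ler_wpM2r ?(ltW (th0 i)) // avg_theta_le.
Qed.

Lemma sum_profile_div_le i : \sum_j s i j / th j <= th i.
Proof.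
apply: (@le_trans _ _ (N%:R^-1 * \sum_(j < N) th i)); last by rewrite avg_const.
rewrite mulr_sumr; apply: ler_sum => j _.
by rewrite ler_pdivrMr // -mulrA profile_le_theta.
Qed.

Lemma q_theta2_le i : q * th i ^+ 2 <= r%:R * N%:R.
Proof.
apply: (@le_trans _ _ (r%:R * (N%:R * (q * s i i)))); last first.
  by rewrite ler_wpM2l // ler_piMr.
have -> : r%:R * (N%:R * (q * s i i)) = q * (r%:R * \sum_k gamma k i * gamma k i).
  by rewrite /profile; field; rewrite gt_eqF.
by rewrite ler_wpM2l ?(ltW q0) // (le_trans (theta_sqr_le i)).
Qed.

Lemma theta_leN i : th i <= r%:R * N%:R.
Proof.
apply: le_trans (q_theta2_le i); rewrite expr2 mulrA ler_peMl ?(ltW (th0 i)) //.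
by rewrite mulr_ege1.
Qed.

Lemma sqrt_q_ge1 : 1 <= Num.sqrt q.
Proof. by rewrite -(@sqrtr1 R) ler_wsqrtr. Qed.

Lemma inv_sqrt_q_le1 : (Num.sqrt q)^-1 <= 1.
Proof. by rewrite invf_le1 ?sqrt_q_ge1 // sqrtr_gt0. Qed.

Lemma inv_q_le : q^-1 <= (Num.sqrt q)^-1.
Proof.
rewrite -{1}(sqr_sqrtr (ltW q0)) expr2 invfM ler_piMr ?invr_ge0 ?sqrtr_ge0 //.
exact: inv_sqrt_q_le1.
Qed.

(** This is where [q <= sqrt N] matters: the law of [h_ij] has variance
    [s_ij (1 - q s_ij)], and the correction to [s_ij] is negligible. *)
Lemma q_sum_profile2_le i :
  \sum_j q * s i j ^+ 2 <= r%:R * Mt * (th i * (Num.sqrt q)^-1).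
Proof.
have b1 : q * th i / N%:R <= r%:R * (Num.sqrt q)^-1.
  have p1 : 0 <= q * th i / N%:R by rewrite divr_ge0 // mulr_ge0 ?(ltW q0) ?(ltW (th0 _)).
  have p2 : 0 <= r%:R * (Num.sqrt q)^-1 by rewrite mulr_ge0 ?invr_ge0 ?sqrtr_ge0.
  rewrite -(ler_pXn2r (ltn0Sn 1)) ?nnegrE //.
  rewrite [X in _ <= X]exprMn exprVn sqr_sqrtr ?(ltW q0) //.
  apply: (@le_trans _ _ (r%:R / q)); last first.
    by rewrite ler_wpM2r ?invr_ge0 ?(ltW q0) // expr2 ler_peMr // ler1n.
  have -> : (q * th i / N%:R) ^+ 2 = (q * th i ^+ 2) * (q / N%:R ^+ 2).
    by field; rewrite gt_eqF.
  apply: (@le_trans _ _ (r%:R * N%:R * (q / N%:R ^+ 2))).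
    by rewrite ler_wpM2r ?q_theta2_le // divr_ge0 ?(ltW q0) // sqr_ge0.
  have -> : r%:R * N%:R * (q / N%:R ^+ 2) = r%:R * q / N%:R.
    by field; rewrite gt_eqF.
  by rewrite -mulrA ler_wpM2l // ler_pdivrMr // mulrC ler_pdivlMr // -expr2 //.
apply: (@le_trans _ _ (Mt * th i * (q * th i / N%:R))).
  apply: (@le_trans _ _ ((q * th i ^+ 2 / N%:R) * (N%:R^-1 * \sum_j th j ^+ 2))).
    rewrite mulr_sumr mulr_sumr; apply: ler_sum => j _.
    have -> : q * th i ^+ 2 / N%:R * (N%:R^-1 * th j ^+ 2)
      = q * (N%:R^-1 * (th i * th j)) ^+ 2 by ring.
    rewrite ler_wpM2l ?(ltW q0) // ler_pXn2r ?nnegrE ?profile_ge0 //.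
      by rewrite profile_le_theta.
    by rewrite !mulr_ge0 ?invr_ge0 ?(ltW (th0 _)).
  have -> : Mt * th i * (q * th i / N%:R) = (q * th i ^+ 2 / N%:R) * Mt by ring.
  by rewrite ler_wpM2l ?avg_theta2_le // divr_ge0 // mulr_ge0 ?sqr_ge0 ?(ltW q0) //.
have -> : r%:R * Mt * (th i * (Num.sqrt q)^-1)
  = Mt * th i * (r%:R * (Num.sqrt q)^-1) by ring.
by rewrite ler_wpM2l // mulr_ge0 ?(ltW (th0 _)) // (le_trans ler01) // Mt_ge1.
Qed.

Definition avg_green (g : 'I_N -> R[i]) (k : 'I_r) : R[i] :=
  N%:R^-1 * \sum_i (gamma k i)%:C * g i.

(** The profile has rank [r], so the variance-weighted row sums of a diagonal are
    functions of [r] averages only. *)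
Lemma gdot_avg_green g i : gdot gamma (avg_green g) i = \sum_a (s i a)%:C * g a.
Proof.
rewrite /gdot /avg_green.
under eq_bigr do rewrite mulrCA mulr_sumr.
rewrite -mulr_sumr exchange_big mulr_sumr /=; apply: eq_bigr => a _.
rewrite natVCE rmorphM /= -mulrA; congr (_ * _).
rewrite rmorph_sum mulr_suml; apply: eq_bigr => k _.
by rewrite rmorphM /= mulrA.
Qed.

Lemma normc_avg_green_le g (C : R) k : 0 <= C ->
  (forall i, th i * n[g i] <= C) -> n[avg_green g k] <= C.
Proof.
move=> C0 h; rewrite /avg_green natVCE normcCM ?invr_ge0 //.
rewrite -[X in _ <= X](avg_const C) ler_wpM2l ?invr_ge0 //.
rewrite (le_trans (normc_sum _ _ _)) //; apply: ler_sum => i _.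
rewrite normcCM // (le_trans _ (h i)) // ler_wpM2r ?normc_ge0 //.
exact: gamma_le_theta.
Qed.

(** Below height 1, [gamma >= 1] turns the lower bound on [Im m] into one on every
    [Im u_k], whence [|g_i| <= 1 / (c theta_i)].  Above height 1 the trivial bound
    [|g_i| <= 1 / Im z] plays that part. *)
Lemma bulk_size z (u : R[i] -> 'I_r -> R[i]) (c Z : R) :
  solves_system gamma u -> 0 < c -> 0 < Im z -> n[z] <= Z ->
  (c < Im (msol gamma u z) \/ 1 <= Im z) ->
  let c0 := Num.min c ((Z + Mt) ^+ 2 * Mt)^-1 in
  let C0 := Num.max c^-1 Mt in
  (forall k, c0 <= Im (u z k)) /\ (forall k, n[u z k] <= C0).
Proof.
move=> hu c00 z0 hZ hcase.
have Mt1 := Mt_ge1; have avg2 := avg_theta2_le; have avgk := avg_gamma_le.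
move: Mt1 avg2 avgk; move: (r%:R * M) => y Mt1 avg2 avgk c0 C0.
have [ukpos ukE] := hu z z0.
have imu k : 0 < Im (u z k) by exact: ukpos.
have Z0 : 0 <= Z by exact: le_trans (normc_ge0 _) hZ.
pose g := gsol gamma u z.
have uE k : u z k = avg_green g k.
  rewrite {1}ukE /avg_green -mulrN -sumrN; congr (_ * _); apply: eq_bigr => i _.
  by rewrite /g /gsol mulrN.
have dn0 i : 0 < Im (z + gdot gamma (u z) i).
  rewrite ImD ltr_wpDr // Im_gdot sumr_ge0 // => j _.
  by rewrite mulr_ge0 // ltW.
have gE i : g i = - (z + gdot gamma (u z) i)^-1 by [].
have Img i : 0 <= Im (g i).
  by rewrite gE Im_oppV divr_ge0 ?sqr_ge0 // ltW.
have Imu_ge k : N%:R^-1 * \sum_i Im (g i) <= Im (u z k).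
  rewrite uE /avg_green natVCE ImCM Im_sum ler_wpM2l ?invr_ge0 //.
  by apply: ler_sum => i _; rewrite ImCM ler_peMl.
have C0c : c^-1 <= C0 by rewrite le_max lexx.
have C0M : y <= C0 by rewrite le_max lexx orbT.
case: hcase => [hm|h1].
  have hk k : c <= Im (u z k).
    rewrite (le_trans _ (Imu_ge k)) // ltW // (lt_le_trans hm) //.
    by rewrite /msol natVCE ImCM Im_sum.
  split=> k; first by rewrite (le_trans _ (hk k)) // ge_min lexx.
  apply: le_trans C0c; rewrite uE; apply: normc_avg_green_le.
    by rewrite invr_ge0 ltW.
  move=> i; rewrite gE normcN Normc.normcV ler_pdivrMr; last first.
    exact: lt_le_trans (dn0 i) (le_trans (ler_norm _) (Im_le_normc _)).
  rewrite mulrC ler_pdivlMr // (le_trans _ (le_trans (ler_norm _) (Im_le_normc _))) //.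
  by rewrite ImD mulrC (le_trans (Im_gdot_ge gamma1 i hk)) // lerDr ltW.
have hg i : n[g i] <= 1.
  rewrite gE normcN Normc.normcV invf_le1; last first.
    exact: lt_le_trans (dn0 i) (le_trans (ler_norm _) (Im_le_normc _)).
  rewrite (le_trans _ (le_trans (ler_norm _) (Im_le_normc _))) // ImD.
  rewrite (le_trans h1) // lerDl Im_gdot sumr_ge0 // => j _.
  by rewrite mulr_ge0 // ltW.
have hM k : n[u z k] <= y.
  rewrite uE /avg_green natVCE normcCM ?invr_ge0 //.
  rewrite (le_trans _ (avgk k)) // ler_wpM2l ?invr_ge0 //.
  rewrite (le_trans (normc_sum _ _ _)) //; apply: ler_sum => i _.
  by rewrite normcCM // ler_piMr.
split=> k; last exact: le_trans (hM k) C0M.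
rewrite (@le_trans _ _ ((Z + y) ^+ 2 * y)^-1) ?ge_min ?lexx ?orbT //.
rewrite (le_trans _ (Imu_ge k)) //.
have ZM : 0 < Z + y by rewrite ltr_wpDl // (lt_le_trans ltr01).
(* Convexity of the inverse: 1 / x >= 2 / y - x / y^2, at x = theta_i^2. *)
have Imgi i : (2 / y - th i ^+ 2 / y ^+ 2) / (Z + y) ^+ 2 <= Im (g i).
  rewrite gE Im_oppV.
  have d1 : n[z + gdot gamma (u z) i] <= (Z + y) * th i.
    rewrite (le_trans (normcD _ _)) // mulrDl lerD ?(normc_gdot_le gamma1) //.
    by rewrite (le_trans hZ) // ler_peMr.
  have dp : 0 < n[z + gdot gamma (u z) i].
    exact: lt_le_trans (dn0 i) (le_trans (ler_norm _) (Im_le_normc _)).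
  apply: (@le_trans _ _ (((Z + y) * th i) ^+ 2)^-1); last first.
    rewrite -[X in X <= _]mul1r ler_pM ?invr_ge0 ?sqr_ge0 //.
      rewrite (le_trans h1) // ImD lerDl Im_gdot sumr_ge0 // => j _.
      by rewrite mulr_ge0 // ltW.
    rewrite lef_pV2 ?posrE ?exprn_gt0 ?mulr_gt0 // ler_pXn2r ?nnegrE ?normc_ge0 //.
    by rewrite mulr_ge0 // ltW.
  have -> : (((Z + y) * th i) ^+ 2)^-1 = (th i ^+ 2)^-1 / (Z + y) ^+ 2.
    by rewrite exprMn invfM mulrC.
  rewrite ler_wpM2r ?invr_ge0 ?sqr_ge0 //.
  have MtP : 0 < y by exact: lt_le_trans Mt1.
  have Mt_neq : y != 0 by rewrite gt_eqF.
  have thn : th i != 0 by rewrite gt_eqF.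
  rewrite -subr_ge0.
  have -> : (th i ^+ 2)^-1 - (2 / y - th i ^+ 2 / y ^+ 2) = ((th i)^-1 - th i / y) ^+ 2.
    field.
    by rewrite Mt_neq thn.
  exact: sqr_ge0.
apply: (@le_trans _ _ (N%:R^-1 * \sum_i (2 / y - th i ^+ 2 / y ^+ 2) / (Z + y) ^+ 2)).
  have -> : N%:R^-1 * (\sum_i (2 / y - th i ^+ 2 / y ^+ 2) / (Z + y) ^+ 2)
      = (2 / y - N%:R^-1 * (\sum_i th i ^+ 2) / y ^+ 2) / (Z + y) ^+ 2.
    rewrite -mulr_suml sumrB [X in _ - X](_ : _ = (\sum_i th i ^+ 2) / y ^+ 2).
      by rewrite mulrA mulrBr avg_const !mulrA.
    by rewrite mulr_suml.
  have -> : ((Z + y) ^+ 2 * y)^-1 = y^-1 / (Z + y) ^+ 2 by rewrite invfM mulrC.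
  rewrite ler_wpM2r ?invr_ge0 ?sqr_ge0 //.
  have MtP : 0 < y by exact: lt_le_trans Mt1.
  have : N%:R^-1 * (\sum_i th i ^+ 2) / y ^+ 2 <= y / y ^+ 2.
    by rewrite ler_wpM2r ?invr_ge0 ?sqr_ge0 // avg2.
  rewrite [X in _ <= X](_ : _ = y^-1); last first.
    by rewrite expr2 invfM mulrA mulfV ?mul1r // gt_eqF.
  set A := _ / _ ^+ 2; set B := _^-1; lra.
by rewrite ler_wpM2l ?invr_ge0 //; apply: ler_sum => i _.
Qed.

End Profile.

(** Perturbed equations for the diagonal entries make their weighted averages an
    approximate solution of the system; after [stability], reinserting the averages
    into the equations compares the entries one by one.  The factors [theta_i]
    cancel because [|g_i|] and its limit are of order [1 / theta_i]. *)
Lemma self_consistent_stable (R : realType) (r : nat) (c C Z : R) : (0 < r)%N ->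
  0 < c -> 0 < C -> exists K s0 : R, [/\ 0 < K, 0 < s0 &
  forall (N : nat) (gamma : 'I_r -> 'I_N -> R) (z : R[i]) (u : R[i] -> 'I_r -> R[i])
    (g : 'I_N -> R[i]) (sg : R),
  (0 < N)%N -> (forall k i, 1 <= gamma k i) ->
  solves_system gamma u -> 0 < Im z -> n[z] <= Z ->
  (forall k, c <= Im (u z k)) -> (forall k, n[u z k] <= C) ->
  (forall k, c <= Im (avg_green gamma g k)) ->
  (forall i, theta gamma i * n[g i] <= C) -> (forall i, g i != 0) ->
  0 <= sg <= s0 ->
  (forall i, n[- (g i)^-1 - z - gdot gamma (avg_green gamma g) i]
     <= theta gamma i * sg) ->
  forall i, theta gamma i * n[g i - gsol gamma u z i] <= K * sg].
Proof.
move=> r0 c0 C0.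
pose Z' := Num.max Z 1.
have Z0 : 0 < Z' by rewrite lt_max ltr01 orbT.
pose ka := c / (Z' + C).
have ka0 : 0 < ka by rewrite divr_gt0 // addr_gt0.
have ka2 : 0 < ka ^+ 2 by rewrite exprn_gt0.
have rR : 0 < (r%:R : R) by rewrite ltr0n.
exists (C / c * (2 * r%:R * (C / c) / ka ^+ 2 + 1)), (c * ka ^+ 2 / (C / c)).
split.
- rewrite mulr_gt0 ?divr_gt0 // addr_gt0 //.
  by rewrite (divr_gt0 _ ka2) // !mulr_gt0 // invr_gt0.
- exact: divr_gt0 (mulr_gt0 c0 ka2) (divr_gt0 C0 c0).
move=> N gamma z u g sg N0 gamma1 hu z0 hZ hcu hCu hcv hCv gn0 /andP[sg0 sgs] heps.
set v := avg_green gamma g in hcv heps *.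
have th1 i : 1 <= theta gamma i by exact: theta_ge1.
have th0 i : 0 < theta gamma i by exact: lt_le_trans (th1 i).
have hZ' : n[z] <= Z' by rewrite (le_trans hZ) // le_max lexx.
have hCv' k : n[v k] <= C by apply: normc_avg_green_le => //; exact: ltW.
have bnd (a : 'I_r -> R[i]) (ha : forall k, c <= Im (a k)) i :
    theta gamma i * n[- (z + gdot gamma a i)^-1] <= c^-1 /\ z + gdot gamma a i != 0.
  have hIm : c * theta gamma i <= Im (z + gdot gamma a i).
    by rewrite ImD (le_trans (Im_gdot_ge gamma1 i ha)) // lerDr ltW.
  have hn : c * theta gamma i <= n[z + gdot gamma a i].
    exact: le_trans hIm (le_trans (ler_norm _) (Im_le_normc _)).
  have np : 0 < n[z + gdot gamma a i] by apply: lt_le_trans hn; rewrite mulr_gt0.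
  split; last by rewrite -normc_gt0.
  by rewrite normcN Normc.normcV ler_pdivrMr // mulrC ler_pdivlMr // mulrC.
pose be i := - (z + gdot gamma v i)^-1.
have gbe i : n[g i - be i] <= C / c * sg / theta gamma i.
  have [b1 b2] := bnd v hcv i.
  have -> : g i - be i = (- (g i)^-1 - z - gdot gamma v i) * (g i * be i).
    rewrite /be; have := gn0 i; set w := gdot _ _ _ in b2 * => gi0; field.
    by rewrite b2 gi0.
  rewrite !Normc.normcM ler_pdivlMr // (le_trans (ler_wpM2r (ltW (th0 i))
    (ler_wpM2r _ (heps i)))) //; first by rewrite mulr_ge0 ?normc_ge0.
  have -> : theta gamma i * sg * (n[g i] * n[be i]) * theta gamma i
    = (theta gamma i * n[g i]) * (theta gamma i * n[be i]) * sg by ring.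
  by rewrite ler_wpM2r // ler_pM // ?mulr_ge0 ?normc_ge0 // ltW.
have ev k : n[v k - sys_map gamma z v k] <= C / c * sg.
  have -> : v k - sys_map gamma z v k = N%:R^-1 * \sum_i (gamma k i)%:C * (g i - be i).
    rewrite /sys_map /v /avg_green opprK -mulrDr -big_split /=; congr (_ * _).
    by apply: eq_bigr => i _; rewrite /be opprK mulrDr.
  rewrite natVCE normcCM ?invr_ge0 // -[X in _ <= X](avg_const N0) ler_wpM2l ?invr_ge0 //.
  rewrite (le_trans (normc_sum _ _ _)) //; apply: ler_sum => i _.
  have gi0 : 0 <= gamma k i by exact: le_trans ler01 _.
  rewrite normcCM // (le_trans (ler_wpM2l gi0 (gbe i))) // mulrC.
  have -> : C / c * sg / theta gamma i * gamma k i
    = C / c * sg * (gamma k i / theta gamma i) by ring.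
  rewrite ler_piMr //; first by rewrite mulr_ge0 // divr_ge0 // ltW.
  by rewrite ler_pdivrMr // mul1r gamma_le_theta.
have eu k : n[u z k - sys_map gamma z (u z) k] <= C / c * sg.
  have [_ ukE] := hu z z0.
  have -> : sys_map gamma z (u z) k = u z k by rewrite [RHS]ukE.
  by rewrite subrr Normc.normc0 mulr_ge0 // divr_ge0 // ltW.
have hst : C / c * sg <= c * ka ^+ 2.
  by rewrite mulrC -ler_pdivlMr // divr_gt0.
have Cs0 : 0 <= C / c * sg by rewrite mulr_ge0 // divr_ge0 // ltW.
have ST := stability gamma1 r0 z0 c0 hZ' hcv hCv' hcu hCu ev eu hst.
move=> i; rewrite -/ka in ST.
have [b1 b2] := bnd _ hcu i.
have -> : g i - gsol gamma u z i =
    ((- (g i)^-1 - z - gdot gamma v i) + gdot gamma (fun k => v k - u z k) i)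
      * (g i * gsol gamma u z i).
  rewrite -gdotB /gsol -/(gdot gamma (u z) i).
  have := gn0 i; set w := gdot _ (u z) _ in b2 *; set w' := gdot _ v _ => gi0; field.
  by rewrite b2 gi0.
rewrite !Normc.normcM.
have A1 : n[(- (g i)^-1 - z - gdot gamma v i) + gdot gamma (fun k => v k - u z k) i]
   <= theta gamma i * (2 * r%:R * (C / c * sg) / ka ^+ 2 + sg).
  rewrite (le_trans (normcD _ _)) // [X in _ <= X]mulrDr addrC lerD //.
  rewrite mulrC (le_trans (normc_sum _ _ _)) //.
  apply: le_trans (ler_wpM2r (ltW (th0 i)) ST).
  rewrite mulr_suml; apply: ler_sum => k _; rewrite normcCM; last exact: le_trans ler01 _.
  by rewrite mulrC ler_wpM2l ?normc_ge0 // gamma_le_theta.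
have -> : C / c * (2 * r%:R * (C / c) / ka ^+ 2 + 1) * sg
  = (2 * r%:R * (C / c * sg) / ka ^+ 2 + sg) * (C * c^-1) by ring.
rewrite mulrCA (le_trans (ler_wpM2r _ A1)) //.
  by rewrite !mulr_ge0 ?normc_ge0 // ltW.
have -> : theta gamma i * (2 * r%:R * (C / c * sg) / ka ^+ 2 + sg) *
    (theta gamma i * (n[g i] * n[gsol gamma u z i]))
  = (2 * r%:R * (C / c * sg) / ka ^+ 2 + sg)
    * ((theta gamma i * n[g i]) * (theta gamma i * n[gsol gamma u z i])) by ring.
rewrite ler_wpM2l //.
  by rewrite addr_ge0 // !mulr_ge0 ?invr_ge0 // ltW.
by rewrite ler_pM // ?mulr_ge0 ?normc_ge0 // ltW.
Qed.

(** * Large deviations on a finite product space *)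

Section ProductSpace.
Context (R : realType) (K : finType) (W : K -> bool -> R).
Hypothesis W0 : forall e b, 0 <= W e b.
Hypothesis W1 : forall e, W e true + W e false = 1.

Local Notation Omega := {ffun K -> bool}.

Definition weight (w : Omega) : R := \prod_e W e (w e).
Definition expect (f : Omega -> R) : R := \sum_w weight w * f w.
Definition proba (A : pred Omega) : R := \sum_(w | A w) weight w.

Definition upd (w : Omega) (e : K) (b : bool) : Omega :=
  [ffun e' => if e' == e then b else w e'].

Definition indep_of (T : Type) (e : K) (f : Omega -> T) :=
  forall w b, f (upd w e b) = f w.

Lemma weight_ge0 w : 0 <= weight w.
Proof. exact: prodr_ge0. Qed.

Lemma expect_le (f g : Omega -> R) : (forall w, f w <= g w) -> expect f <= expect g.
Proof. by move=> h; apply: ler_sum => w _; rewrite ler_wpM2l ?weight_ge0. Qed.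

Lemma sum_weight : \sum_w weight w = 1.
Proof.
rewrite /weight -(bigA_distr_bigA (fun e b => W e b)) big1 // => e _.
by rewrite big_bool /= W1.
Qed.

Lemma expect_cst (a : R) : expect (fun=> a) = a.
Proof. by rewrite /expect -mulr_suml sum_weight mul1r. Qed.

Lemma updE w e b : upd w e b e = b.
Proof. by rewrite ffunE eqxx. Qed.

Lemma upd_neq w e b e' : e' != e -> upd w e b e' = w e'.
Proof. by move=> /negPf h; rewrite ffunE h. Qed.

Lemma weight_upd w e b : weight (upd w e b) * W e (w e) = weight w * W e b.
Proof.
rewrite /weight (bigD1 e) //= [in RHS](bigD1 e) //= updE.
rewrite (eq_bigr (fun e' => W e' (w e'))) => [|e' h]; first by ring.
by rewrite upd_neq.
Qed.

(** This is the only form of Fubini needed: integrating out one coordinate at a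
    time replaces conditional expectations.  The map exchanging the coordinate
    with its resampled value is an involution preserving the joint weight. *)
Lemma expect_resample e f :
  expect f = expect (fun w => \sum_b W e b * f (upd w e b)).
Proof.
rewrite /expect.
have -> : \sum_w weight w * (\sum_b W e b * f (upd w e b))
   = \sum_(p : Omega * bool) weight (upd p.1 e p.2) * W e (p.1 e) * f (upd p.1 e p.2).
  rewrite -(pair_bigA _ (fun w b => weight (upd w e b) * W e (w e) * f (upd w e b))) /=.
  apply: eq_bigr => w _; rewrite mulr_sumr; apply: eq_bigr => b _.
  by rewrite weight_upd mulrA.
pose phi (p : Omega * bool) := (upd p.1 e p.2, p.1 e).
have phiK : involutive phi.
  move=> [w b]; rewrite /phi /= updE; congr (_, _); apply/ffunP => e'.
  by rewrite !ffunE; case: eqP => [->|].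
have -> : \sum_(p : Omega * bool) weight (upd p.1 e p.2) * W e (p.1 e) * f (upd p.1 e p.2)
   = \sum_(p : Omega * bool) weight p.1 * f p.1 * W e p.2.
  rewrite (reindex_inj (inv_inj phiK)); apply: eq_bigr => -[w b] _ /=; rewrite updE.
  have -> : upd (upd w e b) e (w e) = w.
    by apply/ffunP => e'; rewrite !ffunE; case: eqP => [->|].
  by rewrite mulrAC.
rewrite -(pair_bigA _ (fun w b => weight w * f w * W e b)) /=.
by apply: eq_bigr => w _; rewrite -mulr_sumr big_bool /= W1 mulr1.
Qed.

Lemma proba_le_expect (A : pred Omega) f :
  (forall w, 0 <= f w) -> (forall w, A w -> 1 <= f w) -> proba A <= expect f.
Proof.
move=> f0 h; rewrite /proba big_mkcond; apply: ler_sum => w _.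
case: ifP => [/h hw|_]; first by rewrite ler_peMr ?weight_ge0.
by rewrite mulr_ge0 ?weight_ge0.
Qed.

Lemma proba_sub (A B : pred Omega) : (forall w, A w -> B w) -> proba A <= proba B.
Proof.
move=> h; rewrite /proba [X in X <= _]big_mkcond [X in _ <= X]big_mkcond.
apply: ler_sum => w _.
by case: ifP => [/h ->//|_]; case: ifP => // _; exact: weight_ge0.
Qed.

Lemma proba_union (A B : pred Omega) :
  proba (fun w => A w || B w) <= proba A + proba B.
Proof.
rewrite /proba big_mkcond [X in _ <= X + _]big_mkcond [X in _ <= _ + X]big_mkcond.
rewrite -big_split; apply: ler_sum => w _ /=.
by case: (A w); case: (B w); rewrite /= ?addr0 ?add0r // lerDl weight_ge0.
Qed.

Lemma proba_bigunion (I : finType) (P : pred I) (A : I -> pred Omega) :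
  proba (fun w => [exists i, P i && A i w]) <= \sum_(i | P i) proba (A i).
Proof.
rewrite /proba; under [X in _ <= X]eq_bigr do rewrite big_mkcond.
rewrite exchange_big /= big_mkcond; apply: ler_sum => w _.
have nn j : 0 <= (if A j w then weight w else 0) by case: ifP => // _; exact: weight_ge0.
case: ifP => [/existsP[i /andP[Pi Ai]]|_]; last exact: sumr_ge0.
by rewrite (bigD1 i) //= Ai lerDl sumr_ge0.
Qed.

(** From [expR (- x) >= 1 - x], by inversion. *)
Lemma expR_le_quad (x : R) : x <= 1 / 2 -> expR x <= 1 + x + 2 * x ^+ 2.
Proof.
move=> hx; have h1 : 0 < 1 - x by lra.
rewrite -[x in expR x]opprK expRN.
apply: (@le_trans _ _ (1 - x)^-1).
  by rewrite lef_pV2 ?posrE ?expR_gt0 // expR_ge1Dx.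
rewrite -[X in X <= _]mul1r ler_pdivrMr //.
have := sqr_ge0 x; nra.
Qed.

Context (J : eqType) (pos : J -> K).

(** Martingale structure: the coordinate [pos e] enters neither its own
    coefficient nor those listed after it. *)
Fixpoint predictable (T : Type) (c : J -> Omega -> T) (s : seq J) : Prop :=
  if s is e :: s' then
    [/\ pos e \notin map pos s',
        forall e', e' \in e :: s' -> indep_of (pos e) (c e') &
        predictable c s']
  else True.

Lemma predictable_comp (T U : Type) (c : J -> Omega -> T) (f : J -> T -> U) s :
  predictable c s -> predictable (fun e w => f e (c e w)) s.
Proof.
elim: s => //= e s IH [h1 h2 h3]; split => // [e' he' w b|]; last exact: IH.
by rewrite /= h2.
Qed.

(** Coordinates are integrated out from the head of the list: the remaining terms
    ignore that coordinate, and its own factor has mean at most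
    [1 + 2 c^2 v <= expR (2 c^2 v)]. *)
Lemma expect_exp_martingale (c : J -> Omega -> R) (Y : J -> bool -> R) (v : J -> R) s :
  predictable c s ->
  (forall e, e \in s -> \sum_b W (pos e) b * Y e b = 0) ->
  (forall e, e \in s -> \sum_b W (pos e) b * Y e b ^+ 2 <= v e) ->
  (forall e w b, e \in s -> c e w * Y e b <= 1 / 2) ->
  expect (fun w => expR (\sum_(e <- s)
    (c e w * Y e (w (pos e)) - 2 * c e w ^+ 2 * v e))) <= 1.
Proof.
elim: s => [|e s IH] /=.
  by move=> _ _ _ _; rewrite -[X in _ <= X](expect_cst 1); apply: expect_le => w;
     rewrite big_nil expR0.
move=> [h1 h2 h3] hY hv hc.
have {IH}IH := IH h3 (fun e' h => hY e' (mem_behead (s := e :: s) h))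
  (fun e' h => hv e' (mem_behead (s := e :: s) h))
  (fun e' w b h => hc e' w b (mem_behead (s := e :: s) h)).
rewrite (expect_resample (pos e)); apply: le_trans IH; apply: expect_le => w.
have ee : e \in e :: s by rewrite inE eqxx.
set rest := \sum_(e' <- s) _.
have restE b : \sum_(e' <- s) (c e' (upd w (pos e) b) * Y e' (upd w (pos e) b (pos e'))
     - 2 * c e' (upd w (pos e) b) ^+ 2 * v e') = rest.
  apply: eq_big_seq => e' es; rewrite h2 ?inE ?es ?orbT // upd_neq //.
  by apply: contraNneq h1 => <-; exact: map_f.
under eq_bigr do rewrite big_cons restE h2 // updE expRD expRD mulrA.
rewrite -mulr_suml.
rewrite -[X in _ <= X]mul1r ler_wpM2r ?expR_ge0 //.
apply: (@le_trans _ _ ((\sum_b W (pos e) b * (1 + c e w * Y e b + 2 * (c e w * Y e b) ^+ 2))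
   * expR (- (2 * c e w ^+ 2 * v e)))).
  rewrite mulr_suml; apply: ler_sum => b _.
  rewrite mulrA ler_wpM2r ?expR_ge0 // ler_wpM2l //.
  by apply: expR_le_quad; exact: hc.
have -> : \sum_b W (pos e) b * (1 + c e w * Y e b + 2 * (c e w * Y e b) ^+ 2)
  = 1 + c e w * (\sum_b W (pos e) b * Y e b)
    + 2 * c e w ^+ 2 * (\sum_b W (pos e) b * Y e b ^+ 2).
  have Wt : W (pos e) true = 1 - W (pos e) false by rewrite -(W1 (pos e)) addrK.
  by rewrite !big_bool /= Wt; ring.
rewrite hY // mulr0 addr0.
apply: (@le_trans _ _ ((1 + 2 * c e w ^+ 2 * v e) * expR (- (2 * c e w ^+ 2 * v e)))).
  by rewrite ler_wpM2r ?expR_ge0 // lerD2l ler_wpM2l ?hv // mulr_ge0 // sqr_ge0.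
apply: (@le_trans _ _ (expR (2 * c e w ^+ 2 * v e) * expR (- (2 * c e w ^+ 2 * v e)))).
  by rewrite ler_wpM2r ?expR_ge0 // expR_ge1Dx.
by rewrite -expRD subrr expR0.
Qed.

(** A Bernstein inequality in which the scale [L] may be random, as long as it
    does not depend on the coordinates being summed. *)
Lemma bernstein_upper (c : J -> Omega -> R) (L : Omega -> R) (Y : J -> bool -> R)
    (v : J -> R) (beta t : R) s :
  predictable c s ->
  (forall e, e \in s -> indep_of (pos e) L) ->
  (forall e, e \in s -> \sum_b W (pos e) b * Y e b = 0) ->
  (forall e, e \in s -> \sum_b W (pos e) b * Y e b ^+ 2 <= v e) ->
  (forall e b, e \in s -> `|Y e b| <= beta) ->
  (forall e w, e \in s -> `|c e w| * beta <= L w) ->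
  (forall w, 0 <= L w) ->
  (forall w, \sum_(e <- s) v e * c e w ^+ 2 <= L w ^+ 2) ->
  proba (fun w => t * L w < \sum_(e <- s) c e w * Y e (w (pos e)))
    <= expR ((1 - t) / 2).
Proof.
move=> hp hL hY hv hb hc L0 hV.
pose c' e w := c e w / (2 * L w).
have cY e w b : e \in s -> `|c e w * Y e b| <= L w.
  by move=> es; rewrite normrM (le_trans _ (hc e w es)) // ler_wpM2l ?hb.
have hp' : predictable c' s.
  rewrite /c'; elim: (s) (hp) (hL) => //= e s' IH [h1 h2 h3] hL'; split=> //.
    move=> e' he' w b; rewrite h2 // hL' // inE ?eqxx //.
  by apply: IH => // e' he'; apply: hL'; rewrite inE he' orbT.
have := expect_exp_martingale hp' hY hv.
have b2 e w b : e \in s -> c' e w * Y e b <= 1 / 2.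
  move=> es; rewrite /c' mulrAC.
  have [->|Ln0] := eqVneq (L w) 0; first by rewrite mulr0 invr0 mulr0.
  have Lp : 0 < L w by rewrite lt0r Ln0 L0.
  rewrite ler_pdivrMr ?mulr_gt0 // mul1r mulrA mulVf ?mul1r //.
  exact: le_trans (ler_norm _) (cY e w b es).
move=> /(_ b2) hE.
apply: (@le_trans _ _ (expect (fun w => expR ((1 - t) / 2) *
   expR (\sum_(e <- s) (c' e w * Y e (w (pos e)) - 2 * c' e w ^+ 2 * v e))))).
  apply: proba_le_expect => [w|w hw]; first by rewrite mulr_ge0 ?expR_ge0.
  have Lp : 0 < L w.
    rewrite lt0r L0 andbT; apply: contraTneq hw => LE; rewrite -leNgt LE mulr0.
    rewrite big_seq big1 // => e es; apply/eqP; rewrite -normr_le0.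
    by rewrite -[X in _ <= X]LE cY.
  rewrite -expRD -[X in X <= _]expR0 ler_expR sumrB.
  have -> : \sum_(e <- s) c' e w * Y e (w (pos e))
     = (\sum_(e <- s) c e w * Y e (w (pos e))) / (2 * L w).
    by rewrite mulr_suml; apply: eq_bigr => e _; rewrite /c' mulrAC.
  have -> : \sum_(e <- s) 2 * c' e w ^+ 2 * v e
     = (\sum_(e <- s) v e * c e w ^+ 2) / (2 * L w ^+ 2).
    rewrite mulr_suml; apply: eq_bigr => e _; rewrite /c'; field.
    by rewrite gt_eqF.
  have A1 : (\sum_(e <- s) v e * c e w ^+ 2) / (2 * L w ^+ 2) <= 1 / 2.
    rewrite ler_pdivrMr ?mulr_gt0 ?exprn_gt0 // mul1r mulrA mulVf ?mul1r ?hV //.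
  have A2 : t / 2 <= (\sum_(e <- s) c e w * Y e (w (pos e))) / (2 * L w).
    rewrite ler_pdivlMr ?mulr_gt0 //.
    have -> : t / 2 * (2 * L w) = t * L w by field.
    exact: ltW.
  lra.
rewrite /expect; under eq_bigr do rewrite mulrCA.
by rewrite -mulr_sumr ler_piMr ?expR_ge0.
Qed.

Lemma bernstein (c : J -> Omega -> R[i]) (L : Omega -> R) (Y : J -> bool -> R)
    (v : J -> R) (beta t : R) s :
  predictable c s ->
  (forall e, e \in s -> indep_of (pos e) L) ->
  (forall e, e \in s -> \sum_b W (pos e) b * Y e b = 0) ->
  (forall e, e \in s -> \sum_b W (pos e) b * Y e b ^+ 2 <= v e) ->
  (forall e b, e \in s -> `|Y e b| <= beta) -> 0 <= beta ->
  (forall e w, e \in s -> n[c e w] * beta <= L w) ->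
  (forall w, 0 <= L w) ->
  (forall w, \sum_(e <- s) v e * n[c e w] ^+ 2 <= L w ^+ 2) ->
  proba (fun w => 2 * t * L w < n[\sum_(e <- s) c e w * (Y e (w (pos e)))%:C])
    <= 4 * expR ((1 - t) / 2).
Proof.
move=> hp hL hY hv hb b0 hc L0 hV.
have v0 e : e \in s -> 0 <= v e.
  by move=> es; apply: le_trans (hv e es); apply: sumr_ge0 => b _;
     rewrite mulr_ge0 ?sqr_ge0.
have one (f : R[i] -> R) : (forall x, `|f x| <= n[x]) ->
  proba (fun w => t * L w < \sum_(e <- s) f (c e w) * Y e (w (pos e)))
     <= expR ((1 - t) / 2).
  move=> hf; apply: (bernstein_upper (v := v) (beta := beta)) => //.
  - exact: (predictable_comp (fun=> f)).
  - by move=> e w es; apply: le_trans (hc e w es); rewrite ler_wpM2r.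
  - move=> w; apply: le_trans (hV w); rewrite big_seq [X in _ <= X]big_seq.
    apply: ler_sum => e es; rewrite ler_wpM2l ?v0 //.
    by rewrite -[f _ ^+ 2]real_normK ?num_real // ler_pXn2r ?nnegrE ?normc_ge0.
pose X w := \sum_(e <- s) c e w * (Y e (w (pos e)))%:C.
have sumE (f : R[i] -> R) w : (forall x y, f (x + y) = f x + f y) -> f 0 = 0 ->
   (forall x (a : R), f (x * a%:C) = f x * a) ->
   f (X w) = \sum_(e <- s) f (c e w) * Y e (w (pos e)).
  move=> fD f0 fM; rewrite /X (big_morph f fD f0); apply: eq_bigr => e _; exact: fM.
have [ReB ImB] := (@Re_le_normc R, @Im_le_normc R).
have ReNB (x : R[i]) : `|- Re x| <= n[x] by rewrite normrN.
have ImNB (x : R[i]) : `|- Im x| <= n[x] by rewrite normrN.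
have E1 w : Re (X w) = \sum_(e <- s) Re (c e w) * Y e (w (pos e)).
  by apply: sumE => // [x y|x a]; [exact: ReD|rewrite mulrC ReCM mulrC].
have E2 w : Im (X w) = \sum_(e <- s) Im (c e w) * Y e (w (pos e)).
  by apply: sumE => // [x y|x a]; [exact: ImD|rewrite mulrC ImCM mulrC].
have E3 w : - Re (X w) = \sum_(e <- s) (- Re (c e w)) * Y e (w (pos e)).
  by rewrite E1 -sumrN; apply: eq_bigr => e _; rewrite mulNr.
have E4 w : - Im (X w) = \sum_(e <- s) (- Im (c e w)) * Y e (w (pos e)).
  by rewrite E2 -sumrN; apply: eq_bigr => e _; rewrite mulNr.
apply: (@le_trans _ _ (proba (fun w =>
  ((t * L w < Re (X w)) || (t * L w < - Re (X w))) ||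
  ((t * L w < Im (X w)) || (t * L w < - Im (X w)))))).
  apply: proba_sub => w hw; rewrite -/(X w) in hw.
  rewrite -!ltr_normr; case: (ltP _ `|Re (X w)|) => //= hr.
  have := normc_le_ReIm (X w); lra.
have -> : 4 * expR ((1 - t) / 2) = (expR ((1 - t) / 2) + expR ((1 - t) / 2))
  + (expR ((1 - t) / 2) + expR ((1 - t) / 2)) by ring.
have ext (A B : pred Omega) : A =1 B -> proba A = proba B by move=> h; apply: eq_bigl.
apply: (le_trans (proba_union _ _)); apply: lerD.
- apply: (le_trans (proba_union _ _)); apply: lerD.
  + by rewrite (ext _ _ (fun w => congr1 _ (E1 w))) (one _ ReB).
  + by rewrite (ext _ _ (fun w => congr1 _ (E3 w))) (one (fun x => - Re x) ReNB).
- apply: (le_trans (proba_union _ _)); apply: lerD.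
  + by rewrite (ext _ _ (fun w => congr1 _ (E2 w))) (one _ ImB).
  + by rewrite (ext _ _ (fun w => congr1 _ (E4 w))) (one (fun x => - Im x) ImNB).
Qed.

End ProductSpace.

(** * The random matrix on the finite product space *)

Section Predictable.
Context (R : realType) (K : finType) (J : eqType) (pos : J -> K).

Lemma predictable_sorted (T : Type) (lt : rel J) (c : J -> {ffun K -> bool} -> T) s :
  transitive lt -> irreflexive lt -> injective pos -> sorted lt s ->
  (forall a a', a = a' \/ lt a a' -> indep_of (pos a) (c a')) ->
  predictable pos c s.
Proof.
move=> tr irr pinj + h; elim: s => //= a s IH ps.
have /allP lts := order_path_min tr ps.
split=> [|a'|].
- by apply/negP => /mapP[b /lts ab /pinj E]; move: ab; rewrite -E irr.
- by rewrite inE => /orP[/eqP->|/lts ?]; apply: h; [left|right].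
- exact: IH (path_sorted ps).
Qed.

End Predictable.

Section MatrixModel.
Context (R : realType) (N : nat) (s : 'I_N -> 'I_N -> R) (q : R).
Hypothesis s_sym : forall i j, s i j = s j i.
Hypothesis s_ge0 : forall i j, 0 <= s i j.
Hypothesis q_gt0 : 0 < q.
Hypothesis qs_le1 : forall i j, q * s i j <= 1.

Local Notation edges := ('I_N * 'I_N)%type.
Local Notation Omega := {ffun edges -> bool}.

(** Each unordered pair of indices is represented by its increasing ordering;
    the other pairs carry a deterministic dummy coordinate. *)
Definition edge (a b : 'I_N) : edges := if (a <= b)%N then (a, b) else (b, a).

Definition edge_weight (e : edges) (b : bool) : R :=
  if (e.1 <= e.2)%N then (if b then q * s e.1 e.2 else 1 - q * s e.1 e.2)
  else (if b then 0 else 1).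

Definition edge_val (e : edges) (b : bool) : R :=
  if b then (Num.sqrt q)^-1 * (1 - q * s e.1 e.2)
  else - ((Num.sqrt q)^-1 * (q * s e.1 e.2)).

Definition config_mx (w : Omega) : 'M[R]_N :=
  \matrix_(a, b) edge_val (edge a b) (w (edge a b)).

Lemma edgeC a b : edge a b = edge b a.
Proof.
rewrite /edge; case: ltngtP => // /val_inj -> //.
Qed.

Lemma edge_inj i : injective (edge i).
Proof.
move=> a b; rewrite /edge; case: leqP => h1; case: leqP => h2 [].
- by [].
- by move=> ? ?; subst.
- by move=> ? ?; subst.
- by [].
Qed.

Lemma edge_le a b : ((edge a b).1 <= (edge a b).2)%N.
Proof. by rewrite /edge; case: (leqP a b) => // /ltnW. Qed.

Lemma s_edge a b : s (edge a b).1 (edge a b).2 = s a b.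
Proof. by rewrite /edge; case: ifP. Qed.

Lemma edge_weight_ge0 e b : 0 <= edge_weight e b.
Proof.
by rewrite /edge_weight; case: ifP => _; case: b; rewrite // ?subr_ge0 // mulr_ge0 // ltW.
Qed.

Lemma edge_weight_sum e : edge_weight e true + edge_weight e false = 1.
Proof. by rewrite /edge_weight; case: ifP => _; [rewrite addrC subrK|rewrite add0r]. Qed.

Lemma config_mx_sym w : sym_mx (config_mx w).
Proof. by move=> a b; rewrite !mxE edgeC. Qed.

Lemma edge_neq i a x y : x != i -> y != i -> edge x y != edge i a.
Proof.
move=> xi yi; rewrite /edge; case: ifP => _; case: ifP => _; apply/eqP => -[h1 h2];
  by move: xi yi; rewrite ?h1 ?h2 eqxx.
Qed.

Lemma minor_indep i a : indep_of (edge i a) (fun w => minor_mx i (config_mx w)).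
Proof.
move=> w b; apply/matrixP => x y; rewrite !mxE.
case: ifP => // /norP[xi yi].
by rewrite upd_neq // edge_neq.
Qed.

Local Notation sq := (Num.sqrt q).
Let sq0 : 0 < sq. Proof. by rewrite sqrtr_gt0. Qed.
Let sqV0 : 0 <= sq^-1. Proof. by rewrite invr_ge0 ltW. Qed.
Let sqV2 : sq^-1 ^+ 2 = q^-1. Proof. by rewrite exprVn sqr_sqrtr // ltW. Qed.
Let ps0 i j : 0 <= q * s i j. Proof. by rewrite mulr_ge0 // ltW. Qed.

Lemma edge_weight_edge i a b :
  edge_weight (edge i a) b = if b then q * s i a else 1 - q * s i a.
Proof. by rewrite /edge_weight edge_le s_edge. Qed.

Lemma edge_val_edge i a b : edge_val (edge i a) b =
  if b then sq^-1 * (1 - q * s i a) else - (sq^-1 * (q * s i a)).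
Proof. by rewrite /edge_val s_edge. Qed.

Lemma edge_val_norm i a b : `|edge_val (edge i a) b| <= sq^-1.
Proof.
rewrite edge_val_edge; have := qs_le1 i a; have := ps0 i a => h0 h1.
case: b => /=; rewrite ?normrN ger0_norm ?mulr_ge0 ?subr_ge0 ?(ltW q_gt0) //; rewrite ler_piMr //.
by rewrite gerBl.
Qed.

Lemma config_mx_norm w i a : `|config_mx w i a| <= sq^-1.
Proof. by rewrite mxE edge_val_norm. Qed.

Lemma edge_mean i a : \sum_b edge_weight (edge i a) b * edge_val (edge i a) b = 0.
Proof.
by under eq_bigr do rewrite edge_weight_edge edge_val_edge; rewrite big_bool /=; ring.
Qed.

Lemma edge_var i a : \sum_b edge_weight (edge i a) b * edge_val (edge i a) b ^+ 2
  = s i a * (1 - q * s i a).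
Proof.
under eq_bigr do rewrite edge_weight_edge edge_val_edge.
rewrite big_bool /= sqrrN !exprMn sqV2.
by field; rewrite gt_eqF.
Qed.

Definition edge_sqr (i a : 'I_N) (b : bool) : R :=
  edge_val (edge i a) b ^+ 2 - s i a * (1 - q * s i a).

Lemma s_le_qV i a : s i a <= q^-1.
Proof. by rewrite -(ler_pM2l q_gt0) mulfV ?gt_eqF. Qed.

Lemma edge_var_bounds i a : 0 <= s i a * (1 - q * s i a) <= s i a.
Proof. by rewrite mulr_ge0 ?subr_ge0 //= ler_piMr // gerBl. Qed.

Lemma edge_val_sqr_le i a b : edge_val (edge i a) b ^+ 2 <= q^-1.
Proof.
rewrite -sqV2 -[edge_val _ _ ^+ 2]real_normK ?num_real //.
by rewrite ler_pXn2r ?nnegrE ?edge_val_norm.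
Qed.

Lemma edge_sqr_norm i a b : `|edge_sqr i a b| <= q^-1.
Proof.
have /andP[h1 h2] := edge_var_bounds i a; have h3 := s_le_qV i a.
have h4 := edge_val_sqr_le i a b; have h5 := sqr_ge0 (edge_val (edge i a) b).
rewrite /edge_sqr ler_norml; apply/andP; split; lra.
Qed.

Lemma edge_sqr_mean i a : \sum_b edge_weight (edge i a) b * edge_sqr i a b = 0.
Proof.
rewrite /edge_sqr; under eq_bigr do rewrite mulrBr.
by rewrite sumrB edge_var -mulr_suml big_bool /= edge_weight_sum mul1r subrr.
Qed.

Lemma edge_sqr_var i a :
  \sum_b edge_weight (edge i a) b * edge_sqr i a b ^+ 2 <= s i a / q.
Proof.
have /andP[h1 h2] := edge_var_bounds i a.
apply: (@le_trans _ _ (\sum_b edge_weight (edge i a) b *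
    (edge_val (edge i a) b ^+ 2 / q - 2 * edge_val (edge i a) b ^+ 2 * (s i a * (1 - q * s i a))
      + (s i a * (1 - q * s i a)) ^+ 2))).
  apply: ler_sum => b _; rewrite ler_wpM2l ?edge_weight_ge0 //.
  rewrite /edge_sqr sqrrB -mulr_natl mulrA lerD2r lerD2r.
  by rewrite expr2 ler_wpM2l ?sqr_ge0 ?edge_val_sqr_le.
set v := s i a * (1 - q * s i a) in h1 h2 *.
rewrite (eq_bigr (fun b => (edge_weight (edge i a) b * edge_val (edge i a) b ^+ 2) * (q^-1 - 2 * v)
   + edge_weight (edge i a) b * v ^+ 2)) => [|b _]; last by ring.
rewrite big_split /= -!mulr_suml edge_var -/v big_bool /= edge_weight_sum.
have q0 : 0 <= q^-1 by rewrite invr_ge0 ltW.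
have := ler_wpM2r q0 h2; have := sqr_ge0 v.
have -> : v * (q^-1 - 2 * v) + 1 * v ^+ 2 = v / q - v ^+ 2 by ring.
lra.
Qed.

(** The deterministic bounds [B], [S], [W] are quantified inside the events: the
    probability estimates then hold without information on the minor, and the
    bounds available at a given stage are plugged in later. *)

Section Events.
Variables (H : 'M[R]_N) (z : R[i]) (t : R) (i : 'I_N).
Local Notation Gi := (green (minor_mx i H) z).

Definition lin_event := forall j (B S : R), 0 <= B -> 0 <= S ->
  (forall a, a != i -> n[Gi a j] <= B) ->
  \sum_(a | a != i) s i a * n[Gi a j] ^+ 2 <= S ^+ 2 ->
  n[\sum_(a | a != i) (H i a)%:C * Gi a j] <= 2 * t * (B / sq + S).

Definition diag_event := forall (B S : R), 0 <= B -> 0 <= S ->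
  (forall a, a != i -> n[Gi a a] <= B) ->
  \sum_(a | a != i) s i a <= S ^+ 2 ->
  n[\sum_(a | a != i) (H i a ^+ 2 - s i a * (1 - q * s i a))%:C * Gi a a]
    <= 2 * t * (B / q + B * S / sq).

Definition quad_event := forall (B W1 S : R) (W : 'I_N -> R),
  0 <= B -> (forall a, 0 <= W a) -> 0 <= W1 -> 0 <= S ->
  (forall a b, a != i -> b != i -> n[Gi a b] <= B) ->
  (forall a, a != i -> \sum_(b | b != i) s i b * n[Gi a b] ^+ 2 <= W a ^+ 2) ->
  (forall a, a != i -> B / sq + W a <= W1) ->
  \sum_(a | a != i) s i a * (B / sq + W a) ^+ 2 <= S ^+ 2 ->
  n[\sum_(a | a != i) \sum_(b | (b != i) && (b != a))
      (H i a)%:C * (H i b)%:C * Gi a b] <= 8 * t ^+ 2 * (W1 / sq + S).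

End Events.

Definition good_event (H : 'M[R]_N) (z : R[i]) (t : R) :=
  forall i, [/\ lin_event H z t i, diag_event H z t i & quad_event H z t i].

Local Notation Pr := (proba edge_weight).
Local Notation Gm w z i := (green (minor_mx i (config_mx w)) z).

Definition row_seq (i : 'I_N) := [seq a <- rev (enum 'I_N) | a != i].

Lemma sum_row_seq (V : nmodType) i (F : 'I_N -> V) :
  \sum_(a <- row_seq i) F a = \sum_(a | a != i) F a.
Proof.
rewrite /row_seq big_filter (perm_big _ (permEl (perm_rev _))) big_enum_cond.
by apply: eq_bigl => a; rewrite inE.
Qed.

Let gt_ord (a b : 'I_N) := (b < a)%N.

Lemma row_seq_sorted i : sorted gt_ord (row_seq i).
Proof.
have tr : transitive gt_ord by move=> b a c h1 h2; exact: ltn_trans h2 h1.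
apply: sorted_filter => //; rewrite rev_sorted.
have := iota_ltn_sorted 0 N; rewrite -val_enum_ord.
by rewrite sorted_map.
Qed.

Lemma row_predictable (T : Type) i (c : 'I_N -> Omega -> T) :
  (forall a a' : 'I_N, (a' <= a)%N -> indep_of (edge i a) (c a')) ->
  predictable (edge i) c (row_seq i).
Proof.
move=> h; apply: (predictable_sorted (lt := gt_ord)).
- by move=> b a c' h1 h2; exact: ltn_trans h2 h1.
- by move=> a; rewrite /gt_ord ltnn.
- exact: edge_inj.
- exact: row_seq_sorted.
by move=> a a' [->|/ltnW]; apply: h.
Qed.

Lemma Gm_indep z i a : indep_of (edge i a) (fun w => Gm w z i).
Proof. by move=> w b; rewrite minor_indep. Qed.

Local Notation rmax i F := (\big[Num.max/0]_(a | a != i) F a).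

Lemma rmax_ge0 i (F : 'I_N -> R) : 0 <= rmax i F.
Proof. exact: bigmax_ge_id. Qed.

Lemma rmax_ge i (F : 'I_N -> R) a : a != i -> F a <= rmax i F.
Proof. by move=> ai; exact: le_bigmax_cond. Qed.

Lemma rmax_le i (F : 'I_N -> R) B : 0 <= B -> (forall a, a != i -> F a <= B) ->
  rmax i F <= B.
Proof. by move=> B0 h; apply: bigmax_le. Qed.

Lemma sqrt_le (x S : R) : 0 <= S -> x <= S ^+ 2 -> Num.sqrt x <= S.
Proof. by move=> S0 h; rewrite -[S]ger0_norm // -sqrtr_sqr ler_wsqrtr. Qed.

Lemma sum_s_ge0 i (P : pred 'I_N) (F : 'I_N -> R) : 0 <= \sum_(a | P a) s i a * F a ^+ 2.
Proof. by apply: sumr_ge0 => a _; rewrite mulr_ge0 ?sqr_ge0. Qed.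

(** A scale dominating both the largest coefficient and the standard deviation
    of a linear form in the [i]-th row. *)
Definition lin_scale i (f : 'I_N -> R) : R :=
  rmax i f / sq + Num.sqrt (\sum_(a | a != i) s i a * f a ^+ 2).

Lemma lin_scale_ge0 i f : 0 <= lin_scale i f.
Proof. by rewrite addr_ge0 ?sqrtr_ge0 // divr_ge0 ?rmax_ge0 // ltW. Qed.

Lemma lin_scale_le i f B S : 0 <= B -> 0 <= S -> (forall a, a != i -> f a <= B) ->
  \sum_(a | a != i) s i a * f a ^+ 2 <= S ^+ 2 -> lin_scale i f <= B / sq + S.
Proof.
by move=> B0 S0 hB hS; rewrite lerD ?sqrt_le // ler_wpM2r // rmax_le.
Qed.

(** The linear forms occurring below: coefficients depending on the other rows,
    and on the entries of the [i]-th row preceding their own. *)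
Lemma row_bernstein i (c : 'I_N -> Omega -> R[i]) (f : 'I_N -> Omega -> R) (t : R) :
  (forall a a' : 'I_N, (a' <= a)%N -> indep_of (edge i a) (c a')) ->
  (forall a a', indep_of (edge i a) (f a')) ->
  (forall a w, n[c a w] <= f a w) ->
  Pr (fun w => 2 * t * lin_scale i (f^~ w)
       < n[\sum_(a | a != i) (config_mx w i a)%:C * c a w])
    <= 4 * expR ((1 - t) / 2).
Proof.
move=> hc hf hcf.
have f0 a w : 0 <= f a w by exact: le_trans (normc_ge0 _) (hcf a w).
have := @bernstein R _ _ edge_weight_ge0 edge_weight_sum _ (edge i) c
  (fun w => lin_scale i (f^~ w)) (fun a => edge_val (edge i a)) (s i) sq^-1 t (row_seq i).
have HP : predictable (edge i) c (row_seq i) by exact: row_predictable.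
move=> /(_ HP) HB; apply: le_trans (HB _ _ _ _ _ _ _ _) => //.
- rewrite le_eqVlt; apply/orP; left; apply/eqP; apply: eq_bigl => w.
  rewrite sum_row_seq; congr (_ < n[_]); apply: eq_bigr => a _.
  by rewrite mulrC mxE.
- move=> a _ w b; rewrite /lin_scale; congr (_ / _ + Num.sqrt _).
    by apply: eq_bigr => a' _; rewrite hf.
  by apply: eq_bigr => a' _; rewrite hf.
- by move=> a _; exact: edge_mean.
- by move=> a _; rewrite edge_var; case/andP: (edge_var_bounds i a).
- by move=> a b _; exact: edge_val_norm.
- move=> a w; rewrite mem_filter => /andP[ai _]; rewrite /lin_scale.
  apply: (@le_trans _ _ (rmax i (f^~ w) / sq)); last by rewrite lerDl sqrtr_ge0.
  rewrite ler_wpM2r // (le_trans (hcf a w)) //; exact: (rmax_ge (f^~ w)).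
- by move=> w; exact: lin_scale_ge0.
move=> w; rewrite sum_row_seq.
apply: (@le_trans _ _ (\sum_(a | a != i) s i a * f a w ^+ 2)).
  by apply: ler_sum => a _; rewrite ler_wpM2l // ler_pXn2r ?nnegrE ?normc_ge0.
rewrite -{1}(sqr_sqrtr (sum_s_ge0 i (fun a => a != i) (f^~ w))) ler_pXn2r ?nnegrE ?sqrtr_ge0 //.
  by rewrite lerDr divr_ge0 ?rmax_ge0 // ltW.
exact: lin_scale_ge0.
Qed.

Definition lin_bad z t i j w :=
  2 * t * lin_scale i (fun a => n[Gm w z i a j])
    < n[\sum_(a | a != i) (config_mx w i a)%:C * Gm w z i a j].

Lemma lin_bad_proba z t i j : Pr (lin_bad z t i j) <= 4 * expR ((1 - t) / 2).
Proof.
apply: (row_bernstein (c := fun a w => Gm w z i a j)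
  (f := fun a w => n[Gm w z i a j])) => // a a'; first move=> _.
  by move=> w b; rewrite Gm_indep.
by move=> w b; rewrite Gm_indep.
Qed.

Lemma lin_event_of z t i w : 0 <= t -> (forall j, ~~ lin_bad z t i j w) ->
  lin_event (config_mx w) z t i.
Proof.
move=> t0 h j B S B0 S0 hB hS; have := h j; rewrite -leNgt => /le_trans; apply.
by rewrite ler_wpM2l ?mulr_ge0 // lin_scale_le.
Qed.

Definition diag_bad z t i w :=
  2 * t * (rmax i (fun a => n[Gm w z i a a]) / q
           + Num.sqrt (\sum_(a | a != i) s i a / q * n[Gm w z i a a] ^+ 2))
    < n[\sum_(a | a != i) (config_mx w i a ^+ 2 - s i a * (1 - q * s i a))%:C * Gm w z i a a].

Lemma diag_bad_proba z t i : Pr (diag_bad z t i) <= 4 * expR ((1 - t) / 2).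
Proof.
pose c a w := Gm w z i a a.
have := @bernstein R _ _ edge_weight_ge0 edge_weight_sum _ (edge i) c
  (fun w => rmax i (fun a => n[Gm w z i a a]) / q
     + Num.sqrt (\sum_(a | a != i) s i a / q * n[Gm w z i a a] ^+ 2))
  (edge_sqr i) (fun a => s i a / q) q^-1 t (row_seq i).
have HP : predictable (edge i) c (row_seq i).
  by apply: row_predictable => a a' _ w b; rewrite /c Gm_indep.
have qV0 : 0 <= q^-1 by rewrite invr_ge0 ltW.
have sum0 w : 0 <= \sum_(a | a != i) s i a / q * n[Gm w z i a a] ^+ 2.
  by apply: sumr_ge0 => a _; rewrite mulr_ge0 ?sqr_ge0 // mulr_ge0.
move=> /(_ HP) HB; apply: le_trans (HB _ _ _ _ _ _ _ _) => //.
- rewrite le_eqVlt; apply/orP; left; apply/eqP; apply: eq_bigl => w.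
  rewrite sum_row_seq /diag_bad; congr (_ < n[_]); apply: eq_bigr => a _.
  by rewrite mulrC mxE.
- by move=> a _ w b; rewrite Gm_indep.
- by move=> a _; exact: edge_sqr_mean.
- by move=> a _; exact: edge_sqr_var.
- by move=> a b _; exact: edge_sqr_norm.
- move=> a w; rewrite mem_filter => /andP[ai _].
  apply: (@le_trans _ _ (rmax i (fun a => n[Gm w z i a a]) / q)).
    by rewrite ler_wpM2r // (rmax_ge (fun a => n[Gm w z i a a])).
  by rewrite lerDl sqrtr_ge0.
- by move=> w; rewrite addr_ge0 ?sqrtr_ge0 // mulr_ge0 ?rmax_ge0.
move=> w; rewrite sum_row_seq -{1}(sqr_sqrtr (sum0 w)) ler_pXn2r ?nnegrE ?sqrtr_ge0 //.
  by rewrite lerDr mulr_ge0 ?rmax_ge0.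
by rewrite addr_ge0 ?sqrtr_ge0 // mulr_ge0 ?rmax_ge0.
Qed.

Lemma diag_event_of z t i w : 0 <= t -> ~~ diag_bad z t i w ->
  diag_event (config_mx w) z t i.
Proof.
move=> t0 + B S B0 S0 hB hS; rewrite /diag_bad -leNgt => /le_trans; apply.
rewrite ler_wpM2l ?mulr_ge0 // lerD //.
  by rewrite ler_wpM2r ?invr_ge0 ?(ltW q_gt0) // rmax_le.
apply: sqrt_le; first by rewrite !mulr_ge0.
rewrite !exprMn sqV2 mulrAC.
apply: (@le_trans _ _ (\sum_(a | a != i) s i a * (B ^+ 2 / q))).
  apply: ler_sum => a ai; rewrite -mulrA ler_wpM2l // mulrC.
  by rewrite ler_wpM2r ?invr_ge0 ?(ltW q_gt0) // ler_pXn2r ?nnegrE ?normc_ge0 ?hB.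
rewrite -mulr_suml mulrC ler_wpM2l // mulr_ge0 ?sqr_ge0 // invr_ge0 ltW //.
Qed.

(** The quadratic form is a linear form with coefficients [half_row]; these are
    themselves linear forms in the preceding entries of the row, and are
    truncated at their typical size [2 t * lin_scale] to keep them bounded. *)
Definition half_row z (i a : 'I_N) (w : Omega) : R[i] :=
  \sum_(b | (b != i) && (b < a)%N) (config_mx w i b)%:C * Gm w z i a b.

Definition row_scale z i a w := lin_scale i (fun b => n[Gm w z i a b]).

Definition half_row_bad z t i a w := 2 * t * row_scale z i a w < n[half_row z i a w].

Lemma half_row_bad_proba z t i a : Pr (half_row_bad z t i a) <= 4 * expR ((1 - t) / 2).
Proof.
have := @row_bernstein i (fun b w => if (b < a)%N then Gm w z i a b else 0)
  (fun b w => n[Gm w z i a b]) t.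
move=> HB; apply: le_trans (HB _ _ _).
- rewrite le_eqVlt; apply/orP; left; apply/eqP; apply: eq_bigl => w.
  rewrite /half_row_bad /half_row big_mkcondr; congr (_ < n[_]).
  by apply: eq_bigr => b _; case: ifP; rewrite ?mulr0.
- by move=> b b' _ w x; rewrite Gm_indep.
- by move=> b b' w x; rewrite Gm_indep.
- by move=> b w; case: ifP; rewrite ?Normc.normc0 ?normc_ge0.
Qed.

Lemma half_row_indep z i (a a' : 'I_N) : (a' <= a)%N -> indep_of (edge i a) (half_row z i a').
Proof.
move=> aa w x; rewrite /half_row; apply: eq_bigr => b /andP[bi ba].
rewrite Gm_indep; congr (_%:C * _); rewrite !mxE upd_neq //.
by apply: contraTneq ba => /edge_inj ->; rewrite -leqNgt.
Qed.

Lemma row_scale_indep z i a a' : indep_of (edge i a) (row_scale z i a').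
Proof. by move=> w x; rewrite /row_scale Gm_indep. Qed.

Definition trunc_half_row z t i a w :=
  if n[half_row z i a w] <= 2 * t * row_scale z i a w then half_row z i a w else 0.

Definition quad_bad z t i w :=
  2 * t * lin_scale i (fun a => 2 * t * row_scale z i a w)
    < n[\sum_(a | a != i) (config_mx w i a)%:C * trunc_half_row z t i a w].

Lemma quad_bad_proba z t i : 0 <= t -> Pr (quad_bad z t i) <= 4 * expR ((1 - t) / 2).
Proof.
move=> t0; apply: (@row_bernstein i (trunc_half_row z t i)
  (fun a w => 2 * t * row_scale z i a w) t).
- by move=> a a' aa w x; rewrite /trunc_half_row half_row_indep // row_scale_indep.
- by move=> a a' w x; rewrite row_scale_indep.
move=> a w; rewrite /trunc_half_row; case: ifP => // _.
by rewrite Normc.normc0 !mulr_ge0 // lin_scale_ge0.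
Qed.

Lemma quad_event_of z t i w : 0 <= t -> 0 < Im z -> ~~ quad_bad z t i w ->
  (forall a, ~~ half_row_bad z t i a w) -> quad_event (config_mx w) z t i.
Proof.
move=> t0 z0 nb nh B W1 S W B0 W0 W10 S0 hB hW hW1 hS.
set G := green _ z in hB hW *.
have Gsym a b : G a b = G b a by apply: green_sym; apply/minor_mx_sym/config_mx_sym.
have trE a : trunc_half_row z t i a w = half_row z i a w.
  by rewrite /trunc_half_row; have := nh a; rewrite /half_row_bad -leNgt => ->.
have E : \sum_(a | a != i) \sum_(b | (b != i) && (b != a))
      (config_mx w i a)%:C * (config_mx w i b)%:C * G a b
    = 2%:R * \sum_(a | a != i) (config_mx w i a)%:C * trunc_half_row z t i a w.
  pose F a b := (config_mx w i a)%:C * (config_mx w i b)%:C * G a b.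
  have Fs a b : F a b = F b a by rewrite /F Gsym; ring.
  have split_ a : \sum_(b | (b != i) && (b != a)) F a b
     = \sum_(b | (b != i) && (b < a)%N) F a b + \sum_(b | (b != i) && (a < b)%N) F a b.
    rewrite (bigID (fun b : 'I_N => (b < a)%N)) /=; congr (_ + _).
      apply: eq_bigl => b; rewrite -andbA; congr (_ && _).
      by rewrite -val_eqE /=; case: ltngtP.
    apply: eq_bigl => b; rewrite -andbA; congr (_ && _).
    by rewrite -val_eqE /=; case: ltngtP.
  have H1 : \sum_(a | a != i) \sum_(b | (b != i) && (b < a)%N) F a b
     = \sum_(a | a != i) (config_mx w i a)%:C * trunc_half_row z t i a w.
    apply: eq_bigr => a _; rewrite trE /half_row mulr_sumr.
    by apply: eq_bigr => b _; rewrite /F mulrA.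
  rewrite (eq_bigr _ (fun a _ => split_ a)) big_split /=.
  have -> : \sum_(a | a != i) \sum_(b | (b != i) && (a < b)%N) F a b
     = \sum_(a | a != i) \sum_(b | (b != i) && (b < a)%N) F a b.
    rewrite (exchange_big_dep (fun b => b != i)) => [|a b _ /andP[]] //=.
    apply: eq_bigr => b bi; rewrite (eq_bigl (fun a : 'I_N => (a != i) && (a < b)%N)).
      by apply: eq_bigr => a _; exact: Fs.
    by move=> a; rewrite bi.
  by rewrite H1 mulr_natl mulr2n.
rewrite E Normc.normcM.
have -> : n[2%:R : R[i]] = 2 by rewrite natCE normcC ger0_norm.
have hsc a : a != i -> row_scale z i a w <= B / sq + W a.
  by move=> ai; apply: lin_scale_le => //; [move=> b bi; exact: hB|exact: hW].
move: nb; rewrite /quad_bad -leNgt => nb.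
apply: (@le_trans _ _ (2 * (2 * t * (2 * t * (W1 / sq + S))))); last first.
  by rewrite le_eqVlt; apply/orP; left; apply/eqP; ring.
rewrite ler_wpM2l // (le_trans nb) // ler_wpM2l ?mulr_ge0 //.
have -> : 2 * t * (W1 / sq + S) = (2 * t * W1) / sq + 2 * t * S by ring.
apply: lin_scale_le; rewrite ?mulr_ge0 //.
  by move=> a ai; rewrite ler_wpM2l ?mulr_ge0 // (le_trans (hsc a ai)) ?hW1.
rewrite exprMn; apply: le_trans (ler_wpM2l _ hS); last by rewrite sqr_ge0.
rewrite mulr_sumr; apply: ler_sum => a ai; rewrite exprMn mulrCA ler_wpM2l ?sqr_ge0 //.
rewrite ler_wpM2l // ler_pXn2r ?nnegrE ?hsc //; first exact: lin_scale_ge0.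
by rewrite addr_ge0 // mulr_ge0.
Qed.

Lemma good_event_proba z t : 0 <= t -> 0 < Im z -> (0 < N)%N ->
  Pr (fun w => ~~ `[< good_event (config_mx w) z t >])
    <= 16 * N%:R ^+ 2 * expR ((1 - t) / 2).
Proof.
move=> t0 z0 N0; set p := 4 * expR ((1 - t) / 2).
have p0 : 0 <= p by rewrite mulr_ge0 ?expR_ge0.
pose A1 w := [exists ij : 'I_N * 'I_N, true && lin_bad z t ij.1 ij.2 w].
pose A2 w := [exists i, true && diag_bad z t i w].
pose A3 w := [exists ia : 'I_N * 'I_N, true && half_row_bad z t ia.1 ia.2 w].
pose A4 w := [exists i, true && quad_bad z t i w].
apply: (@le_trans _ _ (Pr (fun w => (A1 w || A2 w) || (A3 w || A4 w)))).
  apply: proba_sub; first exact: edge_weight_ge0.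
  move=> w; apply: contraR; rewrite !negb_or => /andP[/andP[h1 h2] /andP[h3 h4]].
  apply/asboolP => i; split.
  - apply: lin_event_of => // j; apply: contra h1 => h1; apply/existsP.
    by exists (i, j).
  - by apply: diag_event_of => //; apply: contra h2 => h2; apply/existsP; exists i.
  - apply: quad_event_of => //.
      by apply: contra h4 => h4; apply/existsP; exists i.
    by move=> a; apply: contra h3 => h3; apply/existsP; exists (i, a).
have pu := proba_union edge_weight_ge0; have pb := proba_bigunion edge_weight_ge0.
have NN : (N%:R : R) <= N%:R ^+ 2 by rewrite expr2 ler_peMr // ler1n.
have S2 (A : 'I_N * 'I_N -> pred Omega) : (forall ij, Pr (A ij) <= p) ->
    Pr (fun w => [exists ij, true && A ij w]) <= N%:R ^+ 2 * p.
  move=> h; apply: (le_trans (pb _ _ _)).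
  apply: (@le_trans _ _ (\sum_(ij : 'I_N * 'I_N) p)); first exact: ler_sum.
  by rewrite sumr_const card_prod card_ord -[X in X <= _]mulr_natl natrM expr2.
have S1 (A : 'I_N -> pred Omega) : (forall i, Pr (A i) <= p) ->
    Pr (fun w => [exists i, true && A i w]) <= N%:R ^+ 2 * p.
  move=> h; apply: (le_trans (pb _ _ _)).
  apply: (@le_trans _ _ (\sum_(i : 'I_N) p)); first exact: ler_sum.
  by rewrite sumr_const card_ord -[X in X <= _]mulr_natl ler_wpM2r.
have -> : 16 * N%:R ^+ 2 * expR ((1 - t) / 2)
  = (N%:R ^+ 2 * p + N%:R ^+ 2 * p) + (N%:R ^+ 2 * p + N%:R ^+ 2 * p).
  by rewrite /p; ring.
apply: (le_trans (pu _ _)); apply: lerD; apply: (le_trans (pu _ _)); apply: lerD.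
- by apply: (S2 (fun ij => lin_bad z t ij.1 ij.2)) => ij; exact: lin_bad_proba.
- by apply: S1 => i; exact: diag_bad_proba.
- by apply: (S2 (fun ij => half_row_bad z t ij.1 ij.2)) => ij; exact: half_row_bad_proba.
- by apply: S1 => i; exact: quad_bad_proba.
Qed.

End MatrixModel.

(** * From the large deviation events to the local law *)

Section SelfEnergy.
Context (R : realType) (r N : nat) (gamma : 'I_r -> 'I_N -> R) (M q : R).
Hypothesis r0 : (0 < r)%N.
Hypothesis N0 : (0 < N)%N.
Hypothesis gamma1 : forall k i, 1 <= gamma k i.
Hypothesis gammaM : N%:R^-1 * (\sum_k \sum_i gamma k i ^+ 2) <= M.
Hypothesis q1 : 1 <= q.
Hypothesis qN : q ^+ 2 <= N%:R.
Hypothesis qs1 : forall i j, q * profile gamma i j <= 1.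

Local Notation th := (theta gamma).
Local Notation s := (profile gamma).
Local Notation Mt := (r%:R * M).
Local Notation qh := ((Num.sqrt q)^-1).

Let th1 i : 1 <= th i. Proof. exact: theta_ge1. Qed.
Let th0 i : 0 < th i. Proof. exact: lt_le_trans (th1 i). Qed.
Let q0 : 0 < q. Proof. exact: lt_le_trans q1. Qed.
Let Mt1 : 1 <= Mt. Proof. exact: (Mt_ge1 r0 N0 gamma1 gammaM). Qed.
Let s0 i j : 0 <= s i j. Proof. exact: profile_ge0. Qed.
Let qh0 : 0 <= qh. Proof. by rewrite invr_ge0 sqrtr_ge0. Qed.
Let qh1 : qh <= 1. Proof. exact: inv_sqrt_q_le1. Qed.
Let qh2 : qh ^+ 2 = q^-1. Proof. by rewrite exprVn sqr_sqrtr // ltW. Qed.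
Let qVh : q^-1 <= qh. Proof. exact: inv_q_le. Qed.
Let thV0 i : 0 <= (th i)^-1. Proof. by rewrite invr_ge0 ltW. Qed.
Let qV0 : 0 <= q^-1. Proof. by rewrite invr_ge0 ltW. Qed.

Context (H : 'M[R]_N) (z : R[i]) (t : R).
Hypothesis Hs : sym_mx H.
Hypothesis Hq : forall i j, `|H i j| <= qh.
Hypothesis z0 : 0 < Im z.
Hypothesis t1 : 1 <= t.
Hypothesis Hgood : good_event s q H z t.

Local Notation G := (green H z).
Local Notation Gi i := (green (minor_mx i H) z).

Lemma green_diag_neq0 i : G i i != 0.
Proof.
have := schur_diag i Hs z0; apply: contra_eq_neq => ->.
by rewrite mul0r eq_sym oner_neq0.
Qed.

Lemma normc_green_gt0 i : 0 < n[G i i].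
Proof. by rewrite normc_gt0 green_diag_neq0. Qed.

Lemma minor_diff i c j : j != i -> Gi i c j = G c j - G c i * G i j / G i i.
Proof.
move=> ji; have g0 := green_diag_neq0 i.
apply: (mulfI g0); rewrite (schur_minor c Hs z0 ji).
by field.
Qed.

Lemma minor_sym i a b : Gi i a b = Gi i b a.
Proof. by apply: green_sym; exact: minor_mx_sym. Qed.

Definition self_energy_err (i : 'I_N) : R[i] :=
  - (G i i)^-1 - z - gdot gamma (avg_green gamma (fun a => G a a)) i.

(** Beyond the fluctuations of the linear and quadratic forms, the error contains
    the discrepancy between [s_ij (1 - q s_ij)] and [s_ij], the effect of removing a
    row, and the missing diagonal term. *)
Lemma self_energy_errE i : self_energy_err i =
  - (H i i)%:C
  + \sum_(a | a != i) (H i a ^+ 2 - s i a * (1 - q * s i a))%:C * Gi i a a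
  + \sum_(a | a != i) \sum_(b | (b != i) && (b != a)) (H i a)%:C * (H i b)%:C * Gi i a b
  - \sum_(a | a != i) (q * s i a ^+ 2)%:C * Gi i a a
  + \sum_(a | a != i) (s i a)%:C * (Gi i a a - G a a)
  - (s i i)%:C * G i i.
Proof.
have GV : (G i i)^-1 = (H i i)%:C - z - \sum_(x | x != i) \sum_(a | a != i)
      (H i x)%:C * (H i a)%:C * Gi i a x.
  have g0 := green_diag_neq0 i.
  by apply: (mulfI g0); rewrite mulfV // schur_diag.
have SV : \sum_a (s i a)%:C * G a a
  = (s i i)%:C * G i i + \sum_(a | a != i) (s i a)%:C * G a a by rewrite (bigD1 i).
rewrite /self_energy_err GV gdot_avg_green SV.
have -> : \sum_(x | x != i) \sum_(a | a != i) (H i x)%:C * (H i a)%:C * Gi i a x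
  = \sum_(a | a != i) (H i a ^+ 2)%:C * Gi i a a
    + \sum_(a | a != i) \sum_(b | (b != i) && (b != a)) (H i a)%:C * (H i b)%:C * Gi i a b.
  rewrite -big_split /=; apply: eq_bigr => a ai; rewrite (bigD1 a) //=.
  rewrite rmorphXn /= expr2; congr (_ + _).
  by apply: eq_bigr => b _; rewrite minor_sym.
have -> : \sum_(a | a != i) (H i a ^+ 2)%:C * Gi i a a
  = \sum_(a | a != i) (H i a ^+ 2 - s i a * (1 - q * s i a))%:C * Gi i a a
   - \sum_(a | a != i) (q * s i a ^+ 2)%:C * Gi i a a
   + (\sum_(a | a != i) (s i a)%:C * (Gi i a a - G a a)
   + \sum_(a | a != i) (s i a)%:C * G a a).
  rewrite -sumrB -!big_split /=; apply: eq_bigr => a _.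
  have -> : (H i a ^+ 2 - s i a * (1 - q * s i a))%:C
    = (H i a ^+ 2)%:C - (s i a)%:C + (q * s i a ^+ 2)%:C.
    by rewrite -rmorphB -rmorphD /=; congr (_%:C); ring.
  ring.
ring.
Qed.

Lemma normc_sum_real (P : pred 'I_N) (c : 'I_N -> R) (f : 'I_N -> R[i]) (B : R) :
  (forall a, 0 <= c a) -> (forall a, P a -> n[f a] <= B) -> 0 <= B ->
  n[\sum_(a | P a) (c a)%:C * f a] <= B * \sum_a c a.
Proof.
move=> c0 hf B0; rewrite (le_trans (normc_sum _ _ _)) //.
apply: (@le_trans _ _ (\sum_(a | P a) B * c a)).
  by apply: ler_sum => a Pa; rewrite normcCM // mulrC ler_wpM2r ?hf.
rewrite -mulr_sumr ler_wpM2l // big_mkcond; apply: ler_sum => a _.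
by case: ifP.
Qed.

(** The self-consistent equation for one diagonal entry.  The two uses differ
    only in how the row sums of the minor are controlled: through [Psi] in the
    bulk, and through the trivial bound [s <= 1/q] at height of order one. *)
Lemma self_energy_err_le (C Psi rho : R) i :
  1 <= C -> 0 <= Psi <= 1 -> 0 <= rho ->
  (forall a b, a != i -> b != i -> n[Gi i a b] <= C) ->
  n[G i i] <= C ->
  (forall a, a != i -> \sum_(b | b != i) s i b * n[Gi i a b] ^+ 2
      <= C * (th i / th a) * Psi ^+ 2 + C / q) ->
  \sum_(a | a != i) s i a * (n[G a i] ^+ 2 / n[G i i]) <= C * th i * rho ->
  n[self_energy_err i]
    <= (46 + r%:R) * C * Mt * (th i * (t ^+ 2 * (qh + Psi) + rho)).
Proof.
move=> C1 /andP[P0 P1] rho0 hG hGi hrow hdiff.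
have C0 : 0 <= C by exact: le_trans ler01 C1.
have t0 : 0 <= t by exact: le_trans ler01 t1.
have t2 : 1 <= t ^+ 2 by rewrite expr_ge1.
have tt2 : t <= t ^+ 2 by rewrite expr2 ler_peMr.
have [_ hD hQ] := Hgood i.
have thi0 := ltW (th0 i); have thi1 := th1 i.
have Mt0 : 0 <= Mt by exact: le_trans ler01 Mt1.
set X := th i * (t ^+ 2 * (qh + Psi)).
have X1 : th i * qh <= X.
  rewrite /X ler_wpM2l // (@le_trans _ _ (qh + Psi)) ?lerDl //.
  by rewrite ler_peMl // addr_ge0.
have CM1 : 1 <= C * Mt by rewrite mulr_ege1.
have CM0 : 0 <= C * Mt by exact: le_trans ler01 CM1.
have X0 : 0 <= X by rewrite !mulr_ge0 ?addr_ge0 // sqr_ge0.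
have MtX : Mt * th i * (t * qh) <= Mt * X.
  rewrite -mulrA ler_wpM2l // /X ler_wpM2l // ler_pM ?lerDl //.
have MT1 : 1 <= Mt * th i by exact: mulr_ege1.
have thMt : Mt * th i <= (Mt * th i) ^+ 2.
  by rewrite expr2 ler_peMr // (le_trans ler01 MT1).
have B1 : n[- (H i i)%:C] <= X.
  rewrite normcN normcC (le_trans (Hq i i)) // (le_trans _ X1) //.
  by rewrite ler_peMl.
have B2 : n[\sum_(a | a != i) (H i a ^+ 2 - s i a * (1 - q * s i a))%:C * Gi i a a]
    <= 4 * (C * Mt * X).
  have S0 : 0 <= Mt * th i by rewrite mulr_ge0.
  apply: (le_trans (hD C (Mt * th i) C0 S0 (fun a ai => hG a a ai ai) _)).
    apply: le_trans thMt; apply: le_trans (sum_profile_le r0 gamma1 gammaM i).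
    by rewrite big_mkcond; apply: ler_sum => a _; case: ifP.
  have : C / q <= C * (Mt * th i) * qh.
    rewrite -mulrA ler_wpM2l // (le_trans qVh) // ler_peMl // mulr_ege1 //.
  have := ler_wpM2l C0 MtX.
  have -> : C * (Mt * th i * (t * qh)) = t * (C * (Mt * th i) * qh) by ring.
  rewrite [C * (Mt * X)]mulrA => h1 h2.
  have := ler_wpM2l t0 h2.
  rewrite -[C * (Mt * th i) / _]/(C * (Mt * th i) * qh); lra.
have B3 : n[\sum_(a | a != i) \sum_(b | (b != i) && (b != a))
      (H i a)%:C * (H i b)%:C * Gi i a b] <= 40 * (C * Mt * X).
  pose W a := Num.sqrt (C * (th i / th a) * Psi ^+ 2 + C / q).
  have Wr0 a : 0 <= C * (th i / th a) * Psi ^+ 2 + C / q.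
    rewrite addr_ge0 // mulr_ge0 ?sqr_ge0 // mulr_ge0 // divr_ge0 // ltW //.
  have W2 a : W a ^+ 2 = C * (th i / th a) * Psi ^+ 2 + C / q by rewrite sqr_sqrtr.
  have W0 a : 0 <= W a by exact: sqrtr_ge0.
  have Wle a : W a <= 2 * C * th i.
    have h : 1 <= 2 * C * th i by rewrite mulr_ege1 // mulr_ege1 // ler1n.
    rewrite -(ler_pXn2r (ltn0Sn 1)) ?nnegrE //; last by rewrite !mulr_ge0.
    rewrite W2 (@le_trans _ _ (2 * C * th i)) //; last by rewrite expr2 ler_peMr // !mulr_ge0.
    have -> : 2 * C * th i = C * th i + C * th i by ring.
    apply: lerD.
      rewrite -[X in _ <= X]mulr1; apply: ler_pM.
      - by rewrite mulr_ge0 // divr_ge0 // ltW.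
      - exact: sqr_ge0.
      - by rewrite ler_wpM2l // ler_pdivrMr // ler_peMr.
      - by rewrite expr_le1.
    rewrite ler_wpM2l // (le_trans qVh) // (le_trans qh1) //.
  have hW1 a : a != i -> C / Num.sqrt q + W a <= 3 * C * th i.
    move=> _; have : C / Num.sqrt q <= C * th i by rewrite ler_wpM2l // (le_trans qh1).
    have := Wle a; lra.
  have hS : \sum_(a | a != i) s i a * (C / Num.sqrt q + W a) ^+ 2
      <= (2 * C * Mt * (th i * (qh + Psi))) ^+ 2.
    apply: (@le_trans _ _ (\sum_a ((4 * C ^+ 2 / q) * s i a
       + (2 * C * th i * Psi ^+ 2) * (s i a / th a)))).
      rewrite big_mkcond; apply: ler_sum => a _.
      case: ifP => _; last first.
        apply: addr_ge0; apply: mulr_ge0 => //.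
        - by rewrite !mulr_ge0 ?sqr_ge0.
        - by rewrite !mulr_ge0 ?sqr_ge0.
        - exact: mulr_ge0 (s0 _ _) (thV0 _).
      have e1 : (C / Num.sqrt q + W a) ^+ 2 <= 2 * (C / Num.sqrt q) ^+ 2 + 2 * W a ^+ 2.
        have := sqr_ge0 (C / Num.sqrt q - W a); rewrite sqrrB sqrrD; lra.
      have e2 : 2 * (C / Num.sqrt q) ^+ 2 + 2 * W a ^+ 2
         <= 4 * C ^+ 2 / q + 2 * C * th i * Psi ^+ 2 / th a.
        rewrite W2 exprMn qh2.
        have : C / q <= C ^+ 2 / q by rewrite ler_wpM2r // expr2 ler_peMr.
        have -> : 2 * C * th i * Psi ^+ 2 / th a = 2 * (C * (th i / th a) * Psi ^+ 2).
          by ring.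
        lra.
      apply: le_trans (ler_wpM2l (s0 i a) (le_trans e1 e2)) _.
      by rewrite le_eqVlt; apply/orP; left; apply/eqP; ring.
    rewrite big_split /= -mulr_sumr -[X in _ + X <= _]mulr_sumr.
    apply: (@le_trans _ _ (4 * C ^+ 2 / q * (Mt * th i) + 2 * C * th i * Psi ^+ 2 * th i)).
      apply: lerD; apply: ler_wpM2l.
      - by rewrite !mulr_ge0 ?sqr_ge0.
      - exact: (sum_profile_le r0 gamma1 gammaM).
      - by rewrite !mulr_ge0 ?sqr_ge0.
      - exact: (sum_profile_div_le r0 N0 gamma1).
    apply: (@le_trans _ _ (4 * C ^+ 2 * (Mt * th i) ^+ 2 * (q^-1 + Psi ^+ 2))).
      rewrite mulrDr; apply: lerD.
        have -> : 4 * C ^+ 2 * (Mt * th i) ^+ 2 / q = (4 * C ^+ 2 / q) * (Mt * th i) ^+ 2 by ring.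
        by rewrite ler_wpM2l // !mulr_ge0 ?sqr_ge0.
      have -> : 2 * C * th i * Psi ^+ 2 * th i = (2 * C * th i ^+ 2) * Psi ^+ 2 by ring.
      rewrite ler_wpM2r ?sqr_ge0 // exprMn.
      have -> : 4 * C ^+ 2 * (Mt ^+ 2 * th i ^+ 2) = (2 * C * (2 * C * Mt ^+ 2)) * th i ^+ 2 by ring.
      rewrite ler_wpM2r ?sqr_ge0 // ler_peMr ?mulr_ge0 //.
      by rewrite mulr_ege1 ?expr_ge1 // mulr_ege1 // ler1n.
    have -> : (2 * C * Mt * (th i * (qh + Psi))) ^+ 2
      = 4 * C ^+ 2 * (Mt * th i) ^+ 2 * (qh + Psi) ^+ 2 by ring.
    apply: ler_wpM2l; first by rewrite mulr_ge0 ?sqr_ge0 // mulr_ge0 ?sqr_ge0.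
    rewrite sqrrD qh2.
    have : 0 <= qh * Psi by rewrite mulr_ge0.
    lra.
  have S0 : 0 <= 2 * C * Mt * (th i * (qh + Psi)).
    by rewrite mulr_ge0 ?(mulr_ge0 thi0) ?addr_ge0 // mulr_ge0 // mulr_ge0.
  have W10 : 0 <= 3 * C * th i by rewrite !mulr_ge0.
  have hrow' a : a != i -> \sum_(b | b != i) s i b * n[Gi i a b] ^+ 2 <= W a ^+ 2.
    by move=> ai; rewrite W2 hrow.
  apply: (le_trans (hQ C _ _ W C0 W0 W10 S0 hG hrow' hW1 hS)).
  have : 3 * C * th i / Num.sqrt q <= 3 * (C * Mt * (th i * (qh + Psi))).
    have -> : 3 * C * th i / Num.sqrt q = 3 * (C * 1 * (th i * qh)) by ring.
    rewrite ler_wpM2l // ler_pM ?mulr_ge0 //.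
      by rewrite ler_wpM2l.
    by rewrite ler_wpM2l // lerDl.
  have t20 : 0 <= t ^+ 2 by exact: sqr_ge0.
  move=> h; have := ler_wpM2l t20 h; rewrite /X.
  have -> : C * Mt * (th i * (t ^+ 2 * (qh + Psi)))
    = t ^+ 2 * (C * Mt * (th i * (qh + Psi))) by ring.
  lra.
have B4 : n[\sum_(a | a != i) (q * s i a ^+ 2)%:C * Gi i a a] <= r%:R * (C * Mt * X).
  apply: (le_trans (normc_sum_real _ (fun a ai => hG a a ai ai) C0)).
    by move=> a; rewrite mulr_ge0 ?sqr_ge0 ?(ltW q0).
  apply: (le_trans (ler_wpM2l C0 (q_sum_profile2_le r0 N0 gamma1 gammaM q1 qN qs1 i))).
  have -> : C * (r%:R * Mt * (th i * qh)) = (r%:R * (C * Mt)) * (th i * qh) by ring.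
  by rewrite [X in _ <= X]mulrA ler_wpM2l // mulr_ge0.
have B5 : n[\sum_(a | a != i) (s i a)%:C * (Gi i a a - G a a)] <= C * th i * rho.
  apply: le_trans hdiff; rewrite (le_trans (normc_sum _ _ _)) //.
  apply: ler_sum => a ai; rewrite normcCM // ler_wpM2l //.
  rewrite minor_diff // addrAC subrr add0r normcN Normc.normcM Normc.normcV.
  by rewrite Normc.normcM [G i a]green_sym // expr2.
have B6 : n[- ((s i i)%:C * G i i)] <= C * X.
  rewrite normcN normcCM // mulrC ler_pM ?normc_ge0 //.
  apply: le_trans X1; rewrite (le_trans (profile_le_q q1 qs1 i i)) // (le_trans qVh) //.
  by rewrite ler_peMl.
rewrite self_energy_errE.
have XCM : X <= C * Mt * X by rewrite ler_peMl.
have CX : C * X <= C * Mt * X by rewrite ler_wpM2r // ler_peMr.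
have rhoCM : C * th i * rho <= C * Mt * (th i * rho).
  rewrite -mulrA ler_wpM2r ?mulr_ge0 // ler_peMr //.
have T0 : 0 <= C * Mt * (th i * rho) by rewrite mulr_ge0 // mulr_ge0.
rewrite mulrDr -/X mulrDr.
have -> : (46 + r%:R) * C * Mt * X = 46 * (C * Mt * X) + r%:R * (C * Mt * X) by ring.
have -> : (46 + r%:R) * C * Mt * (th i * rho)
  = C * Mt * (th i * rho) + (45 + r%:R) * (C * Mt * (th i * rho)) by ring.
have T1 : 0 <= (45 + r%:R) * (C * Mt * (th i * rho)) by rewrite mulr_ge0 // addr_ge0.
rewrite (le_trans (normcD _ _)) //.
apply: le_trans (lerD (le_trans (normcD _ _) (lerD (le_trans (normcBD _ _) (lerD
  (le_trans (normcD _ _) (lerD (le_trans (normcD _ _) (lerD B1 B2)) B3)) B4)) B5)) B6) _.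
lra.
Qed.

(** * Self-improving bounds in the bulk *)

Definition sqth i := Num.sqrt (th i).

Lemma sqth_sqr i : sqth i ^+ 2 = th i.
Proof. by rewrite sqr_sqrtr // ltW. Qed.

Lemma sqth_ge1 i : 1 <= sqth i.
Proof. by rewrite -(@sqrtr1 R) ler_wsqrtr. Qed.

Lemma sqth_gt0 i : 0 < sqth i.
Proof. exact: lt_le_trans (sqth_ge1 i). Qed.

Lemma sqrt_theta_mul i j : Num.sqrt (th i * th j) = sqth i * sqth j.
Proof. by rewrite sqrtrM // ltW. Qed.

Local Notation Phiz := (Phi N q (Im z)).

Lemma inv_sqrt_N_ge0 : 0 <= (Num.sqrt (N%:R * Im z))^-1.
Proof. by rewrite invr_ge0 sqrtr_ge0. Qed.

Section Bulk.
Variables (C lam : R).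
Hypothesis C1 : 1 <= C.
Hypothesis lam01 : 0 <= lam <= 1.
Hypothesis hdiag : forall i, C^-1 <= th i * n[G i i] <= C.
Hypothesis hoff : forall a b, a != b -> sqth a * sqth b * n[G a b] <= lam.

Let C0 : 0 < C. Proof. exact: lt_le_trans C1. Qed.
Let lam0 : 0 <= lam. Proof. by case/andP: lam01. Qed.

Lemma minor_correction_le i a b : a != i -> b != i ->
  sqth a * sqth b * n[G a i * G i b / G i i] <= C * lam ^+ 2.
Proof.
move=> ai bi; rewrite Normc.normcM Normc.normcM Normc.normcV.
have gi := normc_green_gt0 i.
have -> : sqth a * sqth b * (n[G a i] * n[G i b] / n[G i i])
  = ((sqth a * sqth i * n[G a i]) * (sqth i * sqth b * n[G i b]))
    * (th i * n[G i i])^-1.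
  by rewrite -sqth_sqr; field; rewrite !gt_eqF // sqth_gt0.
have nn x y : 0 <= sqth x * sqth y * n[G x y].
  by rewrite !mulr_ge0 ?normc_ge0 // ltW // sqth_gt0.
rewrite mulrC; apply: ler_pM.
- by rewrite invr_ge0 mulr_ge0 ?normc_ge0 // ltW.
- exact: mulr_ge0.
- have /andP[h _] := hdiag i.
  by rewrite -[C]invrK lef_pV2 ?posrE ?invr_gt0 // mulr_gt0.
- by rewrite expr2 ler_pM ?hoff // eq_sym.
Qed.

Lemma minor_off_le i a b : a != i -> b != i -> a != b ->
  sqth a * sqth b * n[Gi i a b] <= 2 * C * lam.
Proof.
move=> ai bi ab; rewrite minor_diff //.
have w0 : 0 <= sqth a * sqth b by rewrite mulr_ge0 // ltW // sqth_gt0.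
rewrite (le_trans (ler_wpM2l w0 (normcBD _ _))) // mulrDr.
apply: (le_trans (lerD (hoff ab) (minor_correction_le ai bi))).
have /andP[_ l1] := lam01.
have : C * lam ^+ 2 <= C * lam by rewrite ler_pM2l // expr2 ler_piMr.
have : lam <= C * lam by rewrite ler_peMl.
lra.
Qed.

Lemma minor_diag_le i a : a != i -> th a * n[Gi i a a] <= 2 * C.
Proof.
move=> ai; rewrite minor_diff // (le_trans (ler_wpM2l (ltW (th0 a)) (normcBD _ _))) //.
rewrite mulrDr mulr_natl mulr2n; apply: lerD; first by case/andP: (hdiag a).
rewrite -[th a]sqth_sqr expr2 (le_trans (minor_correction_le ai ai)) //.
by rewrite ler_piMr ?(ltW C0) // expr_le1 //; case/andP: lam01.
Qed.

Lemma minor_le i a b : a != i -> b != i -> sqth a * sqth b * n[Gi i a b] <= 2 * C.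
Proof.
move=> ai bi; have [->|ab] := eqVneq a b.
  by rewrite -expr2 sqth_sqr minor_diag_le.
rewrite (le_trans (minor_off_le ai bi ab)) // ler_piMr ?mulr_ge0 ?(ltW C0) //.
by case/andP: lam01.
Qed.

Hypothesis eta10 : Im z <= 10.

Definition bulk_psi : R := lam / t ^+ 2 + t / Num.sqrt (N%:R * Im z).

Lemma bulk_psi_ge0 : 0 <= bulk_psi.
Proof.
have t0 : 0 <= t by exact: le_trans ler01 t1.
by rewrite addr_ge0 // mulr_ge0 ?inv_sqrt_N_ge0 // invr_ge0 sqr_ge0.
Qed.

(** The Ward identity has no weights [theta_b].  Where [theta_b <= t^2] they are
    put in by hand, at the price of [t^2]; larger [theta_b] are so rare, their
    second moment being bounded, that the a priori bound [lam] on the entries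
    gains a factor [t^-4]. *)
Lemma minor_weighted_row_le i a : a != i ->
  \sum_(b | b != i) th a * th b * n[Gi i a b] ^+ 2
    <= N%:R * (42 * C ^+ 2 * Mt * bulk_psi ^+ 2).
Proof.
move=> ai.
have t0 : 0 <= t by exact: le_trans ler01 t1.
have t20 : 0 < t ^+ 2 by rewrite exprn_gt0 // (lt_le_trans ltr01).
have NR0 : 0 < (N%:R : R) by rewrite ltr0n.
pose T b := (if b == a then 4 * C ^+ 2 else 0)
  + (4 * C ^+ 2 * lam ^+ 2 / t ^+ 4) * th b ^+ 2 + t ^+ 2 * th a * n[Gi i a b] ^+ 2.
have k0 : 0 <= 4 * C ^+ 2 * lam ^+ 2 / t ^+ 4.
  by rewrite divr_ge0 ?exprn_ge0 // mulr_ge0 ?sqr_ge0 // mulr_ge0 ?sqr_ge0.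
have x1 b : 0 <= (4 * C ^+ 2 * lam ^+ 2 / t ^+ 4) * th b ^+ 2.
  by rewrite mulr_ge0 ?sqr_ge0.
have x2 b : 0 <= t ^+ 2 * th a * n[Gi i a b] ^+ 2.
  by rewrite mulr_ge0 ?sqr_ge0 // mulr_ge0 ?sqr_ge0 ?(ltW (th0 a)).
have xE b : th a * th b * n[Gi i a b] ^+ 2 = (sqth a * sqth b * n[Gi i a b]) ^+ 2.
  by rewrite -!sqth_sqr; ring.
have nn b : 0 <= sqth a * sqth b * n[Gi i a b].
  by rewrite !mulr_ge0 ?normc_ge0 // ltW // sqth_gt0.
have step b : b != i -> th a * th b * n[Gi i a b] ^+ 2 <= T b.
  move=> bi; rewrite /T; case: eqP => [->|/eqP ba].
    rewrite -addrA (@le_trans _ _ (4 * C ^+ 2)) //; last by rewrite lerDl addr_ge0.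
    rewrite xE (_ : 4 * C ^+ 2 = (2 * C) ^+ 2); last by ring.
    by rewrite ler_pXn2r ?nnegrE ?minor_le // mulr_ge0 // ltW.
  rewrite add0r; have [big|small] := ltP (t ^+ 2) (th b).
    rewrite (@le_trans _ _ ((4 * C ^+ 2 * lam ^+ 2 / t ^+ 4) * th b ^+ 2)) //; last first.
      by rewrite lerDl.
    rewrite xE (@le_trans _ _ ((2 * C * lam) ^+ 2)) //.
      rewrite ler_pXn2r ?nnegrE //; last by rewrite !mulr_ge0 // ltW.
      by apply: minor_off_le => //; rewrite eq_sym.
    have -> : 4 * C ^+ 2 * lam ^+ 2 / t ^+ 4 * th b ^+ 2
      = (2 * C * lam) ^+ 2 * (th b / t ^+ 2) ^+ 2.
      by field; rewrite gt_eqF // (lt_le_trans ltr01).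
    rewrite ler_peMr ?sqr_ge0 // expr_ge1 //; last by rewrite divr_ge0 // ltW.
    by rewrite ler_pdivlMr // mul1r ltW.
  rewrite (@le_trans _ _ (t ^+ 2 * th a * n[Gi i a b] ^+ 2)) // ?lerDr //.
  apply: ler_wpM2r; first exact: sqr_ge0.
  by rewrite [t ^+ 2 * _]mulrC; apply: ler_wpM2l => //; exact: ltW.
apply: (@le_trans _ _ (\sum_b T b)).
  rewrite big_mkcond; apply: ler_sum => b _; case: ifP => [/step //|_].
  by rewrite /T -addrA addr_ge0 ?addr_ge0 //; case: ifP => // _; rewrite mulr_ge0 ?sqr_ge0.
rewrite /T !big_split /= -big_mkcond big_pred1_eq -!mulr_sumr.
have WI := ward a (minor_mx_sym i Hs) z0.
have e1 : \sum_b n[Gi i a b] ^+ 2 <= 2 * C / th a / Im z.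
  rewrite WI ler_wpM2r ?invr_ge0 ?(ltW z0) // ler_pdivlMr //.
  apply: le_trans (minor_diag_le ai); rewrite mulrC ler_wpM2l ?(ltW (th0 a)) //.
  exact: le_trans (ler_norm _) (Im_le_normc _).
have e2 : t ^+ 2 * th a * (\sum_b n[Gi i a b] ^+ 2) <= 2 * C * (t ^+ 2 / Im z).
  apply: (le_trans (ler_wpM2l _ e1)); first by rewrite mulr_ge0 ?(ltW t20) ?(ltW (th0 a)).
  rewrite le_eqVlt; apply/orP; left; apply/eqP; field.
  by rewrite !gt_eqF.
have e3 : 4 * C ^+ 2 * lam ^+ 2 / t ^+ 4 * (\sum_b th b ^+ 2)
    <= 4 * C ^+ 2 * Mt * (N%:R * (lam ^+ 2 / t ^+ 4)).
  have : \sum_b th b ^+ 2 <= N%:R * Mt.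
    by rewrite -ler_pdivrMl // (avg_theta2_le gammaM).
  move/(ler_wpM2l (x := 4 * C ^+ 2 * lam ^+ 2 / t ^+ 4)) => h; apply: le_trans (h k0) _.
  by rewrite le_eqVlt; apply/orP; left; apply/eqP; ring.
have e4 : N%:R * (lam ^+ 2 / t ^+ 4) + t ^+ 2 / Im z <= N%:R * bulk_psi ^+ 2.
  rewrite /bulk_psi sqrrD !exprMn !exprVn sqr_sqrtr; last by rewrite mulr_ge0 // ltW.
  have : 0 <= lam / t ^+ 2 * (t / Num.sqrt (N%:R * Im z)).
    by rewrite !mulr_ge0 ?inv_sqrt_N_ge0 ?invr_ge0 // ltW.
  move=> h; have := ler_wpM2l (ltW NR0) h.
  have -> : N%:R * (lam ^+ 2 / (t ^+ 2) ^+ 2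
    + lam / t ^+ 2 * (t / Num.sqrt (N%:R * Im z)) *+ 2 + t ^+ 2 / (N%:R * Im z))
    = N%:R * (lam ^+ 2 / t ^+ 4) + t ^+ 2 / Im z
      + 2 * (N%:R * (lam / t ^+ 2 * (t / Num.sqrt (N%:R * Im z)))).
    have : 0 < Num.sqrt (N%:R * Im z) by rewrite sqrtr_gt0 mulr_gt0.
    have : 0 < t by exact: lt_le_trans ltr01 t1.
    move=> tp; set S := Num.sqrt _ => Sp; rewrite -exprM -mulr_natl; field.
    by rewrite (gt_eqF Sp) (gt_eqF tp) (gt_eqF z0) (gt_eqF NR0).
  rewrite mulr0; lra.
have e5 : 1 <= 10 * (t ^+ 2 / Im z).
  rewrite mulrA ler_pdivlMr // mul1r (le_trans eta10) // ler_peMr // expr_ge1 //.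
have y1 : 0 <= t ^+ 2 / Im z by rewrite divr_ge0 // ltW.
have y2 : 0 <= N%:R * (lam ^+ 2 / t ^+ 4).
  by rewrite mulr_ge0 // divr_ge0 ?sqr_ge0 // exprn_ge0.
have CC : C <= C ^+ 2 by rewrite expr2 ler_peMr // ltW.
have C2 : 0 <= C ^+ 2 by rewrite sqr_ge0.
have C2M : C ^+ 2 <= C ^+ 2 * Mt by rewrite ler_peMr.
have C2M0 : 0 <= C ^+ 2 * Mt by exact: le_trans C2M.
apply: (le_trans (lerD (lerD (lexx _) e3) e2)).
set A := N%:R * (lam ^+ 2 / t ^+ 4) in e4 y2 *.
set B := t ^+ 2 / Im z in e4 e5 y1 *.
apply: (@le_trans _ _ (42 * (C ^+ 2 * Mt) * (A + B))); last first.
  have -> : N%:R * (42 * C ^+ 2 * Mt * bulk_psi ^+ 2)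
    = 42 * (C ^+ 2 * Mt) * (N%:R * bulk_psi ^+ 2) by ring.
  by rewrite ler_wpM2l // mulr_ge0.
have f1 : C ^+ 2 <= 10 * (C ^+ 2 * Mt * B).
  have := ler_pM C2 ler01 C2M e5; rewrite mulr1; lra.
have f2 : C * B <= C ^+ 2 * Mt * B by rewrite ler_wpM2r // (le_trans CC).
have f3 : 0 <= C ^+ 2 * Mt * A by rewrite mulr_ge0.
have -> : 4 * C ^+ 2 * Mt * A = 4 * (C ^+ 2 * Mt * A) by ring.
have -> : 2 * C * B = 2 * (C * B) by ring.
lra.
Qed.

Lemma minor_row_le i a : a != i ->
  \sum_(b | b != i) s i b * n[Gi i a b] ^+ 2
    <= 42 * C ^+ 2 * Mt * (th i / th a) * bulk_psi ^+ 2.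
Proof.
move=> ai; have NR0 : 0 < (N%:R : R) by rewrite ltr0n.
apply: (@le_trans _ _ (\sum_(b | b != i) (th i / th a / N%:R) * (th a * th b * n[Gi i a b] ^+ 2))).
  apply: ler_sum => b _.
  have -> : th i / th a / N%:R * (th a * th b * n[Gi i a b] ^+ 2)
    = N%:R^-1 * (th i * th b) * n[Gi i a b] ^+ 2 by field; rewrite !gt_eqF.
  by rewrite ler_wpM2r ?sqr_ge0 // profile_le_theta.
rewrite -mulr_sumr (le_trans (ler_wpM2l _ (minor_weighted_row_le ai))) //.
  by rewrite !mulr_ge0 ?invr_ge0 // ?(ltW (th0 _)).
rewrite le_eqVlt; apply/orP; left; apply/eqP; field.
by rewrite (gt_eqF (th0 a)) (gt_eqF NR0).
Qed.

Lemma offdiag_bulk i j : i != j ->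
  sqth i * sqth j * n[G i j] <= 14 * C ^+ 2 * Mt * (t * (qh + bulk_psi)).
Proof.
move=> ij; have ji : j != i by rewrite eq_sym.
have t0 : 0 <= t by exact: le_trans ler01 t1.
have [hL _ _] := Hgood i.
have ri0 : 0 < sqth i / sqth j by rewrite divr_gt0 ?sqth_gt0.
have B0 : 0 <= 2 * C * (sqth i / sqth j).
  by apply: mulr_ge0 (ltW ri0); apply: mulr_ge0 => //; exact: ltW.
have S0 : 0 <= 7 * C * Mt * (sqth i / sqth j * bulk_psi).
  apply: mulr_ge0; last exact: mulr_ge0 (ltW ri0) bulk_psi_ge0.
  by apply: mulr_ge0 (le_trans ler01 Mt1); apply: mulr_ge0 => //; exact: ltW.
have hB a : a != i -> n[Gi i a j] <= 2 * C * (sqth i / sqth j).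
  move=> ai; rewrite mulrA ler_pdivlMr ?sqth_gt0 //.
  apply: (@le_trans _ _ (2 * C)); last by rewrite ler_peMr ?sqth_ge1 // mulr_ge0 // ltW.
  apply: le_trans (minor_le ai ji); rewrite mulrC -mulrA ler_peMl ?sqth_ge1 //.
  by rewrite mulr_ge0 ?normc_ge0 // ltW // sqth_gt0.
have hS : \sum_(a | a != i) s i a * n[Gi i a j] ^+ 2
    <= (7 * C * Mt * (sqth i / sqth j * bulk_psi)) ^+ 2.
  rewrite (eq_bigr (fun b => s i b * n[Gi i j b] ^+ 2)) => [|b _]; last by rewrite minor_sym.
  apply: (le_trans (minor_row_le ji)).
  have -> : (7 * C * Mt * (sqth i / sqth j * bulk_psi)) ^+ 2
    = 49 * C ^+ 2 * Mt ^+ 2 * (th i / th j) * bulk_psi ^+ 2.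
    by rewrite -!sqth_sqr; field; rewrite gt_eqF // sqth_gt0.
  rewrite ler_wpM2r ?sqr_ge0 // ler_wpM2r ?divr_ge0 ?(ltW (th0 _)) //.
  have : C ^+ 2 * Mt <= C ^+ 2 * Mt ^+ 2.
    by rewrite ler_wpM2l ?sqr_ge0 // expr2 ler_peMr // (le_trans ler01).
  have : 0 <= C ^+ 2 * Mt by rewrite mulr_ge0 ?sqr_ge0 // (le_trans ler01).
  lra.
have := hL j _ _ B0 S0 hB hS => hX.
rewrite schur_offdiag // normcN Normc.normcM.
set X := n[\sum_(a | _) _] in hX *.
have X0 : 0 <= X by exact: normc_ge0.
have hg : n[G i i] <= C / th i by rewrite ler_pdivlMr // mulrC; case/andP: (hdiag i).
have w0 : 0 <= sqth i * sqth j by rewrite mulr_ge0 // ltW // sqth_gt0.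
apply: (@le_trans _ _ (sqth i * sqth j * (C / th i * (2 * t *
   (2 * C * (sqth i / sqth j) / Num.sqrt q + 7 * C * Mt * (sqth i / sqth j * bulk_psi)))))).
  by rewrite ler_wpM2l // ler_pM ?normc_ge0.
have -> : sqth i * sqth j * (C / th i * (2 * t *
   (2 * C * (sqth i / sqth j) / Num.sqrt q + 7 * C * Mt * (sqth i / sqth j * bulk_psi))))
  = C ^+ 2 * (t * (4 * qh + 14 * Mt * bulk_psi)).
  rewrite -sqth_sqr; field.
  by rewrite (gt_eqF (sqth_gt0 i)) (gt_eqF (sqth_gt0 j)) gt_eqF // sqrtr_gt0.
have -> : 14 * C ^+ 2 * Mt * (t * (qh + bulk_psi))
  = C ^+ 2 * (t * (14 * Mt * qh + 14 * Mt * bulk_psi)) by ring.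
rewrite ler_wpM2l ?sqr_ge0 // ler_wpM2l // lerD2r ler_wpM2r //.
have := Mt1; lra.
Qed.

(** With [lam] the actual value of [Lambda_o], the term [lam / t^2] hidden in
    [bulk_psi] comes with a factor of order [t] only and is absorbed on the left. *)
Lemma offdiag_self_improve : lam = Lambda_o th G -> 28 * C ^+ 2 * Mt <= t ->
  lam <= 28 * C ^+ 2 * Mt * (t ^+ 2 * Phiz).
Proof.
move=> lamE tK; set K1 := 14 * C ^+ 2 * Mt.
have t0 : 0 < t by exact: lt_le_trans ltr01 t1.
have K10 : 0 <= K1 by rewrite mulr_ge0 ?(le_trans ler01 Mt1) // mulr_ge0 // sqr_ge0.
have KE : 28 * C ^+ 2 * Mt = 2 * K1 by rewrite /K1; ring.
have P0 := bulk_psi_ge0; have sN := inv_sqrt_N_ge0.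
have h : lam <= K1 * (t * (qh + bulk_psi)).
  rewrite {1}lamE; apply: bigmax_le.
    by rewrite mulr_ge0 // mulr_ge0 ?(ltW t0) // addr_ge0.
  by move=> [i j] /= ij; rewrite sqrt_theta_mul; exact: offdiag_bulk.
have e : K1 * (t * (qh + bulk_psi)) = K1 * t * qh + (K1 / t) * lam
    + K1 * t ^+ 2 * (Num.sqrt (N%:R * Im z))^-1.
  by rewrite /bulk_psi; set S := (Num.sqrt _)^-1; set S' := (Num.sqrt _)^-1; field; rewrite gt_eqF.
have e1 : (K1 / t) * lam <= lam / 2.
  rewrite mulrC ler_wpM2l // ler_pdivrMr // mulrC ler_pdivlMr // mulrC -KE //.
have e2 : K1 * t * qh <= K1 * t ^+ 2 * qh.
  by rewrite ler_wpM2r // ler_wpM2l // expr2 ler_peMr // ltW.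
rewrite KE /Phi.
have -> : 2 * K1 * (t ^+ 2 * (qh + (Num.sqrt (N%:R * Im z))^-1))
  = 2 * (K1 * t ^+ 2 * qh) + 2 * (K1 * t ^+ 2 * (Num.sqrt (N%:R * Im z))^-1) by ring.
move: h; rewrite e.
lra.
Qed.

Lemma bulk_err_le i : lam <= 28 * C ^+ 2 * Mt * (t ^+ 2 * Phiz) ->
  28 * C ^+ 2 * Mt <= t -> 2 * (t * Phiz) <= 1 ->
  n[self_energy_err i]
    <= th i * (4 * ((46 + r%:R) * (42 * C ^+ 2 * Mt) * Mt) * (t ^+ 3 * Phiz)).
Proof.
move=> hlam tK tP.
have t0 : 0 < t by exact: lt_le_trans ltr01 t1.
have NR0 : 0 < (N%:R : R) by rewrite ltr0n.
set K1 := 28 * C ^+ 2 * Mt in hlam tK.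
have CC : 1 <= C ^+ 2 by rewrite expr_ge1 // ltW.
have CM : 1 <= C ^+ 2 * Mt by rewrite mulr_ege1.
have C2 : C <= C ^+ 2 by rewrite expr2 ler_peMr // ltW.
have C2M : C ^+ 2 <= C ^+ 2 * Mt by rewrite ler_peMr ?sqr_ge0.
set C' := 42 * C ^+ 2 * Mt.
have C'E : C' = 42 * (C ^+ 2 * Mt) by rewrite /C' -mulrA.
have C'1 : 1 <= C' by lra.
have CC' : 2 * C <= C' by lra.
have C'0 : 0 <= C' by lra.
have C'p : 0 < C' by lra.
have Phi0 : 0 <= Phiz by rewrite addr_ge0 // inv_sqrt_N_ge0.
have PsiPhi : bulk_psi <= 2 * (t * Phiz).
  have a1 : lam / t ^+ 2 <= t * Phiz.
    rewrite ler_pdivrMr ?exprn_gt0 // (le_trans hlam) //.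
    rewrite [X in _ <= X](_ : _ = t * (t ^+ 2 * Phiz)); last by ring.
    by rewrite ler_wpM2r // mulr_ge0 // sqr_ge0.
  have a2 : t / Num.sqrt (N%:R * Im z) <= t * Phiz.
    by rewrite ler_wpM2l ?(ltW t0) // lerDr.
  rewrite /bulk_psi; lra.
have Psi01 : 0 <= bulk_psi <= 1 by rewrite bulk_psi_ge0 /= (le_trans PsiPhi).
set rho := t ^+ 3 * Phiz.
have rho0 : 0 <= rho by rewrite mulr_ge0 // exprn_ge0 // ltW.
have lamrho : lam <= rho.
  apply: (le_trans hlam); have -> : rho = t * (t ^+ 2 * Phiz) by rewrite /rho; ring.
  by rewrite ler_wpM2r // mulr_ge0 // sqr_ge0.
have hG a b : a != i -> b != i -> n[Gi i a b] <= C'.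
  move=> ai bi; apply: le_trans CC'; apply: le_trans (minor_le ai bi).
  by rewrite ler_peMl ?normc_ge0 // mulr_ege1 ?sqth_ge1.
have hGi : n[G i i] <= C'.
  have /andP[_ h] := hdiag i.
  apply: (@le_trans _ _ C); last by lra.
  by apply: le_trans h; rewrite ler_peMl ?normc_ge0.
have hrow a : a != i -> \sum_(b | b != i) s i b * n[Gi i a b] ^+ 2
      <= C' * (th i / th a) * bulk_psi ^+ 2 + C' / q.
  by move=> ai; apply: (le_trans (minor_row_le ai)); rewrite lerDl mulr_ge0.
have hdiff : \sum_(a | a != i) s i a * (n[G a i] ^+ 2 / n[G i i]) <= C' * th i * rho.
  apply: (@le_trans _ _ (\sum_(a < N) N%:R^-1 * (C' * th i * rho))); last first.
    by rewrite -mulr_sumr (avg_const N0).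
  rewrite big_mkcond; apply: ler_sum => a _.
  have rhs0 : 0 <= N%:R^-1 * (C' * th i * rho).
    by rewrite mulr_ge0 ?invr_ge0 // mulr_ge0 // mulr_ge0 // ltW.
  case: ifP => // ai.
  have gi := normc_green_gt0 i.
  have x0 : 0 <= n[G a i] ^+ 2 / n[G i i] by rewrite divr_ge0 ?sqr_ge0 // ltW.
  apply: (le_trans (ler_wpM2r x0 (profile_le_theta gamma1 i a))).
  rewrite -[N%:R^-1 * _ * _]mulrA; apply: ler_wpM2l; first by rewrite invr_ge0.
  have -> : th i * th a * (n[G a i] ^+ 2 / n[G i i])
     = (sqth a * sqth i * n[G a i]) ^+ 2 * (n[G i i])^-1.
    by rewrite -!sqth_sqr; ring.
  have nn : 0 <= sqth a * sqth i * n[G a i].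
    by rewrite !mulr_ge0 ?normc_ge0 // ltW // sqth_gt0.
  have y1 : (sqth a * sqth i * n[G a i]) ^+ 2 <= rho.
    apply: le_trans lamrho; apply: (@le_trans _ _ (lam ^+ 2)).
      by rewrite ler_pXn2r ?nnegrE ?hoff.
    by rewrite expr2 ler_piMr //; case/andP: lam01.
  have y2 : (n[G i i])^-1 <= C' * th i.
    rewrite -[X in _ <= X]invrK lef_pV2 ?posrE ?invr_gt0 ?(mulr_gt0 C'p (th0 i)) //.
    rewrite invfM ler_pdivrMr // mulrC.
    have /andP[h _] := hdiag i; apply: le_trans h.
    by rewrite lef_pV2 ?posrE //; lra.
  by rewrite mulrC ler_pM ?sqr_ge0 // invr_ge0 ltW.
have := @self_energy_err_le C' bulk_psi rho i C'1 Psi01 rho0 hG hGi hrow hdiff.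
move/le_trans; apply.
set K3 := (46 + r%:R) * C' * Mt.
have K30 : 0 <= K3.
  by rewrite mulr_ge0 ?(le_trans ler01 Mt1) // mulr_ge0 // addr_ge0.
rewrite [X in _ <= X](_ : _ = K3 * (th i * (4 * rho))); last by rewrite /rho; ring.
rewrite ler_wpM2l // ler_wpM2l ?(ltW (th0 i)) //.
have t2 : 0 <= t ^+ 2 by exact: sqr_ge0.
have z1 : t ^+ 2 * qh <= rho.
  have : qh <= Phiz by rewrite lerDl inv_sqrt_N_ge0.
  move/(ler_wpM2l t2)/le_trans; apply.
  by rewrite /rho ler_wpM2r // exprS ler_peMl.
have z2 : t ^+ 2 * bulk_psi <= 2 * rho.
  apply: (le_trans (ler_wpM2l t2 PsiPhi)).
  by rewrite /rho le_eqVlt; apply/orP; left; apply/eqP; ring.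
rewrite mulrDr; lra.
Qed.

End Bulk.

(** * Spectral parameters at height of order one *)

Section Base.
Hypothesis eta1 : 1 <= Im z.

Let sg := 2 * ((46 + r%:R) * Mt) * (t ^+ 2 * qh).

Lemma green_le1 (H' : 'M[R]_N) a b : sym_mx H' -> n[green H' z a b] <= 1.
Proof. by move=> hs; rewrite (le_trans (green_le a b hs z0)) // invf_le1. Qed.

Lemma Im_diag_over (H' : 'M[R]_N) a : sym_mx H' ->
  \sum_b n[green H' z a b] ^+ 2 <= n[green H' z a a].
Proof.
move=> hs; rewrite ward // ler_pdivrMr //.
rewrite (le_trans (le_trans (ler_norm _) (Im_le_normc _))) // ler_peMr //.
exact: normc_ge0.
Qed.

Lemma sum_profile_green_le (H' : 'M[R]_N) i a (P : pred 'I_N) : sym_mx H' ->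
  \sum_(b | P b) s i b * n[green H' z a b] ^+ 2 <= q^-1 * n[green H' z a a].
Proof.
move=> hs; apply: (@le_trans _ _ (\sum_b q^-1 * n[green H' z a b] ^+ 2)).
  rewrite big_mkcond; apply: ler_sum => b _; case: ifP => _.
    by rewrite ler_wpM2r ?sqr_ge0 // profile_le_q.
  by rewrite mulr_ge0 ?sqr_ge0.
by rewrite -mulr_sumr ler_wpM2l // Im_diag_over.
Qed.

Lemma base_err_le i : n[self_energy_err i] <= th i * sg.
Proof.
have g0 := normc_green_gt0 i.
have -> : th i * sg = (46 + r%:R) * 1 * Mt * (th i * (t ^+ 2 * qh + t ^+ 2 * qh)).
  by rewrite /sg; ring.
apply: (@le_trans _ _ ((46 + r%:R) * 1 * Mt * (th i * (t ^+ 2 * (qh + 0) + qh)))).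
  apply: self_energy_err_le => //.
  - by rewrite lexx ler01.
  - by move=> a b _ _; apply: green_le1; exact: minor_mx_sym.
  - exact: green_le1.
  - move=> a ai; rewrite expr0n mulr0 add0r mul1r.
    rewrite (le_trans (sum_profile_green_le i a _ (minor_mx_sym i Hs))) //.
    by rewrite ler_piMr // green_le1 //; exact: minor_mx_sym.
  have -> : \sum_(a | a != i) s i a * (n[G a i] ^+ 2 / n[G i i])
     = (\sum_(a | a != i) s i a * n[G i a] ^+ 2) / n[G i i].
    rewrite mulr_suml; apply: eq_bigr => a _.
    by rewrite -mulrA (green_sym z a i Hs).
  rewrite ler_pdivrMr // (le_trans (sum_profile_green_le i i _ Hs)) //.
  rewrite ler_wpM2r ?(ltW g0) // mul1r (le_trans qVh) // ler_peMl //.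
have K0 : 0 <= (46 + r%:R) * 1 * Mt.
  by rewrite mulr_ge0 ?(le_trans ler01 Mt1) // mulr_ge0 // addr_ge0.
rewrite ler_wpM2l // ler_wpM2l ?(ltW (th0 i)) // addr0 lerD2l ler_peMl //.
by rewrite expr_ge1 // (le_trans ler01).
Qed.

Lemma sg_ge0 : 0 <= sg.
Proof.
rewrite mulr_ge0 //; last by rewrite mulr_ge0 // sqr_ge0.
by rewrite mulr_ge0 // mulr_ge0 ?(le_trans ler01 Mt1) // addr_ge0.
Qed.

Local Notation v := (avg_green gamma (fun a => G a a)).

Lemma Im_avg_ge k : N%:R^-1 * \sum_i Im (G i i) <= Im (v k).
Proof.
rewrite /avg_green natVCE ImCM Im_sum ler_wpM2l ?invr_ge0 //.
by apply: ler_sum => i _; rewrite ImCM ler_peMl // Im_green_ge0.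
Qed.

Lemma Im_avg_ge0 k : 0 <= Im (v k).
Proof.
apply: le_trans (Im_avg_ge k); rewrite mulr_ge0 ?invr_ge0 //.
by apply: sumr_ge0 => i _; exact: Im_green_ge0.
Qed.

Lemma green_inv_err i : - (G i i)^-1 = z + gdot gamma v i + self_energy_err i.
Proof. by rewrite /self_energy_err; ring. Qed.

Lemma base_diag_lower (Z : R) i : n[z] <= Z -> sg <= 1 ->
  (Z + Mt + 1)^-1 <= th i * n[G i i].
Proof.
move=> hZ hsg; have g0 := normc_green_gt0 i.
have Z0 : 0 <= Z by exact: le_trans (normc_ge0 _) hZ.
have hv k : n[v k] <= Mt.
  rewrite /avg_green natVCE normcCM ?invr_ge0 //.
  apply: le_trans (avg_gamma_le r0 gamma1 gammaM k); rewrite ler_wpM2l ?invr_ge0 //.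
  rewrite (le_trans (normc_sum _ _ _)) //; apply: ler_sum => a _.
  have ga : 0 <= gamma k a by exact: le_trans ler01 _.
  by rewrite normcCM // ler_piMr // green_le1.
have h : (n[G i i])^-1 <= (Z + Mt + 1) * th i.
  rewrite -Normc.normcV -normcN green_inv_err.
  rewrite (le_trans (normcD _ _)) // mulrDl; apply: lerD; last first.
    by rewrite mul1r (le_trans (base_err_le i)) // ler_piMr // ltW.
  rewrite (le_trans (normcD _ _)) // mulrDl; apply: lerD; last exact: normc_gdot_le.
  by rewrite (le_trans hZ) // ler_peMr.
have K0 : 0 < Z + Mt + 1 by rewrite ltr_wpDl // addr_ge0 // (le_trans ler01).
rewrite -[X in _ <= X]invrK lef_pV2 ?posrE ?invr_gt0 ?mulr_gt0 //.
by rewrite invfM mulrC ler_pdivrMr.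
Qed.

(** A lower bound on [Im G_ii] is available only for [theta_i] of order one;
    such indices are abundant, again by convexity of the inverse. *)
Lemma base_Im_avg (Z : R) k : n[z] <= Z -> sg <= (4 * Mt)^-1 ->
  (2 * (Z + Mt + 1) ^+ 2 * Mt)^-1 <= Im (v k).
Proof.
move=> hZ hsg.
have Z0 : 0 <= Z by exact: le_trans (normc_ge0 _) hZ.
have Mt0 : 0 < Mt by exact: lt_le_trans Mt1.
have K0 : 0 < Z + Mt + 1 by rewrite ltr_wpDl // addr_ge0 // ltW.
have hsg1 : sg <= 1.
  have M4 : 1 <= 4 * Mt by have := Mt1; lra.
  by rewrite (le_trans hsg) // invf_le1 // (lt_le_trans ltr01).
set K := Z + Mt + 1 in K0 *.
apply: le_trans (Im_avg_ge k).
have step i : (2 / Mt - th i ^+ 2 / Mt ^+ 2) / (2 * K ^+ 2) <= Im (G i i).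
  have K20 : 0 < 2 * K ^+ 2 by rewrite mulr_gt0 // exprn_gt0.
  have [big|small] := leP (2 * Mt) (th i ^+ 2).
    apply: le_trans (Im_green_ge0 i Hs z0).
    rewrite pmulr_lle0 ?invr_gt0 // subr_le0.
    have -> : 2 / Mt = (2 * Mt) / Mt ^+ 2.
      by move: Mt0; move: (r%:R * M) => y y0; field; rewrite gt_eqF.
    by rewrite ler_wpM2r ?invr_ge0 ?sqr_ge0.
  have thM : th i <= 2 * Mt by apply: le_trans (ltW small); rewrite expr2 ler_peMr // ltW.
  have g0 := normc_green_gt0 i.
  have ImE : Im (G i i) = n[G i i] ^+ 2 * Im (- (G i i)^-1).
    by rewrite Im_oppV mulrCA mulfV ?mulr1 // expf_neq0 // gt_eqF.
  have h1 : 1 / 2 <= Im (- (G i i)^-1).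
    rewrite green_inv_err ImD [Im (z + _)]ImD.
    have e1 : 0 <= Im (gdot gamma v i).
      rewrite Im_gdot sumr_ge0 // => j _; rewrite mulr_ge0 ?Im_avg_ge0 //.
      exact: le_trans ler01 _.
    have e2 : - (1 / 2) <= Im (self_energy_err i).
      rewrite lerNl; apply: le_trans (ler_norm _) _; rewrite normrN.
      apply: (le_trans (Im_le_normc _)); apply: (le_trans (base_err_le i)).
      apply: (@le_trans _ _ (2 * Mt * (4 * Mt)^-1)).
        by rewrite ler_pM ?sg_ge0 // ltW.
      rewrite le_eqVlt; apply/orP; left; apply/eqP.
      by move: Mt0; move: (r%:R * M) => y y0; field; rewrite gt_eqF.
    have := eta1; lra.
  have h2 : (K ^-1 / th i) ^+ 2 <= n[G i i] ^+ 2.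
    rewrite ler_pXn2r ?nnegrE ?normc_ge0 //; last first.
      by rewrite mulr_ge0 ?invr_ge0 // ltW.
    by rewrite ler_pdivrMr // mulrC base_diag_lower.
  rewrite ImE.
  apply: (@le_trans _ _ ((K^-1 / th i) ^+ 2 * (1 / 2))); last first.
    by rewrite ler_pM ?sqr_ge0.
  have -> : (K^-1 / th i) ^+ 2 * (1 / 2) = (th i ^+ 2)^-1 / (2 * K ^+ 2).
    by field; rewrite (gt_eqF K0) (gt_eqF (th0 i)).
  rewrite ler_wpM2r ?invr_ge0 ?(ltW K20) // -subr_ge0.
  have -> : (th i ^+ 2)^-1 - (2 / Mt - th i ^+ 2 / Mt ^+ 2) = ((th i)^-1 - th i / Mt) ^+ 2.
    move: Mt0; move: (r%:R * M) => y y0.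
    by field; rewrite (gt_eqF y0) (gt_eqF (th0 i)).
  exact: sqr_ge0.
apply: (@le_trans _ _ (N%:R^-1 * \sum_i (2 / Mt - th i ^+ 2 / Mt ^+ 2) / (2 * K ^+ 2))); last first.
  by rewrite ler_wpM2l ?invr_ge0 //; apply: ler_sum => i _.
have -> : N%:R^-1 * (\sum_i (2 / Mt - th i ^+ 2 / Mt ^+ 2) / (2 * K ^+ 2))
  = (2 / Mt - N%:R^-1 * (\sum_i th i ^+ 2) / Mt ^+ 2) / (2 * K ^+ 2).
  rewrite -mulr_suml sumrB [X in _ - X](_ : _ = (\sum_i th i ^+ 2) / Mt ^+ 2).
    by rewrite mulrA mulrBr (avg_const N0) !mulrA.
  by rewrite mulr_suml.
have -> : (2 * K ^+ 2 * Mt)^-1 = Mt^-1 / (2 * K ^+ 2) by rewrite invfM mulrC.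
apply: ler_wpM2r; first by rewrite invr_ge0 mulr_ge0 // exprn_ge0 // ltW.
have := avg_theta2_le gammaM.
move: Mt0; move: (r%:R * M) => y y0 hy.
have : N%:R^-1 * (\sum_i th i ^+ 2) / y ^+ 2 <= y / y ^+ 2.
  by rewrite ler_wpM2r ?invr_ge0 ?sqr_ge0.
rewrite [X in _ <= X](_ : _ = y^-1); last by field; rewrite gt_eqF.
lra.
Qed.

Lemma base_diag_upper (c : R) i : 0 < c -> (forall k, c <= Im (v k)) -> sg <= c / 2 ->
  th i * n[G i i] <= 2 / c.
Proof.
move=> c0 hc hsg; have g0 := normc_green_gt0 i.
have h : c / 2 * th i <= (n[G i i])^-1.
  rewrite -Normc.normcV -normcN (le_trans _ (le_trans (ler_norm _) (Im_le_normc _))) //.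
  rewrite green_inv_err ImD [Im (z + _)]ImD.
  have e1 := Im_gdot_ge gamma1 i hc.
  have e2 : - (c / 2 * th i) <= Im (self_energy_err i).
    rewrite lerNl; apply: le_trans (ler_norm _) _; rewrite normrN.
    apply: (le_trans (Im_le_normc _)); apply: (le_trans (base_err_le i)).
    by rewrite mulrC ler_wpM2r // ltW.
  have := z0; lra.
have ct : 0 < c / 2 * th i by rewrite mulr_gt0 // divr_gt0.
have h3 : n[G i i] <= (c / 2 * th i)^-1.
  by rewrite -[X in X <= _]invrK lef_pV2 ?posrE ?invr_gt0.
apply: (le_trans (ler_wpM2l (ltW (th0 i)) h3)).
rewrite le_eqVlt; apply/orP; left; apply/eqP; field.
by rewrite (gt_eqF c0) (gt_eqF (th0 i)).
Qed.

(** No bound on [Lambda_o] is available here; instead [|G_ij|^2 <= Im G_jj / Im z],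
    which is of order [1 / theta_j], and likewise for the minor up to a factor
    [theta_i]. *)
Lemma base_offdiag (C : R) i j : 1 <= C ->
  (forall i, C^-1 <= th i * n[G i i] <= C) -> i != j ->
  sqth i * sqth j * n[G i j] <= 8 * C ^+ 3 * (t * qh).
Proof.
move=> C1 hdiag ij; have ji : j != i by rewrite eq_sym.
have C0 : 0 < C by exact: lt_le_trans C1.
have t0 : 0 <= t by exact: le_trans ler01 t1.
have CC : C <= C ^+ 2 by rewrite expr2 ler_peMr // ltW.
have [hL _ _] := Hgood i.
have gi := normc_green_gt0 i.
have ri0 : 0 < sqth i / sqth j by rewrite divr_gt0 ?sqth_gt0.
have hgj : n[G j j] <= C / th j by rewrite ler_pdivlMr // mulrC; case/andP: (hdiag j).
have hgi : (n[G i i])^-1 <= C * th i.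
  have /andP[h _] := hdiag i.
  rewrite -[X in _ <= X]invrK lef_pV2 ?posrE ?invr_gt0 ?mulr_gt0 //.
  by rewrite invfM ler_pdivrMr // mulrC.
have hjj : n[Gi i j j] <= 2 * C ^+ 2 * (th i / th j).
  rewrite minor_diff // (le_trans (normcBD _ _)) // Normc.normcM Normc.normcM Normc.normcV.
  have e1 : n[G j i] * n[G i j] <= C / th j.
    rewrite (green_sym z i j Hs) -expr2; apply: le_trans hgj.
    apply: le_trans (Im_diag_over j Hs); rewrite (bigD1 i) //= lerDl.
    by apply: sumr_ge0 => b _; exact: sqr_ge0.
  have e2 : n[G j i] * n[G i j] / n[G i i] <= C ^+ 2 * (th i / th j).
    rewrite (_ : C ^+ 2 * (th i / th j) = C / th j * (C * th i)); last by ring.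
    by rewrite ler_pM ?mulr_ge0 ?normc_ge0 // invr_ge0 ltW.
  have e3 : C / th j <= C ^+ 2 * (th i / th j).
    by rewrite mulrA ler_wpM2r // (le_trans CC) // ler_peMr // sqr_ge0.
  apply: (le_trans (lerD hgj e2)); lra.
set B := 2 * C ^+ 2 * (sqth i / sqth j).
have B0 : 0 <= B by rewrite mulr_ge0 ?(ltW ri0) // mulr_ge0 // sqr_ge0.
have hB2 : n[Gi i j j] <= B ^+ 2.
  apply: (le_trans hjj); rewrite /B exprMn.
  rewrite (_ : (sqth i / sqth j) ^+ 2 = th i / th j); last by rewrite exprMn exprVn !sqth_sqr.
  have D1 : 1 <= 2 * C ^+ 2 by rewrite mulr_ege1 ?ler1n // expr_ge1 // ltW.
  apply: ler_wpM2r; first by rewrite divr_ge0 ?(ltW (th0 _)).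
  by rewrite [X in _ <= X]expr2 ler_peMr // (le_trans ler01).
have hB a : a != i -> n[Gi i a j] <= B.
  move=> ai; apply: normc_le_sqr => //; apply: le_trans hB2.
  rewrite minor_sym; apply: le_trans (Im_diag_over j (minor_mx_sym i Hs)).
  by rewrite (bigD1 a) //= lerDl; apply: sumr_ge0 => b _; exact: sqr_ge0.
have hS : \sum_(a | a != i) s i a * n[Gi i a j] ^+ 2 <= (B * qh) ^+ 2.
  rewrite (eq_bigr (fun b => s i b * n[Gi i j b] ^+ 2)) => [|b _]; last by rewrite minor_sym.
  rewrite (le_trans (sum_profile_green_le i j _ (minor_mx_sym i Hs))) //.
  by rewrite exprMn qh2 mulrC ler_wpM2r.
have S0 : 0 <= B * qh by rewrite mulr_ge0.
have := hL j _ _ B0 S0 hB hS => hX.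
rewrite schur_offdiag // normcN Normc.normcM.
set X := n[\sum_(a | _) _] in hX *.
have X0 : 0 <= X by exact: normc_ge0.
have hg : n[G i i] <= C / th i by rewrite ler_pdivlMr // mulrC; case/andP: (hdiag i).
have w0 : 0 <= sqth i * sqth j by rewrite mulr_ge0 // ltW // sqth_gt0.
apply: (@le_trans _ _ (sqth i * sqth j * (C / th i * (2 * t * (B / Num.sqrt q + B * qh))))).
  by rewrite ler_wpM2l // ler_pM ?normc_ge0.
rewrite le_eqVlt; apply/orP; left; apply/eqP.
rewrite /B -sqth_sqr; field.
by rewrite (gt_eqF (sqth_gt0 i)) (gt_eqF (sqth_gt0 j)) gt_eqF // sqrtr_gt0.
Qed.

End Base.

End SelfEnergy.

(** * One step of the bootstrap, with uniform constants *)

Definition model_ok (R : realType) (r N : nat) (gamma : 'I_r -> 'I_N -> R) (M q : R) :=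
  [/\ (0 < N)%N, forall k i, 1 <= gamma k i,
      N%:R^-1 * (\sum_k \sum_i gamma k i ^+ 2) <= M, 1 <= q &
      q ^+ 2 <= N%:R /\ forall i j, q * profile gamma i j <= 1].

Definition matrix_ok (R : realType) (N : nat) (q : R) (H : 'M[R]_N) :=
  sym_mx H /\ forall i j, `|H i j| <= (Num.sqrt q)^-1.

(** What has to be known at a spectral parameter before the estimates there can
    start: the orders of magnitude predicted by the deterministic solution. *)
Definition apriori (R : realType) (r N : nat) (gamma : 'I_r -> 'I_N -> R)
    (H : 'M[R]_N) (z : R[i]) (C : R) :=
  [/\ forall i, C^-1 <= theta gamma i * n[green H z i i] <= C,
      forall k, C^-1 <= Im (avg_green gamma (fun a => green H z a a) k) &
      Lambda_o (theta gamma) (green H z) <= 1].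

Section LambdaFacts.
Context (R : realType) (r N : nat) (gamma : 'I_r -> 'I_N -> R)
  (u : R[i] -> 'I_r -> R[i]) (H : 'M[R]_N) (z : R[i]).
Local Notation th := (theta gamma).
Local Notation G := (green H z).

Lemma Lambda_o_ge i j : i != j ->
  Num.sqrt (th i * th j) * n[G i j] <= Lambda_o th G.
Proof.
move=> ij; exact: (@le_bigmax_cond _ _ _ 0 (i, j) (fun ij : 'I_N * 'I_N => ij.1 != ij.2)
  (fun ij => Num.sqrt (th ij.1 * th ij.2) * n[G ij.1 ij.2])).
Qed.

Lemma Lambda_o_ge0 : 0 <= Lambda_o th G.
Proof. exact: bigmax_ge_id. Qed.

Lemma Lambda_ge0 : 0 <= Lambda gamma u H z.
Proof. by rewrite /Lambda le_max Lambda_o_ge0 orbT. Qed.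

Lemma Lambda_diag_ge i : th i * n[G i i - gsol gamma u z i] <= Lambda gamma u H z.
Proof.
rewrite /Lambda le_max; apply/orP; left.
exact: (@le_bigmax_cond _ _ _ 0 i xpredT (fun i => th i * n[G i i - gsol gamma u z i])).
Qed.

Lemma Lambda_off_ge i j : i != j ->
  Num.sqrt (th i * th j) * n[G i j] <= Lambda gamma u H z.
Proof. by move=> ij; rewrite /Lambda le_max Lambda_o_ge ?orbT. Qed.

Lemma Lambda_le B : 0 <= B ->
  (forall i, th i * n[G i i - gsol gamma u z i] <= B) ->
  (forall i j, i != j -> Num.sqrt (th i * th j) * n[G i j] <= B) ->
  Lambda gamma u H z <= B.
Proof.
move=> B0 h1 h2; rewrite /Lambda ge_max; apply/andP; split.
  by apply: bigmax_le.
by apply: bigmax_le => // -[i j] /= ij; exact: h2.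
Qed.

End LambdaFacts.

(** The a priori bounds of constant order [C] come back as small ones. *)
Theorem bulk_step (R : realType) (r : nat) (M Z c0 C0 C : R) :
  (0 < r)%N -> 1 <= r%:R * M -> 0 < c0 -> 0 < C0 -> 1 <= C ->
  exists K tau : R, [/\ 1 <= K, 0 < tau &
  forall (N : nat) (gamma : 'I_r -> 'I_N -> R) (q : R) (H : 'M[R]_N) (z : R[i]) (t : R)
    (u : R[i] -> 'I_r -> R[i]),
  model_ok gamma M q -> matrix_ok q H -> good_event (profile gamma) q H z t ->
  solves_system gamma u -> 0 < Im z -> Im z <= 10 -> n[z] <= Z ->
  (forall k, c0 <= Im (u z k)) -> (forall k, n[u z k] <= C0) ->
  apriori gamma H z C ->
  K <= t -> t ^+ 3 * Phi N q (Im z) <= tau ->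
  Lambda gamma u H z <= K * (t ^+ 3 * Phi N q (Im z))].
Proof.
move=> r0 Mt1 c00 C00 C1.
have Cp : 0 < C by exact: lt_le_trans C1.
pose c' := Num.min c0 C^-1; pose C' := Num.max C0 C.
have c'0 : 0 < c' by rewrite lt_min c00 invr_gt0.
have C'0 : 0 < C' by rewrite lt_max C00.
have [Ks [s0 [Ks0 s00 SC]]] := self_consistent_stable Z r0 c'0 C'0.
pose K1 := 28 * C ^+ 2 * (r%:R * M).
pose K3 := 4 * ((46 + r%:R) * (42 * C ^+ 2 * (r%:R * M)) * (r%:R * M)).
have CC : 1 <= C ^+ 2 by rewrite expr_ge1 // ltW.
have CM : 1 <= C ^+ 2 * (r%:R * M) by rewrite mulr_ege1.
have K11 : 1 <= K1 by rewrite /K1 -mulrA; lra.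
have r46 : 1 <= 46 + r%:R :> R by have : 0 <= r%:R :> R by []; lra.
have K31 : 1 <= K3.
  have h : 1 <= 42 * C ^+ 2 * (r%:R * M) by rewrite -mulrA; lra.
  rewrite /K3 mulr_ege1 ?ler1n // mulr_ege1 // mulr_ege1 //.
pose K := K1 + Ks * K3.
have K30 : 0 < K3 by exact: lt_le_trans K31.
have KsK3 : 0 < Ks * K3 by exact: mulr_gt0.
exists K, (Num.min (1 / 2) (s0 / K3)); split.
- by rewrite /K; lra.
- by rewrite lt_min; apply/andP; split; [lra|exact: divr_gt0].
move=> N gamma q H z t u [N0 gamma1 gammaM q1 [qN qs1]] [Hs Hq] Hgood hu z0 z10 hZ hcu hCu
  [hd hv hlam] Kt.
rewrite le_min => /andP[tau1 tau2].
have t1 : 1 <= t by apply: le_trans Kt; rewrite /K; lra.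
have t0 : 0 <= t by exact: le_trans ler01 t1.
set P := Phi N q (Im z) in tau1 tau2 *.
have P0 : 0 <= P by rewrite addr_ge0 // invr_ge0 sqrtr_ge0.
have tP : 2 * (t * P) <= 1.
  have : t * P <= t ^+ 3 * P by rewrite ler_wpM2r // exprS ler_peMr // expr_ge1.
  lra.
set lam := Lambda_o (theta gamma) (green H z) in hlam.
have lam01 : 0 <= lam <= 1 by rewrite hlam andbT; exact: Lambda_o_ge0.
have hoff a b : a != b -> sqth gamma a * sqth gamma b * n[green H z a b] <= lam.
  by move=> ab; rewrite -(sqrt_theta_mul r0 gamma1) Lambda_o_ge.
have K1t : K1 <= t by apply: le_trans Kt; rewrite /K lerDl ltW.
have hlam' := offdiag_self_improve r0 N0 gamma1 gammaM q1 Hs z0 t1 Hgood C1 lam01 hd hoff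
  z10 erefl K1t.
have herr i := bulk_err_le r0 N0 gamma1 gammaM q1 qN qs1 Hs Hq z0 t1 Hgood C1 lam01 hd hoff
  z10 i hlam' K1t tP.
have T0 : 0 <= t ^+ 3 * P by rewrite mulr_ge0 // exprn_ge0.
have sg1 : 0 <= K3 * (t ^+ 3 * P) <= s0.
  by rewrite mulr_ge0 ?(ltW K30) //= mulrC -ler_pdivlMr.
have hdiagz i : theta gamma i * n[green H z i i - gsol gamma u z i] <= Ks * (K3 * (t ^+ 3 * P)).
  apply: (SC N gamma z u (fun a => green H z a a)) => //.
  - by move=> k; apply: le_trans (hcu k); rewrite ge_min lexx.
  - by move=> k; apply: (le_trans (hCu k)); rewrite le_max lexx.
  - by move=> k; apply: le_trans (hv k); rewrite ge_min lexx orbT.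
  - by move=> a; have /andP[_ h] := hd a; apply: (le_trans h); rewrite le_max lexx orbT.
  - by move=> a; exact: green_diag_neq0.
have KE : K * (t ^+ 3 * P) = K1 * (t ^+ 3 * P) + Ks * (K3 * (t ^+ 3 * P)).
  by rewrite /K; ring.
have x1 : 0 <= K1 * (t ^+ 3 * P) by rewrite mulr_ge0 // (le_trans ler01).
have x2 : 0 <= Ks * (K3 * (t ^+ 3 * P)).
  by apply: mulr_ge0; [exact: ltW|case/andP: sg1].
rewrite KE; apply: Lambda_le; first exact: addr_ge0.
  by move=> i; rewrite (le_trans (hdiagz i)) // lerDr.
move=> i j ij; rewrite (le_trans (Lambda_o_ge gamma H z ij)) // -/lam (le_trans hlam') //.
rewrite -/K1 -/P; apply: (@le_trans _ _ (K1 * (t ^+ 3 * P))); last by rewrite lerDl.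
rewrite ler_wpM2l ?(le_trans ler01 K11) // ler_wpM2r // [X in _ <= X]exprS ler_peMl //.
exact: sqr_ge0.
Qed.

(** The starting point of the bootstrap: the same conclusion without a priori
    bounds, from the trivial bound on the resolvent. *)
Theorem base_step (R : realType) (r : nat) (M Z c0 C0 : R) :
  (0 < r)%N -> 1 <= r%:R * M -> 0 < c0 -> 0 < C0 ->
  exists K tau : R, [/\ 1 <= K, 0 < tau &
  forall (N : nat) (gamma : 'I_r -> 'I_N -> R) (q : R) (H : 'M[R]_N) (z : R[i]) (t : R)
    (u : R[i] -> 'I_r -> R[i]),
  model_ok gamma M q -> matrix_ok q H -> good_event (profile gamma) q H z t ->
  solves_system gamma u -> 1 <= Im z -> n[z] <= Z ->
  (forall k, c0 <= Im (u z k)) -> (forall k, n[u z k] <= C0) ->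
  1 <= t -> t ^+ 2 * (Num.sqrt q)^-1 <= tau ->
  Lambda gamma u H z <= K * (t ^+ 2 * (Num.sqrt q)^-1)].
Proof.
move=> r0 Mt1 c00 C00.
set y := r%:R * M in Mt1.
have y0 : 0 < y by exact: lt_le_trans Mt1.
pose Z' := Num.max Z 0.
have Z0 : 0 <= Z' by rewrite le_max lexx orbT.
pose c1 := (2 * (Z' + y + 1) ^+ 2 * y)^-1.
have Zy1 : 1 <= Z' + y + 1 by lra.
have Zy0 : 0 < Z' + y + 1 by lra.
have c10 : 0 < c1 by rewrite invr_gt0 mulr_gt0 // mulr_gt0 // exprn_gt0.
pose C1 := Num.max (Z' + y + 1) (2 / c1).
have C11 : 1 <= C1 by rewrite le_max Zy1.
have C10 : 0 < C1 by exact: lt_le_trans C11.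
pose c' := Num.min c0 c1; pose C' := Num.max C0 C1.
have c'0 : 0 < c' by rewrite lt_min c00.
have C'0 : 0 < C' by rewrite lt_max C00.
have [Ks [s0 [Ks0 s00 SC]]] := self_consistent_stable Z r0 c'0 C'0.
pose A := 2 * ((46 + r%:R) * y).
have A0 : 0 < A by rewrite mulr_gt0 // mulr_gt0 // ltr_wpDr.
have C31 : 1 <= C1 ^+ 3 by rewrite expr_ge1 // ltW.
exists (Ks * A + 8 * C1 ^+ 3),
  (Num.min (Num.min (4 * y)^-1 (c1 / 2)) s0 / A); split.
- have : 0 < Ks * A by exact: mulr_gt0.
  lra.
- rewrite divr_gt0 // !lt_min s00 andbT; apply/andP; split; last exact: divr_gt0.
  by rewrite invr_gt0 mulr_gt0.
move=> N gamma q H z t u [N0 gamma1 gammaM q1 [qN qs1]] [Hs Hq] Hgood hu z1 hZ hcu hCu t1.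
set P := t ^+ 2 * (Num.sqrt q)^-1 => hP.
have z0 : 0 < Im z by exact: lt_le_trans z1.
have t0 : 0 <= t by exact: le_trans ler01 t1.
have hZ' : n[z] <= Z' by rewrite (le_trans hZ) // le_max lexx.
have qh0 : 0 <= (Num.sqrt q)^-1 by rewrite invr_ge0 sqrtr_ge0.
have P0 : 0 <= P by rewrite mulr_ge0 // sqr_ge0.
move: hP; rewrite ler_pdivlMr // mulrC !le_min => /andP[/andP[sg1 sg2] sg3].
have sgle1 : A * P <= 1.
  have y4 : 1 <= 4 * y by lra.
  by apply: (le_trans sg1); rewrite invf_le1 // (lt_le_trans ltr01).
have herr := base_err_le r0 N0 gamma1 gammaM q1 qN qs1 Hs Hq z0 t1 Hgood z1.
have hlow i := base_diag_lower r0 N0 gamma1 gammaM q1 qN qs1 Hs Hq z0 t1 Hgood z1 i hZ' sgle1.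
have hIm k := base_Im_avg r0 N0 gamma1 gammaM q1 qN qs1 Hs Hq z0 t1 Hgood z1 k hZ' sg1.
have hup i := base_diag_upper r0 N0 gamma1 gammaM q1 qN qs1 Hs Hq z0 t1 Hgood z1 i c10 hIm sg2.
have hd i : C1^-1 <= theta gamma i * n[green H z i i] <= C1.
  apply/andP; split; last by rewrite (le_trans (hup i)) // le_max lexx orbT.
  apply: le_trans (hlow i); rewrite lef_pV2 ?posrE // le_max lexx //.
have hoff i j : i != j ->
   Num.sqrt (theta gamma i * theta gamma j) * n[green H z i j] <= 8 * C1 ^+ 3 * P.
  move=> ij; rewrite (sqrt_theta_mul r0 gamma1).
  have := base_offdiag r0 gamma1 q1 qs1 Hs z0 t1 Hgood z1 C11 hd ij.
  move/le_trans; apply; apply: ler_wpM2l; first by rewrite mulr_ge0 // (le_trans ler01).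
  by rewrite /P; apply: ler_wpM2r => //; rewrite expr2 ler_peMr.
have sgs : 0 <= A * P <= s0 by rewrite mulr_ge0 ?(ltW A0).
have hdg i : theta gamma i * n[green H z i i - gsol gamma u z i] <= Ks * (A * P).
  apply: (SC N gamma z u (fun a => green H z a a)) => //.
  - by move=> k; apply: le_trans (hcu k); rewrite ge_min lexx.
  - by move=> k; apply: (le_trans (hCu k)); rewrite le_max lexx.
  - by move=> k; apply: le_trans (hIm k); rewrite ge_min lexx orbT.
  - move=> a; have /andP[_ h] := hd a.
    by apply: (le_trans h); rewrite le_max lexx orbT.
  - by move=> a; exact: green_diag_neq0.
have x1 : 0 <= Ks * (A * P) by rewrite mulr_ge0 ?(ltW Ks0) //; case/andP: sgs.
have x2 : 0 <= 8 * C1 ^+ 3 * P by rewrite mulr_ge0 // mulr_ge0 // (le_trans ler01).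
have -> : (Ks * A + 8 * C1 ^+ 3) * P = Ks * (A * P) + 8 * C1 ^+ 3 * P by ring.
apply: Lambda_le; first exact: addr_ge0.
  by move=> i; rewrite (le_trans (hdg i)) // lerDl.
by move=> i j ij; rewrite (le_trans (hoff i j ij)) // lerDr.
Qed.

(** * Descending from height 10 *)

Lemma Phi_antitone (R : realType) (N : nat) (q e1 e2 : R) : (0 < N)%N ->
  0 < e1 -> e1 <= e2 -> Phi N q e2 <= Phi N q e1.
Proof.
move=> N0 e10 e12; have NR0 : 0 < (N%:R : R) by rewrite ltr0n.
have e20 : 0 < e2 by exact: lt_le_trans e12.
rewrite /Phi lerD2l lef_pV2 ?posrE ?sqrtr_gt0; first by rewrite ler_wsqrtr // ler_wpM2l.
  exact: mulr_gt0.
exact: mulr_gt0.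
Qed.

(** The a priori bounds survive a small vertical displacement of the spectral
    parameter; [W] is a crude upper bound for the weights [theta]. *)
Lemma apriori_propagate (R : realType) (r N : nat) (gamma : 'I_r -> 'I_N -> R)
    (u : R[i] -> 'I_r -> R[i]) (H : 'M[R]_N) (z z' : R[i]) (Z c0 C0 rho W C : R) :
  (0 < r)%N -> (0 < N)%N -> (forall k i, 1 <= gamma k i) ->
  solves_system gamma u -> 0 < Im z' -> n[z'] <= Z -> 0 < c0 ->
  (forall k, c0 <= Im (u z' k)) -> (forall k, n[u z' k] <= C0) ->
  Lambda gamma u H z' <= rho ->
  (forall i, theta gamma i <= W) ->
  (forall a b, W * n[green H z a b - green H z' a b] <= rho) ->
  rho <= 1 / 2 -> rho <= (4 * (Z + C0))^-1 -> rho <= c0 / 4 ->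
  2 * (Z + C0) <= C -> c0^-1 + 1 <= C -> 2 / c0 <= C ->
  apriori gamma H z C.
Proof.
move=> r0 N0 gamma1 hu z0 hZ c00 hcu hCu hLam hW hlip rho1 rho2 rho3 C1 C2 C3.
have th1 i : 1 <= theta gamma i by exact: theta_ge1.
have th0 i : 0 < theta gamma i by exact: lt_le_trans (th1 i).
have [_ ukE] := hu z' z0.
have rho0 : 0 <= rho by exact: le_trans (Lambda_ge0 _ _ _ _) hLam.
have ZC : 0 < Z + C0.
  have := hcu (Ordinal r0); have := hCu (Ordinal r0); have := normc_ge0 z'.
  have := le_trans (ler_norm _) (Im_le_normc (u z' (Ordinal r0))); lra.
have C0p : 0 < C by have := invr_gt0 c0; rewrite c00; lra.
set G := green H z; set G' := green H z'.
pose g := gsol gamma u z'.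
have lip i a b : theta gamma i * n[G a b - G' a b] <= rho.
  by apply: le_trans (hlip a b); rewrite ler_wpM2r ?normc_ge0.
have close i : theta gamma i * n[G i i - g i] <= 2 * rho.
  rewrite (le_trans (ler_wpM2l (ltW (th0 i)) (normc_distD (G' i i) _ _))) // mulrDr.
  rewrite mulr_natl mulr2n; apply: lerD; first exact: lip.
  exact: le_trans (Lambda_diag_ge _ _ _ _ i) hLam.
have g_size i : (Z + C0)^-1 <= theta gamma i * n[g i] <= c0^-1.
  have [s1 s2 s3 _] := sector_den gamma1 i r0 z0 c00 hZ hcu hCu.
  rewrite /g /gsol -/(gdot gamma (u z') i) normcN Normc.normcV; apply/andP; split.
    by rewrite ler_pdivlMr // mulrC ler_pdivrMr // mulrC.
  rewrite ler_pdivrMr // mulrC ler_pdivlMr // mulrC.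
  exact: le_trans s1 (le_trans (ler_norm _) (Im_le_normc _)).
split.
- move=> i; have /andP[g1 g2] := g_size i; have cl := close i; apply/andP; split.
    have h : theta gamma i * n[g i] <= theta gamma i * n[G i i] + theta gamma i * n[G i i - g i].
      rewrite -mulrDr ler_wpM2l ?(ltW (th0 i)) // normcB -lerBlDr.
      have := normc_lower (g i) (G i i); lra.
    have e1 : C^-1 <= (2 * (Z + C0))^-1 by rewrite lef_pV2 ?posrE // mulr_gt0.
    have e2 : (2 * (Z + C0))^-1 = (Z + C0)^-1 - 2 * (4 * (Z + C0))^-1.
      by field; rewrite gt_eqF.
    lra.
  have h : theta gamma i * n[G i i] <= theta gamma i * n[g i] + theta gamma i * n[G i i - g i].
    rewrite -mulrDr ler_wpM2l ?(ltW (th0 i)) //.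
    have := normc_lower (G i i) (g i); lra.
  lra.
- move=> k.
  have uE : u z' k = avg_green gamma g k.
    rewrite {1}ukE /avg_green -mulrN -sumrN; congr (_ * _); apply: eq_bigr => i _.
    by rewrite /g /gsol mulrN.
  have dif : n[avg_green gamma (fun a => G a a) k - u z' k] <= 2 * rho.
    rewrite uE /avg_green -mulrBr -sumrB.
    rewrite (eq_bigr (fun i => (gamma k i)%:C * (G i i - g i))) => [|i _]; last first.
      by rewrite mulrBr.
    apply: (normc_avg_green_le N0 gamma1 (g := fun i => G i i - g i)) => //.
    by rewrite mulr_ge0.
  have h1 := le_trans (ler_norm _) (le_trans (Im_le_normc _) dif).
  have : Im (u z' k) - 2 * rho <= Im (avg_green gamma (fun a => G a a) k).
    have := le_trans (ler_norm (- Im (avg_green gamma (fun a => G a a) k - u z' k))) _.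
    move/(_ (2 * rho)); rewrite normrN => /(_ (le_trans (Im_le_normc _) dif)).
    rewrite ImD ImN; lra.
  have := hcu k.
  have : C^-1 <= c0 / 2.
    have -> : c0 / 2 = (2 / c0)^-1 by rewrite invf_div.
    by rewrite lef_pV2 ?posrE // divr_gt0.
  lra.
rewrite /Lambda_o; apply: bigmax_le => // -[i j] /= ij.
have w0 : 0 <= Num.sqrt (theta gamma i * theta gamma j) by exact: sqrtr_ge0.
have wW : Num.sqrt (theta gamma i * theta gamma j) <= W.
  have W0 : 0 <= W by exact: le_trans (ltW (th0 i)) (hW i).
  apply: sqrt_le => //; rewrite expr2 ler_pM // ltW //.
apply: (@le_trans _ _ (Num.sqrt (theta gamma i * theta gamma j) * (n[G i j - G' i j] + n[G' i j]))).
  rewrite ler_wpM2l //; have := normc_lower (G i j) (G' i j); lra.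
rewrite mulrDr; have l1 := le_trans (Lambda_off_ge gamma u H z' ij) hLam.
have : Num.sqrt (theta gamma i * theta gamma j) * n[G i j - G' i j] <= rho.
  by apply: le_trans (hlip i j); rewrite ler_wpM2r ?normc_ge0.
move=> l2; apply: (le_trans (lerD l2 l1)); lra.
Qed.

Definition vertical_grid (R : realType) (E eta : R) (n k : nat) : R[i] :=
  Complex E (10 - k%:R * ((10 - eta) / n%:R)).

Lemma vertical_grid_end (R : realType) (E eta : R) n : (0 < n)%N -> vertical_grid E eta n n = Complex E eta.
Proof.
move=> n0; rewrite /vertical_grid; congr Complex.
by rewrite mulrC mulfVK ?pnatr_eq0 -?lt0n // opprB addrC subrK.
Qed.

Lemma vertical_grid_Im_ge (R : realType) (E eta : R) n k : (0 < n)%N -> (k <= n)%N -> eta <= 10 ->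
  eta <= Im (vertical_grid E eta n k).
Proof.
move=> n0 kn e10 /=; rewrite lerBrDl -lerBrDr mulrCA ler_piMr ?subr_ge0 //.
by rewrite ler_pdivrMr ?ltr0n // mul1r ler_nat.
Qed.

Lemma vertical_grid_Im_le (R : realType) (E eta : R) n k : eta <= 10 ->
  Im (vertical_grid E eta n k) <= 10.
Proof. by move=> e10 /=; rewrite gerBl mulr_ge0 // divr_ge0 // subr_ge0. Qed.

(** The estimate at one grid point gives, by continuity, the a priori bounds at the
    next one, where [bulk_step] restores the estimate with the original constant:
    nothing is lost along the [N^6] steps. *)
Theorem vertical_bootstrap (R : realType) (r : nat) (M c Eb : R) :
  (0 < r)%N -> 1 <= r%:R * M -> 0 < c ->
  exists K tau : R, [/\ 1 <= K, 0 < tau &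
  forall (N : nat) (gamma : 'I_r -> 'I_N -> R) (q : R) (H : 'M[R]_N) (t E eta : R)
    (u : R[i] -> 'I_r -> R[i]),
  model_ok gamma M q -> matrix_ok q H -> solves_system gamma u ->
  (forall z, Re z = E -> 0 < Im z <= 1 -> c < Im (msol gamma u z)) ->
  `|E| <= Eb -> N%:R^-1 <= eta -> eta <= 10 ->
  (forall k, (k <= N ^ 6)%N ->
     good_event (profile gamma) q H (vertical_grid E eta (N ^ 6) k) t) ->
  K <= t -> t ^+ 3 * Phi N q eta <= tau -> 10 * r%:R <= tau * N%:R ->
  Lambda gamma u H (Complex E eta) <= K * (t ^+ 3 * Phi N q eta)].
Proof.
move=> r0 Mt1 c_gt0.
pose Z := `|Eb| + 10.
have Z0 : 0 < Z by rewrite ltr_wpDl.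
pose c0 := Num.min c ((Z + r%:R * M) ^+ 2 * (r%:R * M))^-1.
pose C0 := Num.max c^-1 (r%:R * M).
have Mt0 : 0 < r%:R * M by exact: lt_le_trans ltr01 Mt1.
have c00 : 0 < c0.
  rewrite lt_min c_gt0 /= invr_gt0; apply: mulr_gt0 => //.
  by apply: exprn_gt0; exact: addr_gt0.
have C00 : 0 < C0 by rewrite lt_max Mt0 orbT.
have ZC : 0 < Z + C0 by exact: addr_gt0.
pose rho := Num.min (1 / 2) (Num.min (4 * (Z + C0))^-1 (c0 / 4)).
have rho0 : 0 < rho.
  rewrite !lt_min; apply/and3P; split; first lra.
    by rewrite invr_gt0 mulr_gt0.
  by rewrite divr_gt0.
pose C := Num.max (2 * (Z + C0)) (Num.max (c0^-1 + 1) (2 / c0)).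
have Ca : 2 * (Z + C0) <= C by rewrite le_max lexx.
have Cb : c0^-1 + 1 <= C by rewrite /C !le_max lexx !orbT.
have Cc : 2 / c0 <= C by rewrite /C !le_max lexx !orbT.
have C1 : 1 <= C by apply: le_trans Cb; rewrite lerDr invr_ge0 ltW.
have [K1 [tau1 [K11 tau10 bulk]]] := bulk_step Z r0 Mt1 c00 C00 C1.
have [K2 [tau2 [K21 tau20 base]]] := base_step Z r0 Mt1 c00 C00.
pose K := K1 + K2.
have K0 : 0 < K by rewrite /K; lra.
exists K, (Num.min (Num.min tau1 tau2) (rho / K)); split.
- by rewrite /K; lra.
- by rewrite !lt_min tau10 tau20 divr_gt0.
move=> N gamma q H t E eta u mok hmat hu hbulk hE Neta eta10 hgood Kt.
have [N0 gamma1 gammaM q1 [qN qs1]] := mok.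
have [Hs Hq] := hmat.
have NR0 : 0 < (N%:R : R) by rewrite ltr0n.
have NR1 : 1 <= (N%:R : R) by rewrite ler1n.
have eta0 : 0 < eta by apply: lt_le_trans Neta; rewrite invr_gt0.
set P := Phi N q eta.
have P0 : 0 <= P by rewrite addr_ge0 // invr_ge0 sqrtr_ge0.
have t1 : 1 <= t by apply: le_trans Kt; rewrite /K; lra.
have t0 : 0 <= t by exact: le_trans ler01 t1.
set D := t ^+ 3 * P.
have D0 : 0 <= D by rewrite mulr_ge0 // exprn_ge0.
rewrite !le_min => /andP[/andP[D1 D2] D3] hN.
have n0 : (0 < N ^ 6)%N by rewrite expn_gt0 N0.
have hN' : 10 * r%:R <= rho * N%:R.
  apply: (le_trans hN); apply: ler_wpM2r; first exact: ltW.
  apply: (@le_trans _ _ (rho / K)); first by rewrite ge_min lexx orbT.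
  by rewrite ler_pdivrMr // ler_peMr ?(ltW rho0) // /K; lra.
pose zk k := vertical_grid E eta (N ^ 6) k.
have zk_ge k : (k <= N ^ 6)%N -> eta <= Im (zk k) by move=> h; exact: vertical_grid_Im_ge.
have zk_le k : Im (zk k) <= 10 by exact: vertical_grid_Im_le.
have zk0 k : (k <= N ^ 6)%N -> 0 < Im (zk k) by move=> /zk_ge; exact: lt_le_trans.
have zkZ k : (k <= N ^ 6)%N -> n[zk k] <= Z.
  move=> h; rewrite (le_trans (normc_le_ReIm _)) // lerD //.
    by rewrite (le_trans hE) // ler_norm.
  by rewrite ger0_norm ?zk_le // ltW // zk0.
have usize k : (k <= N ^ 6)%N ->
    (forall j, c0 <= Im (u (zk k) j)) /\ (forall j, n[u (zk k) j] <= C0).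
  move=> h; have := bulk_size r0 N0 gamma1 gammaM hu c_gt0 (zk0 k h) (zkZ k h); apply.
  have [le1|/ltW ge1] := leP (Im (zk k)) 1; [left|by right].
  by apply: hbulk; rewrite // zk0.
suff main : forall k, (k <= N ^ 6)%N -> Lambda gamma u H (zk k) <= K * D.
  by rewrite -(vertical_grid_end E eta n0); exact: main.
have PhiD k : (k <= N ^ 6)%N -> t ^+ 3 * Phi N q (Im (zk k)) <= D.
  move=> h; rewrite /D ler_wpM2l ?exprn_ge0 //.
  exact: Phi_antitone (zk_ge k h).
elim=> [_|k IH kn].
  have Im10 : Im (zk 0%N) = 10 by rewrite /= mul0r subr0.
  have [uc uC] := usize 0%N (leq0n _).
  have qhD : t ^+ 2 * (Num.sqrt q)^-1 <= D.
    rewrite /D; apply: ler_pM; rewrite ?sqr_ge0 ?invr_ge0 ?sqrtr_ge0 //.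
      by rewrite [X in _ <= X]exprS ler_peMl ?sqr_ge0.
    by rewrite /P /Phi lerDl invr_ge0 sqrtr_ge0.
  have h1 : 1 <= Im (zk 0%N) by rewrite Im10 ler1n.
  have := base N gamma q H (zk 0%N) t u mok hmat (hgood 0%N (leq0n _)) hu h1
    (zkZ 0%N (leq0n _)) uc uC t1 (le_trans qhD D2).
  move/le_trans; apply; apply: ler_pM => //.
  - by rewrite (le_trans ler01).
  - by rewrite mulr_ge0 ?sqr_ge0 // invr_ge0 sqrtr_ge0.
  - by rewrite /K lerDr (le_trans ler01).
have kn' : (k <= N ^ 6)%N by exact: ltnW.
have [uc uC] := usize _ kn; have [uc' uC'] := usize _ kn'.
have hLam : Lambda gamma u H (zk k) <= rho.
  by apply: (le_trans (IH kn')); rewrite mulrC -ler_pdivlMr.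
have dz : n[zk k.+1 - zk k] <= 10 / N%:R ^+ 6.
  have -> : zk k.+1 - zk k = Complex 0 (- ((10 - eta) / N%:R ^+ 6)).
    apply: complex_ext => /=; first by rewrite subrr.
    by rewrite natrX -natr1; ring.
  rewrite (le_trans (normc_le_ReIm _)) //= normr0 add0r normrN ger0_norm.
    by rewrite ler_wpM2r ?invr_ge0 ?exprn_ge0 // gerBl ltW.
  by rewrite divr_ge0 ?exprn_ge0 // subr_ge0.
have inv_le j : (j <= N ^ 6)%N -> (Im (zk j))^-1 <= N%:R.
  move=> h; rewrite -[X in _ <= X]invrK lef_pV2 ?posrE ?invr_gt0 ?zk0 //.
  exact: le_trans Neta (zk_ge j h).
(* The step 10 / N^6 beats the Lipschitz constant N^3 of the resolvent at
   heights above 1 / N and the largest weight r N. *)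
have hlip a b : r%:R * N%:R * n[green H (zk k.+1) a b - green H (zk k) a b] <= rho.
  have := green_lip a b Hs (zk0 _ kn) (zk0 _ kn').
  have e1 : n[zk k.+1 - zk k] * ((Im (zk k.+1))^-1 * (Im (zk k))^-1) *+ N
     <= 10 / N%:R ^+ 6 * (N%:R * N%:R) * N%:R.
    rewrite -mulr_natr; apply: ler_wpM2r; first exact: ltW.
    apply: ler_pM => //; first exact: normc_ge0.
      by rewrite mulr_ge0 ?invr_ge0 // ltW // zk0.
    by apply: ler_pM; rewrite ?inv_le // invr_ge0 ltW // zk0.
  move=> h; have {h e1} := le_trans h e1.
  have rN0 : 0 <= r%:R * N%:R :> R by rewrite mulr_ge0.
  move=> h; apply: (le_trans (ler_wpM2l rN0 h)).
  have -> : r%:R * N%:R * (10 / N%:R ^+ 6 * (N%:R * N%:R) * N%:R)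
    = (10 * r%:R) / N%:R ^+ 2 :> R by field; rewrite gt_eqF.
  rewrite ler_pdivrMr ?exprn_gt0 // (le_trans hN') // ler_wpM2l ?(ltW rho0) //.
  by rewrite expr2 ler_peMr // ltW.
have hap : apriori gamma H (zk k.+1) C.
  apply: (apriori_propagate (z' := zk k) (Z := Z) (c0 := c0) (C0 := C0) (rho := rho)
    (W := r%:R * N%:R) r0 N0 gamma1 hu (zk0 _ kn') (zkZ _ kn') c00 uc' uC' hLam) => //.
  - by move=> i; exact: (theta_leN r0 N0 gamma1 q1 qs1).
  - by rewrite /rho !ge_min lexx.
  - by rewrite /rho !ge_min lexx !orbT.
  - by rewrite /rho !ge_min lexx !orbT.
have := bulk N gamma q H (zk k.+1) t u mok hmat (hgood _ kn) hu (zk0 _ kn) (zk_le _)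
  (zkZ _ kn) uc uC hap _ (le_trans (PhiD _ kn) D1).
move=> hb; apply: (le_trans (hb _)); first by apply: le_trans Kt; rewrite /K; lra.
apply: ler_pM.
- by rewrite (le_trans ler01).
- by rewrite mulr_ge0 ?exprn_ge0 // addr_ge0 // invr_ge0 sqrtr_ge0.
- by rewrite /K lerDl (le_trans ler01).
- exact: PhiD.
Qed.

(** * Measurability *)

Section Measurability.
Context (R : realType) (d : measure_display) (T : measurableType d).

Definition measurable_cplx (f : T -> R[i]) :=
  measurable_fun setT (fun w => Re (f w)) /\ measurable_fun setT (fun w => Im (f w)).

Lemma measurable_cplx_cst c : measurable_cplx (fun=> c).
Proof. by split; exact: measurable_cst. Qed.

Lemma measurable_cplx_real (f : T -> R) :
  measurable_fun setT f -> measurable_cplx (fun w => (f w)%:C).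
Proof. by move=> mf; split => //=; exact: measurable_cst. Qed.

Lemma measurable_cplxD f g :
  measurable_cplx f -> measurable_cplx g -> measurable_cplx (fun w => f w + g w).
Proof.
move=> [f1 f2] [g1 g2]; split.
  by under eq_fun do rewrite ReD; exact: measurable_funD.
by under eq_fun do rewrite ImD; exact: measurable_funD.
Qed.

Lemma measurable_cplxM f g :
  measurable_cplx f -> measurable_cplx g -> measurable_cplx (fun w => f w * g w).
Proof.
move=> [f1 f2] [g1 g2]; split.
  by under eq_fun do rewrite ReM; apply: measurable_funB; exact: measurable_funM.
by under eq_fun do rewrite ImM; apply: measurable_funD; exact: measurable_funM.
Qed.

Lemma measurable_normc2 f : measurable_cplx f ->
  measurable_fun setT (fun w => n[f w] ^+ 2).
Proof.
move=> [f1 f2]; under eq_fun do rewrite normc_sqr.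
by apply: measurable_funD; exact: measurable_funX.
Qed.

Lemma measurable_cplxV f : measurable_cplx f -> measurable_cplx (fun w => (f w)^-1).
Proof.
move=> mf; have mn := measurable_normc2 mf; have [f1 f2] := mf.
have mi : measurable_fun setT (fun w => (n[f w] ^+ 2)^-1).
  rewrite (_ : (fun w => _) = (fun x => powR x (-1)) \o (fun w => n[f w] ^+ 2)).
    by apply: measurableT_comp => //; exact: measurable_powR.
  by apply/funext => w /=; rewrite powR_inv1 ?sqr_ge0.
split.
  rewrite (_ : (fun w => _) = (fun w => Re (f w) * (n[f w] ^+ 2)^-1)).
    exact: measurable_funM.
  by apply/funext => w; rewrite normc_sqr; case: (f w).
rewrite (_ : (fun w => _) = (fun w => - Im (f w) * (n[f w] ^+ 2)^-1)).
  by apply: measurable_funM => //; exact: measurable_funN.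
by apply/funext => w; rewrite normc_sqr; case: (f w) => a b /=; rewrite mulNr.
Qed.

Lemma measurable_cplx_sum (I : Type) (s : seq I) (P : pred I) (f : I -> T -> R[i]) :
  (forall i, measurable_cplx (f i)) ->
  measurable_cplx (fun w => \sum_(i <- s | P i) f i w).
Proof.
move=> mf; elim: s => [|i s IH].
  by under eq_fun do rewrite big_nil; exact: measurable_cplx_cst.
under eq_fun do rewrite big_cons; case: (P i) => //.
exact: measurable_cplxD.
Qed.

Lemma measurable_cplx_prod (I : Type) (s : seq I) (P : pred I) (f : I -> T -> R[i]) :
  (forall i, measurable_cplx (f i)) ->
  measurable_cplx (fun w => \prod_(i <- s | P i) f i w).
Proof.
move=> mf; elim: s => [|i s IH].
  by under eq_fun do rewrite big_nil; exact: measurable_cplx_cst.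
under eq_fun do rewrite big_cons; case: (P i) => //.
exact: measurable_cplxM.
Qed.

Lemma measurable_normc f : measurable_cplx f -> measurable_fun setT (fun w => n[f w]).
Proof.
move=> mf; rewrite (_ : (fun w => _) = (fun w => Num.sqrt (n[f w] ^+ 2))).
  apply: measurableT_comp; last exact: measurable_normc2.
  exact: continuous_measurable_fun (@sqrt_continuous R).
by apply/funext => w; rewrite sqrtr_sqr ger0_norm ?normc_ge0.
Qed.

Lemma measurable_cplx_det n (A : T -> 'M[R[i]]_n) :
  (forall i j, measurable_cplx (fun w => A w i j)) ->
  measurable_cplx (fun w => \det (A w)).
Proof.
move=> mA; apply: measurable_cplx_sum => s.
apply: measurable_cplxM; first exact: measurable_cplx_cst.
exact: measurable_cplx_prod.
Qed.

(** Cramer's rule makes the entries of the resolvent rational functions of those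
    of the matrix. *)
Lemma measurable_green N (H : T -> 'M[R]_N) z i j :
  (forall w, sym_mx (H w)) -> 0 < Im z ->
  (forall i j, measurable_fun setT (fun w => H w i j)) ->
  measurable_cplx (fun w => green (H w) z i j).
Proof.
move=> Hs z0 mH.
pose A w := map_mx (real_complex R) (H w) - z%:M.
have mA a b : measurable_cplx (fun w => A w a b).
  under eq_fun do rewrite !mxE; apply: measurable_cplxD.
    exact: measurable_cplx_real.
  exact: measurable_cplx_cst.
rewrite (_ : (fun w => _) = (fun w => (\det (A w))^-1 * cofactor (A w) j i)).
  apply: measurable_cplxM; first exact/measurable_cplxV/measurable_cplx_det.
  apply: measurable_cplxM; first exact: measurable_cplx_cst.
  by apply: measurable_cplx_det => a b; under eq_fun do rewrite mxE mxE; exact: mA.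
by apply/funext => w; rewrite /green /invmx (green_unit (Hs w) z0) !mxE.
Qed.

Lemma measurable_bigmax (I : Type) (s : seq I) (P : pred I) (f : I -> T -> R) :
  (forall i, measurable_fun setT (f i)) ->
  measurable_fun setT (fun w => \big[Num.max/0]_(i <- s | P i) f i w).
Proof.
move=> mf; elim: s => [|i s IH].
  by under eq_fun do rewrite big_nil; exact: measurable_cst.
under eq_fun do rewrite big_cons; case: (P i) => //.
exact: measurable_maxr.
Qed.

Lemma measurable_Lambda r N (gamma : 'I_r -> 'I_N -> R) u (H : T -> 'M[R]_N) z :
  (forall w, sym_mx (H w)) -> 0 < Im z ->
  (forall i j, measurable_fun setT (fun w => H w i j)) ->
  measurable_fun setT (fun w => Lambda gamma u (H w) z).
Proof.
move=> Hs z0 mH; have mG i j := measurable_green i j Hs z0 mH.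
apply: measurable_maxr; apply: measurable_bigmax => i;
  apply: measurable_funM; try exact: measurable_cst; apply: measurable_normc => //.
by apply: measurable_cplxD => //; exact: measurable_cplx_cst.
Qed.

End Measurability.

(** * Transfer to the finite product space *)

Section Transfer.
Context (R : realType) (d : measure_display) (T : measurableType d)
  (P : probability T R) (N : nat) (s : 'I_N -> 'I_N -> R) (q : R)
  (h : 'I_N -> 'I_N -> {RV P >-> R}).
Hypothesis s_ge0 : forall i j, 0 <= s i j.
Hypothesis q_gt0 : 0 < q.
Hypothesis qs_le1 : forall i j, q * s i j <= 1.
Hypothesis hH : centered_adjacency q s h.

Local Notation edges := ('I_N * 'I_N)%type.
Local Notation Omega := {ffun edges -> bool}.

Lemma sample_matrix_sym w : sym_mx (sample_matrix h w).
Proof. by have [hs _ _] := hH; move=> a b; rewrite !mxE hs. Qed.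

Lemma measure_bigU_le (I : finType) (Q : pred I) (A : I -> set T) :
  (forall i, measurable (A i)) ->
  measurable (\big[setU/set0]_(i | Q i) A i) /\
  (P (\big[setU/set0]_(i | Q i) A i) <= \sum_(i | Q i) P (A i))%E.
Proof.
move=> mA; elim: (index_enum I) => [|i e [mU IH]].
  by rewrite !big_nil measure0; split.
rewrite !big_cons; case: ifP => // _; split; first exact: measurableU.
by rewrite (le_trans (measureU2 _ _ _)) // leeD2l.
Qed.

Let upper : {set edges} := [set ij : edges | (ij.1 <= ij.2)%N]%SET.

Let atom (w : Omega) : set T :=
  \bigcap_(e in [set` upper]) (h e.1 e.2 @^-1` [set edge_val s q e (w e)]).

Let degenerate (e : edges) : set T :=
  h e.1 e.2 @^-1` (~` [set edge_val s q e true; edge_val s q e false]).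

Let m_preim e (B : set R) : measurable B -> measurable (h e.1 e.2 @^-1` B).
Proof. by move=> mB; rewrite -[X in measurable X]setTI; exact: measurable_funPT. Qed.

Let m_atom w : measurable (atom w).
Proof.
apply: fin_bigcap_measurable => [|e _]; first exact: finite_finset.
by apply: m_preim; exact: measurable_set1.
Qed.

Let m_degenerate e : measurable (degenerate e).
Proof.
apply: m_preim; apply: measurableC.
by apply: measurableU; exact: measurable_set1.
Qed.

Let edge_proba e b : e \in upper ->
  P (h e.1 e.2 @^-1` [set edge_val s q e b]) = (edge_weight s q e b)%:E.
Proof.
rewrite inE /edge_weight => ->; have [_ _ law] := hH; have [l1 l2] := law e.1 e.2.
by case: b.
Qed.

Let degenerate0 e : e \in upper -> P (degenerate e) = 0.
Proof.
move=> eu; rewrite /degenerate -preimage_setC probability_setC; last first.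
  by apply: m_preim; apply: measurableU; exact: measurable_set1.
rewrite preimage_setU measureU; first last.
- rewrite -preimage_setI (_ : _ `&` _ = set0) ?preimage_set0 //.
  apply/seteqP; split=> // x [/= -> /eqP]; rewrite /edge_val.
  have : 0 < (Num.sqrt q)^-1 by rewrite invr_gt0 sqrtr_gt0.
  move=> sqp /eqP; nra.
- by apply: m_preim; exact: measurable_set1.
- by apply: m_preim; exact: measurable_set1.
transitivity (1 - ((edge_weight s q e true)%:E + (edge_weight s q e false)%:E))%E.
  by congr (_ - (_ + _))%E; exact: edge_proba.
by rewrite -EFinD edge_weight_sum; apply: (congr1 EFin); exact: subrr.
Qed.

Let atom_proba (w : Omega) : (forall e, e \notin upper -> w e = false) ->
  P (atom w) = (weight (edge_weight s q) w)%:E.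
Proof.
move=> w0; have [_ ind _] := hH.
rewrite /atom (ind upper (fun e => [set edge_val s q e (w e)])) //.
rewrite (eq_bigr (fun e => (edge_weight s q e (w e))%:E)) => [|e eu]; last first.
  exact: edge_proba.
rewrite prodEFin /weight; congr (_%:E).
rewrite [RHS](bigID (mem upper)) /= [X in _ * X]big1 ?mulr1 // => e eu.
rewrite w0 // /edge_weight; move: eu; rewrite inE.
by case: ifP.
Qed.

(** Under independence with two-valued entries, the law of the matrix is the
    image of the product measure; only the events need care, since the entries
    are two-valued almost surely but not surely. *)
Lemma transfer (bad : 'M[R]_N -> Prop) :
  measurable [set w | bad (sample_matrix h w)] ->
  (P [set w | bad (sample_matrix h w)]
    <= (proba (edge_weight s q) (fun w => `[< bad (config_mx s q w) >]))%:E)%E.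
Proof.
move=> mbad; have [hs _ _] := hH.
pose Q (w : Omega) := [forall e, (e \notin upper) ==> ~~ w e] && `[< bad (config_mx s q w) >].
pose U1 := \big[setU/set0]_(w | Q w) atom w.
pose U2 := \big[setU/set0]_(e in upper) degenerate e.
have [mU1 PU1] := measure_bigU_le Q m_atom.
have [mU2 PU2] := measure_bigU_le (mem upper) m_degenerate.
have sub : [set w | bad (sample_matrix h w)] `<=` U1 `|` U2.
  move=> x /= bx.
  have [[e eu dx]|nd] := pselect (exists2 e, e \in upper & degenerate e x).
    by right; rewrite /U2 (bigD1 e) //=; left.
  left.
  pose w : Omega := [ffun e => (e \in upper) && (h e.1 e.2 x == edge_val s q e true)].
  have wE e : e \in upper -> h e.1 e.2 x = edge_val s q e (w e).
    move=> eu; rewrite ffunE eu /=; case: eqP => [//|ne].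
    by apply: contrapT => ne2; apply: nd; exists e => // -[].
  have cE : config_mx s q w = sample_matrix h x.
    apply/matrixP => a b; rewrite !mxE -wE; last by rewrite inE edge_le.
    by rewrite /edge; case: ifP => //= _; rewrite hs.
  have Qw : Q w.
    apply/andP; split; last by apply/asboolP; rewrite cE.
    by apply/forallP => e; apply/implyP => /negPf eu; rewrite ffunE eu.
  by rewrite /U1 (bigD1 w) //=; left => e /= eu; exact: wE.
apply: (@le_trans _ _ (P (U1 `|` U2))).
  by apply: le_measure; rewrite ?inE //; exact: measurableU.
apply: (le_trans (measureU2 _ mU1 mU2)).
rewrite -[X in (_ <= X)%E]adde0; apply: leeD; last first.
  by apply: (le_trans PU2); rewrite big1 // => e eu; exact: degenerate0.
apply: (le_trans PU1).
rewrite (eq_bigr (fun w => (weight (edge_weight s q) w)%:E)) => [|w /andP[/forallP hw _]]; last first.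
  apply: atom_proba => e eu; have := hw e; rewrite eu /=.
  by case: (w e).
rewrite sumEFin lee_fin /proba [X in X <= _]big_mkcond [X in _ <= X]big_mkcond.
apply: ler_sum => w _; rewrite /Q; case: `[< _ >]; rewrite ?andbT ?andbF //.
by case: ifP => // _; apply: weight_ge0; exact: edge_weight_ge0.
Qed.

End Transfer.

(** * Asymptotics and the local law *)

Section Asymptotics.
Context (R : realType).
Implicit Types (N : nat) (a e : R).

Lemma powR_natM N a e : (0 < N)%N ->
  powR (N%:R : R) a * powR (N%:R : R) e = powR (N%:R : R) (a + e).
Proof. by move=> N0; rewrite powRD // pnatr_eq0 -lt0n N0 implybT. Qed.

Lemma powR_nat_ge1 N a : (0 < N)%N -> 0 <= a -> 1 <= powR (N%:R : R) a.
Proof. by move=> N0 a0; rewrite -[X in X <= _](powRr0 (N%:R : R)) ler_powR // ler1n. Qed.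

Lemma powR_nat_near a (A : R) : 0 < a -> \forall N \near \oo, A <= powR (N%:R : R) a.
Proof.
move=> a0; near=> N.
have h : powR `|A| a^-1 <= N%:R :> R by near: N; exact: nbhs_infty_ger.
apply: (le_trans (ler_norm A)).
have -> : `|A| = powR (powR `|A| a^-1) a by rewrite -powRrM mulVf ?gt_eqF // powRr1.
by apply: ge0_ler_powR; rewrite ?nnegrE ?powR_ge0 // ltW.
Unshelve. all: by end_near.
Qed.

Lemma Phi_le N (kappa delta eta b : R) : (0 < N)%N ->
  b <= kappa / 2 -> b <= delta / 2 -> powR N%:R (delta - 1) <= eta ->
  Phi N (powR N%:R kappa) eta <= 2 * powR N%:R (- b).
Proof.
move=> N0 bk bd he; have NR0 : 0 < (N%:R : R) by rewrite ltr0n.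
have NR1 : 1 <= (N%:R : R) by rewrite ler1n.
have sqrtN (x : R) : Num.sqrt (powR (N%:R : R) x) = powR N%:R (x / 2).
  by rewrite -powR12_sqrt ?powR_ge0 // -powRrM.
rewrite /Phi [2 * _]mulr_natl mulr2n powRN; apply: lerD.
  by rewrite sqrtN lef_pV2 ?posrE ?powR_gt0 // ler_powR.
have h : powR N%:R delta <= N%:R * eta.
  apply: le_trans (ler_wpM2l (ltW NR0) he).
  by rewrite -{2}(powRr1 (ltW NR0)) powR_natM // addrC subrK.
apply: (@le_trans _ _ (powR N%:R (delta / 2))^-1).
  rewrite lef_pV2 ?posrE ?powR_gt0 //; last first.
    by rewrite sqrtr_gt0 (lt_le_trans _ h) // powR_gt0.
  by rewrite -sqrtN ler_wsqrtr.
by rewrite lef_pV2 ?posrE ?powR_gt0 // ler_powR.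
Qed.

(** The failure probability of the good event at all grid points together; it is
    beaten by one term of the exponential series of high enough degree. *)
Lemma exp_beats_powers e (D : R) : 0 < e ->
  \forall N \near \oo, ((N ^ 6).+1)%:R * (16 * N%:R ^+ 2 * expR ((1 - powR N%:R e) / 2))
     <= powR (N%:R : R) (- D).
Proof.
move=> e0.
have [m hm] : exists m : nat, D + 9 <= e * m.+1%:R.
  exists (Num.bound ((D + 9) / e)); rewrite mulrC -ler_pdivrMr // ltW //.
  have [x0|x0] := leP 0 ((D + 9) / e).
    by rewrite (lt_trans (archi_boundP x0)) // ltr_nat.
  by rewrite (lt_le_trans x0).
pose B : R := 32 * expR (1 / 2) * (2 ^+ m.+1 * (m.+1)`!%:R).
near=> N.
have N0 : (0 < N)%N by near: N; exact: nbhs_infty_gt.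
have NR0 : 0 < (N%:R : R) by rewrite ltr0n.
have NR1 : 1 <= (N%:R : R) by rewrite ler1n.
have hB : B <= N%:R by near: N; exact: nbhs_infty_ger.
set t := powR (N%:R : R) e.
have t0 : 0 < t by rewrite powR_gt0.
have f0 : 0 < ((m.+1)`!%:R : R) by rewrite ltr0n fact_gt0.
have ht : powR N%:R D * N%:R ^+ 9 <= t ^+ m.+1.
  have -> : t ^+ m.+1 = powR N%:R (e * m.+1%:R) by rewrite powRrM powR_mulrn // ltW.
  have -> : N%:R ^+ 9 = powR (N%:R : R) 9 by rewrite (powR_mulrn 9 (ltW NR0)).
  by rewrite powR_natM // ler_powR.
have hexp : t ^+ m.+1 <= expR (t / 2) * (2 ^+ m.+1 * (m.+1)`!%:R).
  have := @expR_ge1Dxn R (t / 2) m (ltW (divr_gt0 t0 (ltr0Sn _ 1))).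
  rewrite expr_div_n => /(le_trans _) h.
  have : t ^+ m.+1 / 2 ^+ m.+1 / (m.+1)`!%:R <= expR (t / 2) by apply: h; rewrite lerDr.
  rewrite ler_pdivrMr // ler_pdivrMr ?exprn_gt0 // => /le_trans; apply.
  by rewrite -mulrA [X in _ * X]mulrC.
have -> : expR ((1 - t) / 2) = expR (1 / 2) * (expR (t / 2))^-1.
  by rewrite -expRN -expRD; congr expR; ring.
have E0 : 0 < expR (t / 2) by exact: expR_gt0.
rewrite powRN -[X in _ <= X]mul1r ler_pdivlMr ?powR_gt0 //.
set x := powR (N%:R : R) D in ht *.
have x0 : 0 < x by rewrite powR_gt0.
have hN6 : ((N ^ 6).+1)%:R <= 2 * N%:R ^+ 6 :> R.
  by rewrite -natr1 natrX mulr_natl mulr2n lerD2l expr_ge1.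
set F := 2 ^+ m.+1 * (m.+1)`!%:R in hexp.
have F0 : 0 < F by rewrite mulr_gt0 // exprn_gt0.
apply: (@le_trans _ _ (2 * N%:R ^+ 6 * (16 * N%:R ^+ 2 * (expR (1 / 2) / expR (t / 2))) * x)).
  apply: ler_wpM2r; first exact: ltW.
  by apply: ler_wpM2r.
have -> : 2 * N%:R ^+ 6 * (16 * N%:R ^+ 2 * (expR (1 / 2) / expR (t / 2))) * x
   = (32 * expR (1 / 2)) * (x * N%:R ^+ 9) / (N%:R * expR (t / 2)).
  by field; rewrite (gt_eqF NR0) (gt_eqF E0).
rewrite ler_pdivrMr ?mulr_gt0 // [X in _ <= X]mul1r.
have K0 : 0 <= 32 * expR (1 / 2) :> R by rewrite mulr_ge0 ?expR_ge0.
apply: (le_trans (ler_wpM2l K0 (le_trans ht hexp))).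
have -> : 32 * expR (1 / 2) * (expR (t / 2) * F) = B * expR (t / 2) by rewrite /B /F; ring.
by rewrite ler_wpM2r ?expR_ge0.
Unshelve. all: by end_near.
Qed.

(** The large deviation parameter is a small power of [N]: small enough for the
    losses [t^3] to be absorbed by [N^eps] and by the decay of [Phi]. *)
Lemma choose_scale (r : nat) (kappa delta eps D K tau : R) :
  0 < kappa -> 0 < delta -> 0 < eps -> 1 <= K -> 0 < tau ->
  exists e : R, \forall N \near \oo, (0 < N)%N ->
  [/\ K <= powR N%:R e,
      forall eta, powR N%:R (delta - 1) <= eta ->
        powR N%:R e ^+ 3 * Phi N (powR N%:R kappa) eta <= tau,
      10 * r%:R <= tau * N%:R,
      K * powR N%:R e ^+ 3 <= powR N%:R eps &
      ((N ^ 6).+1)%:R * (16 * N%:R ^+ 2 * expR ((1 - powR N%:R e) / 2))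
        <= powR (N%:R : R) (- D)].
Proof.
move=> k0 d0 ep0 K1 tau0.
pose b := Num.min kappa delta / 2.
have b0 : 0 < b by rewrite divr_gt0 // lt_min k0.
have bk : b <= kappa / 2 by rewrite ler_pM2r // ge_min lexx.
have bd : b <= delta / 2 by rewrite ler_pM2r // ge_min lexx orbT.
pose e := Num.min b eps / 6.
have e0 : 0 < e by rewrite divr_gt0 // lt_min b0.
have eb : e * 3 <= b / 2.
  have : Num.min b eps <= b by rewrite ge_min lexx.
  rewrite /e; lra.
have ee : e * 3 <= eps / 2.
  have : Num.min b eps <= eps by rewrite ge_min lexx orbT.
  rewrite /e; lra.
exists e; near=> N => N0.
have NR0 : 0 < (N%:R : R) by rewrite ltr0n.
have NR1 : 1 <= (N%:R : R) by rewrite ler1n.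
have t3 : powR (N%:R : R) e ^+ 3 = powR N%:R (e * 3).
  by rewrite -powR_mulrn ?powR_ge0 // -powRrM.
split.
- by near: N; exact: powR_nat_near.
- move=> eta heta; rewrite t3.
  apply: (le_trans (ler_wpM2l (powR_ge0 _ _) (Phi_le N0 bk bd heta))).
  rewrite mulrCA powR_natM //.
  apply: (@le_trans _ _ (2 * powR N%:R (- (b / 2)))).
    by rewrite ler_wpM2l // ler_powR //; lra.
  rewrite powRN ler_pdivrMr ?powR_gt0 // mulrC -ler_pdivrMr //.
  by near: N; apply: powR_nat_near; rewrite divr_gt0.
- rewrite [tau * _]mulrC -ler_pdivrMr //.
  by near: N; exact: nbhs_infty_ger.
- rewrite t3.
  have hK : K <= powR (N%:R : R) (eps / 2).
    by near: N; apply: powR_nat_near; rewrite divr_gt0.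
  apply: (@le_trans _ _ (powR N%:R (eps / 2) * powR N%:R (eps / 2))).
    by apply: ler_pM; rewrite ?powR_ge0 ?(le_trans ler01 K1) // ler_powR.
  by rewrite powR_natM // -splitr.
- by near: N; exact: exp_beats_powers.
Unshelve. all: by end_near.
Qed.

End Asymptotics.

Theorem theorem7p1 (R : realType) (r : nat) (M kappa : R) (N0 : nat)
    (gamma : forall N : nat, 'I_r -> 'I_N -> R)
    (d : nat -> measure_display) (T : forall N : nat, measurableType (d N))
    (P : forall N : nat, probability (T N) R)
    (h : forall N : nat, 'I_N -> 'I_N -> {RV (P N) >-> R})
    (u : nat -> R[i] -> 'I_r -> R[i])
    (I : set R) (delta : R)
    (hr : (1 <= r)%N) (hM : 0 < M) (hkappa : 0 < kappa <= 1 / 2)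
    (hN0 : (1 <= N0)%N)
    (hgamma1 : forall N : nat, (N0 <= N)%N ->
       forall (k : 'I_r) (i : 'I_N), 1 <= gamma N k i)
    (hgammaM : forall N : nat, (N0 <= N)%N ->
       N%:R^-1 * (\sum_(k < r) \sum_(i < N) gamma N k i ^+ 2) <= M)
    (hs : forall N : nat, (N0 <= N)%N ->
       forall i j : 'I_N, N%:R `^ kappa * profile (gamma N) i j <= 1)
    (hu : forall N : nat, (N0 <= N)%N -> solves_system (gamma N) (u N))
    (hH : forall N : nat, (N0 <= N)%N ->
       centered_adjacency (N%:R `^ kappa) (profile (gamma N)) (h N))
    (hI : bulk_interval N0 gamma u I)
    (hdelta : 0 < delta) :
  stoch_dom P (spectral_domain I delta)
    (fun N z w => Lambda (gamma N) (u N) (sample_matrix (h N) w) z)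
    (fun N z _ => Phi N (N%:R `^ kappa) (complex.Im z)).
Proof.
move=> eps D eps0 D0.
have [_ bI [c c0 hc]] := hI.
have /pinfty_ex_gt0[Eb _ hEb] := bI.
have Mt1 : 1 <= r%:R * M.
  exact: (Mt_ge1 hr hN0 (hgamma1 N0 (leqnn _)) (hgammaM N0 (leqnn _))).
have [K [tau [K1 tau0 VB]]] := vertical_bootstrap Eb hr Mt1 c0.
have /andP[k0 k2] := hkappa.
have [e he] := choose_scale r D k0 hdelta eps0 K1 tau0.
near=> N.
have NN0 : (N0 <= N)%N by near: N; exact: nbhs_infty_ge.
have Npos : (0 < N)%N by exact: leq_trans NN0.
have NR0 : 0 < (N%:R : R) by rewrite ltr0n.
have NR1 : 1 <= (N%:R : R) by rewrite ler1n.
have [tK tPhi hrN tEps tD] :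
  [/\ K <= powR N%:R e,
      forall eta, powR N%:R (delta - 1) <= eta ->
        powR N%:R e ^+ 3 * Phi N (powR N%:R kappa) eta <= tau,
      10 * r%:R <= tau * N%:R,
      K * powR N%:R e ^+ 3 <= powR N%:R eps &
      ((N ^ 6).+1)%:R * (16 * N%:R ^+ 2 * expR ((1 - powR N%:R e) / 2))
        <= powR (N%:R : R) (- D)].
  by move: Npos; near: N.
set t := powR N%:R e in tK tPhi tEps tD.
set q := N%:R `^ kappa.
have q1 : 1 <= q by rewrite powR_nat_ge1 // ltW.
have q0 : 0 < q by exact: lt_le_trans q1.
have qN : q ^+ 2 <= N%:R.
  rewrite expr2 /q powR_natM // -[X in _ <= X](powRr1 (ltW NR0)) ler_powR //; lra.
have mok : model_ok (gamma N) M q.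
  split; [exact: Npos|exact: hgamma1|exact: hgammaM|exact: q1|].
  by split; [exact: qN|exact: hs].
have t0 : 0 <= t by exact: powR_ge0.
apply: ge_ereal_sup => _ [z [Iz /andP[zlow zup]] <-].
set s := profile (gamma N).
have s_sym i j : s i j = s j i by exact: profile_sym.
have s_ge0 i j : 0 <= s i j by exact: profile_ge0 (hgamma1 N NN0) i j.
have qs i j : q * s i j <= 1 by exact: hs.
have z0 : 0 < complex.Im z by apply: lt_le_trans zlow; rewrite powR_gt0.
have hHN := hH N NN0.
pose bad (H : 'M[R]_N) := (N%:R `^ eps * Phi N q (complex.Im z) < `|Lambda (gamma N) (u N) H z|)%R.
have mbad : measurable [set w | bad (sample_matrix (h N) w)].
  rewrite -[X in measurable X]setTI.
  have mL : measurable_fun setT (fun w => `|Lambda (gamma N) (u N) (sample_matrix (h N) w) z|).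
    apply: measurableT_comp => //; apply: measurable_Lambda => //.
      exact: sample_matrix_sym hHN.
    by move=> i j; under eq_fun do rewrite mxE; exact: measurable_funPT.
  have := @measurable_fun_ltr _ _ _ setT (fun=> N%:R `^ eps * Phi N q (complex.Im z)) _
     (measurable_cst _) mL.
  have mtrue : measurable [set true] by [].
  move=> /(_ measurableT [set true] mtrue).
  by congr (measurable (_ `&` _)).
apply: le_trans (transfer s_ge0 q0 qs hHN (bad := fun H => bad H) mbad) _.
rewrite lee_fin; apply: le_trans tD.
have w_ge0 := edge_weight_ge0 s_ge0 q0 qs.
(* On the good event at every grid point the bound holds, so that the bad event
   forces a failure at one of them. *)
pose zk k := vertical_grid (complex.Re z) (complex.Im z) (N ^ 6) k.
pose B (k : 'I_(N ^ 6).+1) (w : {ffun 'I_N * 'I_N -> bool}) :=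
  ~~ `[< good_event s q (config_mx s q w) (zk k) t >].
apply: (@le_trans _ _ (proba (edge_weight s q) (fun w => [exists k, true && B k w]))).
  apply: proba_sub => // w /asboolP; apply: contraPT => /existsPn hB.
  apply/negP; rewrite -leNgt ger0_norm ?Lambda_ge0 //.
  have hgood k : (k <= N ^ 6)%N -> good_event s q (config_mx s q w) (zk k) t.
    move=> kn; have := hB (Ordinal (n := (N ^ 6).+1) kn).
    by rewrite /B /= negbK => /asboolP.
  have zE : z = Complex (complex.Re z) (complex.Im z) by case: (z).
  have hm : matrix_ok q (config_mx s q w).
    by split; [exact: config_mx_sym|move=> i j; exact: config_mx_norm].
  have hb (z' : R[i]) : complex.Re z' = complex.Re z -> 0 < complex.Im z' <= 1 ->
      c < complex.Im (msol (gamma N) (u N) z').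
    by move=> rE; apply: hc => //; rewrite rE.
  have etaN : N%:R^-1 <= complex.Im z.
    apply: le_trans zlow; rewrite -(powR_inv1 (ltW NR0)) ler_powR //; lra.
  have := VB N (gamma N) q (config_mx s q w) t (complex.Re z) (complex.Im z) (u N)
    mok hm (hu N NN0) hb (hEb _ Iz) etaN zup hgood tK (tPhi _ zlow) hrN.
  rewrite -zE => /le_trans; apply; rewrite mulrA ler_wpM2r //.
  by rewrite addr_ge0 ?invr_ge0 ?sqrtr_ge0.
apply: (le_trans (proba_bigunion w_ge0 _ _)).
apply: (@le_trans _ _ (\sum_(k < (N ^ 6).+1) 16 * N%:R ^+ 2 * expR ((1 - t) / 2))).
  apply: ler_sum => k _; apply: good_event_proba => //.
  apply: lt_le_trans z0 _; apply: vertical_grid_Im_ge => //; first by rewrite expn_gt0 Npos.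
  by rewrite -ltnS.
by rewrite sumr_const card_ord -[X in X <= _]mulr_natl.
Unshelve. all: by end_near.
Qed.
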